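(* Let $p$ be a prime number. For all natural numbers $n\ge 1$, the morphism ${}^p\mathrm{JW}_n^{\mathbb{Q}}\in TL_n(2)$ (the rational $p$-Jones-Wenzl element on $n$ strands) is an idempotent. Furthermore, if one expresses ${}^p\mathrm{JW}_n^{\mathbb{Q}}$ in the $\mathbb{Q}$-basis of $(n,n)$-crossingless matchings and writes each of its coefficients as an irreducible fraction $a/b$, then $p$ does not divide $b$.
   Context: Temperley-Lieb category. An $(m,n)$-crossingless matching is an equivalence class (same pairing of marked points) of planar diagrams in a rectangle with $m$ and $n$ marked points on two opposite horizontal edges, consisting of $(m+n)/2$ pairwise non-intersecting curves in the rectangle pairing up the marked points. $\mathcal{TL}(2)$ is the strict monoidal $\mathbb{Q}$-linear category with objects $0,1,2,\dots$, with $\mathrm{Hom}(m,n)$ zero if $m-n$ is odd and otherwise the $\mathbb{Q}$-vector space with basis the crossingless matchings between $m$ and $n$ points; composition $g\circ f$ is vertical stacking ($g$ on top of $f$), each closed loop being removed and replaced by the scalar $-2$; tensor product is addition on objects and horizontal juxtaposition on morphisms. $TL_n(2)=\mathrm{End}_{\mathcal{TL}(2)}(n)$. The bar $\overline{\phantom{f}}$ denotes the contravariant $\mathbb{Q}$-linear flip functor, the identity on objects, flipping diagrams upside down. $\mathrm{id}_m$ is the identity of $m$. Let $\mathrm{cap}_m\in\mathrm{Hom}(2m,0)$ denote the diagram of $m$ nested arcs (pairing point $j$ with point $2m+1-j$). Jones-Wenzl projector. $\mathrm{JW}_n$ is the unique non-zero idempotent of $TL_n(2)$ with $e_i\circ\mathrm{JW}_n=\mathrm{JW}_n\circ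 e_i=0$ for $1\le i\le n-1$, where $e_i$ is the diagram with a cup and a cap at positions $i,i+1$ and vertical strands elsewhere. $p$-support and $p$-father. Let $n\ge 1$ and let $n+1=a_rp^r+\dots+a_1p+a_0$ be the $p$-adic expansion ($a_r\ne 0$). Then $\mathrm{supp}_p(n)=\{a_rp^r\pm a_{r-1}p^{r-1}\pm\dots\pm a_1p\pm a_0\}$ and $I_n=\mathrm{supp}_p(n)-1=\{j-1: j\in \mathrm{supp}_p(n)\}$. If $n+1$ has exactly one non-zero digit, $n$ is called a $p$-Adam. Otherwise, if $a_s$ is the non-zero digit of smallest index $s$, the $p$-father of $n$ is $f[n]=\big(\sum_{i=s+1}^{r}a_ip^i\big)-1$. Rational $p$-Jones-Wenzl element. ${}^p\mathrm{JW}_n^{\mathbb{Q}}=\sum_{i\in I_n}\lambda_n^i\,U_n^i$ with $U_n^i=\overline{p_n^i}\circ \mathrm{JW}_i\circ p_n^i$, where $\lambda_n^i\in\mathbb{Q}$ and $p_n^i\in\mathrm{Hom}(n,i)$ are defined by induction on the number of non-zero digits of $n+1$: if $n$ is a $p$-Adam, then $I_n=\{n\}$, $\lambda_n^n=1$, $p_n^n=\mathrm{id}_n$, so ${}^p\mathrm{JW}_n^{\mathbb{Q}}=\mathrm{JW}_n$. If $n$ is not a $p$-Adam, put $m=n-f[n]$; then $I_n=(I_{f[n]}-m)\sqcup(I_{f[n]}+m)$, and for $i\in I_{f[n]}$: $$\lambda_n^{i+m}=\lambda_{f[n]}^i,\qquad p_n^{i+m}=p_{f[n]}^i\otimes \mathrm{id}_m,$$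 $$\lambda_n^{i-m}=(-1)^m\,\frac{i+1-m}{i+1}\,\lambda_{f[n]}^i,\qquad p_n^{i-m}=(\mathrm{id}_{i-m}\otimes \mathrm{cap}_m)\circ\big((\mathrm{JW}_i\circ p_{f[n]}^i)\otimes\mathrm{id}_m\big).$$ *)

(* Defs.v *)
(* MathComp; JW below is chosen by the classical choice of mathcomp.classical. *)
From HB Require Import structures.
From mathcomp Require Import all_boot all_order all_algebra.
From mathcomp Require Import boolp classical_sets.
From mathcomp Require Import zify.

Set Implicit Arguments.
Unset Strict Implicit.
Unset Printing Implicit Defensive.

Import GRing.Theory.

Local Open Scope ring_scope.

Notation point m n := ('I_m + 'I_n)%type.

(* [inl i] is the i-th marked point of the bottom edge and [inr j] the j-th one
   of the top edge, both counted from 0, left to right. [pos] lists the points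
   counterclockwise along the boundary of the rectangle: bottom edge from left
   to right, then top edge from right to left. *)
Definition pos m n (x : point m n) : nat :=
  match x with inl i => i | inr j => m + (n - j.+1) end.

(* A pairing of the marked points is a fixed-point-free involution. It is
   realized by disjoint curves in the rectangle iff no two of its pairs are
   interleaved along the boundary. *)
Definition crossingless m n (f : {ffun point m n -> point m n}) : bool :=
  [&& [forall x, f (f x) == x],
      [forall x, f x != x] &
      [forall x, forall y, ~~ [&& pos x < pos y, pos y < pos (f x)
                                & pos (f x) < pos (f y)]%N]].

Record matching m n := Matching {
  pairing :> {ffun point m n -> point m n};
  _ : crossingless pairing }.

HB.instance Definition _ m n := [isSub for @pairing m n].
HB.instance Definition _ m n := [Equality of matching m n by <:].
HB.instance Definition _ m n := [Choice of matching m n by <:].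
HB.instance Definition _ m n := [Countable of matching m n by <:].
HB.instance Definition _ m n := [Finite of matching m n by <:].

Lemma crossinglessP m n (f : {ffun point m n -> point m n}) :
  reflect [/\ forall x, f (f x) = x, forall x, f x <> x &
              forall x y, ~ [/\ pos x < pos y, pos y < pos (f x)
                              & pos (f x) < pos (f y)]%N]
          (crossingless f).
Proof.
apply: (iffP and3P) => -[f1 f2 f3]; split.
- by move=> x; apply/eqP/(forallP f1).
- by move=> x; apply/eqP/(forallP f2).
- by move=> x y [xy yf ff]; have /forallP/(_ y) := forallP f3 x; rewrite xy yf ff.
- by apply/forallP => x; apply/eqP.
- by apply/forallP => x; apply/eqP.
- apply/forallP => x; apply/forallP => y; apply/negP => /and3P[*].
  by apply: (f3 x y).
Qed.

Definition id_pairing m : {ffun point m m -> point m m} :=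
  [ffun x => match x with inl i => inr i | inr i => inl i end].

Lemma id_crossingless m : crossingless (id_pairing m).
Proof.
apply/crossinglessP; split=> [[]i|[]i|[]i []j]; rewrite !ffunE //=.
all: by case=> *; have := ltn_ord i; have := ltn_ord j => *; lia.
Qed.

Definition id_matching m : matching m m := Matching (id_crossingless m).

Definition cap_pairing m : {ffun point m.*2 0 -> point m.*2 0} :=
  [ffun x => match x with inl i => inl (rev_ord i) | inr i => inr i end].

Lemma cap_crossingless m : crossingless (cap_pairing m).
Proof.
apply/crossinglessP; split=> [[]i|[]i|[]i []j]; rewrite !ffunE /=;
  try by case: i.
- by rewrite rev_ordK.
- by case=> /(congr1 val) /=; have := ltn_ord i => *; lia.
- by case=> *; have := ltn_ord i; have := ltn_ord j => *; lia.
- by case: j.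
Qed.

Definition cap_matching m : matching m.*2 0 := Matching (cap_crossingless m).

(* The diagram e_i, on the adjacent positions i and j = i + 1. *)
Definition cupcap_pairing n (i j : 'I_n) : {ffun point n n -> point n n} :=
  [ffun x => match x with
   | inl k => if k == i then inl j else if k == j then inl i else inr k
   | inr k => if k == i then inr j else if k == j then inr i else inl k
   end].

Lemma cupcap_crossingless n (i j : 'I_n) :
  j = i.+1 :> nat -> crossingless (cupcap_pairing i j).
Proof.
move=> ij; have ji : (j == i) = false by apply/eqP => /(congr1 val) /=; lia.
apply/crossinglessP; split.
- case=> k; rewrite !ffunE; case: (eqVneq k i) => [->|ki];
    rewrite ?ffunE ?ji ?eqxx //; case: (eqVneq k j) => [->|kj];
    by rewrite ?ffunE ?eqxx ?(negPf ki) ?(negPf kj).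
- case=> k; rewrite !ffunE; case: (eqVneq k i) => [->|ki];
    try (by case=> /eqP; rewrite ji);
    by case: (eqVneq k j) => // -> [] /eqP; rewrite eq_sym ji.
- move=> x y; rewrite !ffunE.
  have hi := ltn_ord i; have hj := ltn_ord j.
  case: x => x; case: y => y; have hx := ltn_ord x; have hy := ltn_ord y.
  all: rewrite -!val_eqE /=; do !case: ifP => /= ?; case=> *; lia.
Qed.

Definition cupcap_matching n (i j : 'I_n) (ij : j = i.+1 :> nat) :
  matching n n := Matching (cupcap_crossingless ij).

Definition flip_point m n (x : point m n) : point n m :=
  match x with inl i => inr i | inr j => inl j end.

Definition flip_pairing m n (f : {ffun point m n -> point m n}) :
  {ffun point n m -> point n m} :=
  [ffun x => flip_point (f (flip_point x))].

Lemma flip_crossingless m n (f : matching m n) : crossingless (flip_pairing f).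
Proof.
case: f => f /= /crossinglessP[f1 f2 f3].
have fpK m' n' : cancel (@flip_point m' n') (@flip_point n' m') by case.
have posf m' n' (x : point m' n') : (pos (flip_point x) + pos x).+1 = (m' + n')%N.
  by case: x => i /=; have := ltn_ord i => *; lia.
apply/crossinglessP; split=> [x|x|x y]; rewrite !ffunE.
- by rewrite fpK f1 fpK.
- by move/(congr1 (@flip_point _ _)); rewrite fpK; apply: f2.
- have := posf _ _ x; have := posf _ _ y.
  have := posf _ _ (f (flip_point x)); have := posf _ _ (f (flip_point y)).
  move=> h1 h2 h3 h4 [h5 h6 h7].
  apply: (f3 (f (flip_point y)) (f (flip_point x))); rewrite !f1.
  by split; lia.
Qed.

Definition flip_matching m n (f : matching m n) : matching n m :=
  Matching (flip_crossingless f).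

Section Juxtaposition.
Variables m n m' n' : nat.

Definition left_point (x : point m n) : point (m + m') (n + n') :=
  match x with inl i => inl (lshift m' i) | inr j => inr (lshift n' j) end.

Definition right_point (x : point m' n') : point (m + m') (n + n') :=
  match x with inl i => inl (rshift m i) | inr j => inr (rshift n j) end.

Definition split_point (x : point (m + m') (n + n')) :
    (point m n + point m' n')%type :=
  match x with
  | inl i => match split i with inl a => inl (inl a) | inr b => inr (inl b) end
  | inr j => match split j with inl a => inl (inr a) | inr b => inr (inr b) end
  end.

Definition juxt_pairing (f : {ffun point m n -> point m n})
    (g : {ffun point m' n' -> point m' n'}) :
    {ffun point (m + m') (n + n') -> point (m + m') (n + n')} :=
  [ffun x => match split_point x with
             | inl u => left_point (f u)
             | inr v => right_point (g v)
             end].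

Lemma split_left x : split_point (left_point x) = inl x.
Proof. by case: x => i /=; rewrite (unsplitK (inl i)). Qed.

Lemma split_right x : split_point (right_point x) = inr x.
Proof. by case: x => i /=; rewrite (unsplitK (inr i)). Qed.

Variant point_spec : point (m + m') (n + n') -> Type :=
| LeftPoint u : point_spec (left_point u)
| RightPoint v : point_spec (right_point v).

Lemma pointP x : point_spec x.
Proof.
case: x => i; rewrite -(splitK i); case: (split i) => a /=.
- exact: (LeftPoint (inl a)).
- exact: (RightPoint (inl a)).
- exact: (LeftPoint (inr a)).
- exact: (RightPoint (inr a)).
Qed.

Lemma juxt_crossingless (f : matching m n) (g : matching m' n') :
  crossingless (juxt_pairing f g).
Proof.
case: f => f /= /crossinglessP[f1 f2 f3].
case: g => g /= /crossinglessP[g1 g2 g3].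
have posL (x : point m n) :
    pos (left_point x) = (if pos x < m then pos x else m' + n' + pos x)%N.
  by case: x => i /=; have := ltn_ord i; case: ifP => *; lia.
have posR (x : point m' n') : pos (right_point x) = (m + pos x)%N.
  by case: x => i /=; have := ltn_ord i => *; lia.
have posB (x : point m' n') : (pos x < m' + n')%N.
  by case: x => i /=; have := ltn_ord i => *; lia.
apply/crossinglessP; split=> [x|x|x y]; rewrite !ffunE.
- by case: (pointP x) => u;
    rewrite ?split_left ?split_right ?f1 ?g1.
- case: (pointP x) => u; rewrite ?split_left ?split_right.
  + by move/(congr1 split_point); rewrite !split_left => -[/f2].
  + by move/(congr1 split_point); rewrite !split_right => -[/g2].
- case: (pointP x) => u; case: (pointP y) => v;
    rewrite ?split_left ?split_right ?posL ?posR.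
  + by do !case: ifP => ?; case=> *; apply: (f3 u v); split; lia.
  + by have := posB v; have := posB (g v); do !case: ifP => ?; move=> ? ? []; lia.
  + by have := posB u; have := posB (g u); do !case: ifP => ?; move=> ? ? []; lia.
  + by case=> *; apply: (g3 u v); split; lia.
Qed.

Definition juxt_matching (f : matching m n) (g : matching m' n') :
  matching (m + m') (n + n') := Matching (juxt_crossingless f g).

End Juxtaposition.

Section Stacking.
Variables m n k : nat.

(* The marked points of g stacked on top of f: the bottom edge of f, the common
   edge, and the top edge of g. *)
Definition spoint := (point m n + 'I_k)%type.

Definition low_point (x : point m n) : spoint := inl x.

Definition high_point (x : point n k) : spoint :=
  match x with inl j => inl (inr j) | inr l => inr l end.

Definition outer_point (x : point m k) : spoint :=
  match x with inl i => inl (inl i) | inr l => inr l end.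

Variables (g : matching n k) (f : matching m n).

(* Two points are adjacent when they are the ends of a curve of f or of g; the
   connected components are then the curves of the stacked diagram. *)
Definition stack_rel : rel spoint := fun x y =>
  [exists u, (x == low_point u) && (y == low_point (f u))] ||
  [exists v, (x == high_point v) && (y == high_point (g v))].

(* h is the matching obtained by stacking g on top of f: it pairs the ends of
   the open curves. Exactly one h satisfies this. *)
Definition stacked (h : matching m k) : bool :=
  [forall x, connect stack_rel (outer_point x) (outer_point (h x))].

(* The number of curves meeting neither outer edge. *)
Definition loops : nat :=
  n_comp stack_rel [pred x | [forall y, ~~ connect stack_rel x (outer_point y)]].

End Stacking.

(* The vector space with basis the matchings: a morphism is given by its
   coefficients in this basis. It is zero when m - n is odd, as there are then
   no matchings. *)
Notation Hom m n := {ffun matching m n -> rat^o}.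

Definition diagram m n (f : matching m n) : Hom m n :=
  [ffun h => (h == f)%:R].

Definition compH m n k (G : Hom n k) (F : Hom m n) : Hom m k :=
  [ffun h => \sum_(g : matching n k) \sum_(f : matching m n | stacked g f h)
               G g * F f * (-2) ^+ loops g f].

Definition tensH m n m' n' (F : Hom m n) (G : Hom m' n') :
    Hom (m + m') (n + n') :=
  [ffun h => \sum_(f : matching m n)
               \sum_(g : matching m' n' | juxt_matching f g == h) F f * G g].

Definition barH m n (F : Hom m n) : Hom n m :=
  [ffun h => F (flip_matching h)].

Definition idH m : Hom m m := diagram (id_matching m).

Definition capH m : Hom m.*2 0 := diagram (cap_matching m).

(* Transport along equalities m = m' and n = n', which hold in every use below
   that matters; the value is 0 otherwise. *)
Definition castH m n m' n' (F : Hom m n) : Hom m' n' :=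
  match m =P m', n =P n' with
  | ReflectT em, ReflectT en =>
      ecast a (Hom a n') em (ecast b (Hom m b) en F)
  | _, _ => 0
  end.

Lemma castH_id m n (F : Hom m n) : castH m n F = F.
Proof. by rewrite /castH; do 2 case: eqP => // ?; rewrite !eq_axiomK. Qed.

Definition is_JW n (x : Hom n n) : Prop :=
  [/\ x <> 0, compH x x = x &
      forall (i j : 'I_n) (ij : j = i.+1 :> nat),
        compH (diagram (cupcap_matching ij)) x = 0 /\
        compH x (diagram (cupcap_matching ij)) = 0].

(* The unique x such that is_JW x. *)
Definition JW n : Hom n n := xget 0 [set x | is_JW x]%classic.

Section PJonesWenzl.
Variable p : nat.

Definition digit (N i : nat) : nat := ((N %/ p ^ i) %% p)%N.

Definition top_digit (N : nat) : nat := trunc_log p N.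

(* The j in supp_p(n). *)
Definition supp (n : nat) : pred nat := fun j =>
  let r := top_digit n.+1 in
  [exists eps : {ffun 'I_r -> bool},
    j%:Z == (digit n.+1 r * p ^ r)%N%:Z
            + \sum_(i < r) (-1) ^+ eps i * (digit n.+1 i * p ^ i)%N%:Z].

(* I_n = supp_p(n) - 1, where every element of supp_p(n) is positive. *)
Definition shifted_supp (n : nat) : pred nat := fun i => supp n i.+1.

Definition nonzero_digits (N : nat) : nat :=
  count (fun i => digit N i != 0%N) (iota 0 (top_digit N).+1).

(* f[n]; only meaningful when n + 1 has at least two non-zero digits. *)
Definition father (n : nat) : nat :=
  let r := top_digit n.+1 in
  let s := find (fun i => digit n.+1 i != 0%N) (iota 0 r.+1) in
  (\sum_(s.+1 <= i < r.+1) digit n.+1 i * p ^ i)%N.-1.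

(* In lambda_rec and pmor_rec, [k.+1] is the number of non-zero digits of
   n + 1. For n not a p-Adam and m = n - f[n], an index j in I_n is either
   i + m or i - m with i in I_f[n], not both. *)
Fixpoint lambda_rec (k n j : nat) : rat :=
  if k is k'.+1 then
    let f := father n in
    let m := (n - f)%N in
    if (m <= j)%N && shifted_supp f (j - m)%N then lambda_rec k' f (j - m)%N
    else let i := (j + m)%N in
      if shifted_supp f i then
        (-1) ^+ m * ((i.+1%:R - m%:R) / i.+1%:R) * lambda_rec k' f i
      else 0
  else (j == n)%:R.

Definition lambda (n j : nat) : rat :=
  lambda_rec (nonzero_digits n.+1).-1 n j.

Fixpoint pmor_rec (k n j : nat) : Hom n j :=
  if k is k'.+1 then
    let f := father n in
    let m := (n - f)%N in
    if (m <= j)%N && shifted_supp f (j - m)%N then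
      castH n j (tensH (pmor_rec k' f (j - m)%N) (idH m))
    else let i := (j + m)%N in
      if shifted_supp f i then
        castH n j
          (compH (castH (i + m)%N (i - m)%N (tensH (idH (i - m)%N) (capH m)))
                 (tensH (compH (JW i) (pmor_rec k' f i)) (idH m)))
      else 0
  else castH n j (idH n).

Definition pmor (n j : nat) : Hom n j :=
  pmor_rec (nonzero_digits n.+1).-1 n j.

Definition U (n i : nat) : Hom n n :=
  compH (barH (pmor n i)) (compH (JW i) (pmor n i)).

(* Every element of I_n is at most n. *)
Definition pJW (n : nat) : Hom n n :=
  \sum_(i < n.+1 | shifted_supp n i) lambda n i *: U n i.

End PJonesWenzl.

(* Main.v *)
(* A strand stands for the plane Q^2 with its symplectic form, whose loop value
   is -2. Up to signs this turns the diagrams into matrices on tensor powers of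
   Q^2, in such a way that a morphism is zero, or p-integral, as soon as its
   matrix is: the matrix of the crossingless matchings is unitriangular in a
   suitable sense. JW_n becomes the projection onto symmetric tensors.

   By Schur's lemma for the symmetric powers and Wenzl's recursion, iterated to
   decompose JW_i (x) id_m, the summands lambda_n^i U_n^i are orthogonal
   idempotents. Let p^s be the place of the lowest non-zero digit of n + 1, and
   say that j is linked to n if j + 1 = +- (n + 1) modulo 2 p^(s+1). Then the
   element of n is the linked part of the element of f[n], tensored with id_m,
   and for a p-Adam it is the linked part of id_n.

   Taking linked parts preserves integrality. The operators F^(k) E^(k), with
   divided powers, are integral and commute with all our matrices. For k = p^i
   and i <= s their eigenvalues are read off, modulo p, from the base p digits
   of the weights and determine whether j is linked to n. So some polynomial in
   them has eigenvalues 1 on the linked part and 0 elsewhere modulo p, and its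
   p^e-th powers converge p-adically to the projection onto the linked part. *)
From HB Require Import structures.
From mathcomp Require Import all_boot all_order all_algebra.
From mathcomp Require Import fingroup perm cyclic.
From mathcomp Require Import boolp classical_sets.
From mathcomp Require Import zify ring.
Require Import Defs.

Set Implicit Arguments.
Unset Strict Implicit.
Unset Printing Implicit Defensive.

Import Order.TTheory GRing.Theory Num.Theory.

Local Open Scope ring_scope.

(** * Matrices indexed by words *)

(** Two obstacles shape the argument. The summands are not p-integral one by one: for p = 2 and n =
    2 already JW_2 = id + e_1 / 2 is not. Integrality can therefore be shown only for the sum as a
    whole. The factor 2 in the modulus of linkage is a matter of weights: if n + 2 a = j + 2 b, then
    j is linked to n iff a = b or a + (n - b) + 1 = 0 modulo p^(s+1), which base p digits can
    detect.

    The second obstacle is signs. Labellings constant along arcs give the loop value 2 instead of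
    -2. The parity of the number of loops is absorbed in one sign per diagram, and [func] then
    respects composition and flip up to signs that depend on the objects only. These do no harm
    except in [U], where a morphism is composed with its flip: there they amount to (-1)^r for r
    caps, and the factors (-1)^m of [lambda] cancel exactly this.

    As matrices determine morphisms, the laws of diagrams that are needed, such as those of the
    identity, are read off from matrices instead of being proved by moving curves. *)

(* A matrix whose rows (inputs) and columns (outputs) are indexed by words,
   i.e. a linear map between tensor powers of Q^2. *)
Definition kernel := seq bool -> seq bool -> rat.

Fixpoint words n : seq (seq bool) :=
  if n is n'.+1 then
    [seq false :: x | x <- words n'] ++ [seq true :: x | x <- words n']
  else [:: [::]].

Lemma mem_words n x : (x \in words n) = (size x == n).
Proof.
elim: n x => [|n IH] [|c x] //=; rewrite mem_cat.
- by apply/negP => /orP[] /mapP[].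
- rewrite eqSS -IH; case: c.
  + rewrite (_ : _ \in [seq false :: _ | _ <- _] = false) /=; last by apply/mapP => -[].
    by rewrite mem_map // => ? ? [].
  + rewrite orbC (_ : _ \in [seq true :: _ | _ <- _] = false) /=; last by apply/mapP => -[].
    by rewrite mem_map // => ? ? [].
Qed.

Lemma uniq_words n : uniq (words n).
Proof.
elim: n => //= n IH; rewrite cat_uniq !map_inj_uniq ?IH ?andbT /=; try by move=> ? ? [].
by apply/hasP => -[_ /mapP[x _ ->]] /mapP[].
Qed.

Lemma words_cons (V : nmodType) n (G : seq bool -> V) :
  \sum_(x <- words n.+1) G x =
  \sum_(x <- words n) G (false :: x) + \sum_(x <- words n) G (true :: x).
Proof. by rewrite /= big_cat !big_map. Qed.

Lemma words_flip n (V : nmodType) (G : seq bool -> V) :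
  \sum_(x <- words n.+1) G x =
  \sum_(x <- words n) (G (true :: x) + G (false :: x)).
Proof. by rewrite words_cons addrC big_split. Qed.

Lemma words_delta n (V : nmodType) x (G : seq bool -> V) : size x = n ->
  (forall y, size y = n -> y != x -> G y = 0) -> \sum_(y <- words n) G y = G x.
Proof.
move=> sx G0; rewrite (bigD1_seq x) ?uniq_words ?mem_words ?sx //= big_seq_cond big1 ?addr0 //.
by move=> y; rewrite mem_words => /andP[/eqP sy yx]; apply: G0.
Qed.

Lemma eq_words n (V : nmodType) (G H : seq bool -> V) :
  (forall x, size x = n -> G x = H x) ->
  \sum_(x <- words n) G x = \sum_(x <- words n) H x.
Proof. by move=> GH; apply: eq_big_seq => x; rewrite mem_words => /eqP/GH. Qed.

(** Rows being inputs, [kmul n K L] applies K first. The middle length n is an argument because a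
    kernel is indexed by words of all lengths. *)
Definition kmul n (K L : kernel) : kernel :=
  fun x z => \sum_(y <- words n) K x y * L y z.
Definition ktr (K : kernel) : kernel := fun x y => K y x.
Definition kadd (K L : kernel) : kernel := fun x y => K x y + L x y.
Definition kscale (c : rat) (K : kernel) : kernel := fun x y => c * K x y.
Definition kid n : kernel := fun x y => ((size x == n) && (x == y))%:R.

(** Source and target are a predicate and not a type, so that equality of kernels is plain equality
    and no transport between lengths arises. *)
Definition homk m n (K : kernel) :=
  forall x y, K x y != 0 -> size x = m /\ size y = n.

Lemma kernelP (K L : kernel) : (forall x y, K x y = L x y) -> K = L.
Proof. by move=> KL; apply/funext => x; apply/funext => y. Qed.

Arguments words n%_N.
Arguments kmul n%_N K L x y.
Arguments kid n%_N x y.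
Arguments homk m%_N n%_N K.

Lemma homk_eq m n (K L : kernel) : homk m n K -> homk m n L ->
  (forall x y, size x = m -> size y = n -> K x y = L x y) -> K = L.
Proof.
move=> hK hL KL; apply: kernelP => x y.
case: (eqVneq (size x) m) (eqVneq (size y) n) => [sx|sx] [sy|sy]; first exact: KL.
all: by have [/hK[] *|/negPn/eqP->] := boolP (K x y != 0);
  have [/hL[] *|/negPn/eqP->] := boolP (L x y != 0) => //; lia.
Qed.

Lemma homk0 m n K x y : homk m n K -> (size x != m) || (size y != n) -> K x y = 0.
Proof. by move=> hK; have [/hK[-> ->]|/negPn/eqP-> //] := boolP (K x y != 0); rewrite !eqxx. Qed.

Lemma kmulA m n (K L M : kernel) :
  kmul m K (kmul n L M) = kmul n (kmul m K L) M.
Proof.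
apply: kernelP => x z; rewrite /kmul.
under eq_bigr do rewrite mulr_sumr /=.
rewrite exchange_big /=; apply: eq_bigr => y _; rewrite mulr_suml /=.
by apply: eq_bigr => w _; rewrite mulrA.
Qed.

Lemma kmulDl n K L M : kmul n (kadd K L) M = kadd (kmul n K M) (kmul n L M).
Proof.
by apply: kernelP => x z; rewrite /kmul /kadd -big_split; apply: eq_bigr => y _; rewrite mulrDl.
Qed.

Lemma kmulDr n K L M : kmul n M (kadd K L) = kadd (kmul n M K) (kmul n M L).
Proof.
by apply: kernelP => x z; rewrite /kmul /kadd -big_split; apply: eq_bigr => y _; rewrite mulrDr.
Qed.

Lemma kmulZl n c K L : kmul n (kscale c K) L = kscale c (kmul n K L).
Proof.
by apply: kernelP => x z; rewrite /kmul /kscale mulr_sumr; apply: eq_bigr => y _; rewrite mulrA.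
Qed.

Lemma kmulZr n c K L : kmul n K (kscale c L) = kscale c (kmul n K L).
Proof.
apply: kernelP => x z; rewrite /kmul /kscale mulr_sumr.
by apply: eq_bigr => y _; rewrite mulrCA.
Qed.

Lemma kscaleA c d K : kscale c (kscale d K) = kscale (c * d) K.
Proof. by apply: kernelP => x y; rewrite /kscale mulrA. Qed.

Lemma kscale1 K : kscale 1 K = K.
Proof. by apply: kernelP => x y; rewrite /kscale mul1r. Qed.

Lemma kmul1r m n K : homk m n K -> kmul n K (kid n) = K.
Proof.
move=> hK; apply: kernelP => x y; rewrite /kmul /kid.
have [sy|sy] := eqVneq (size y) n.
  rewrite (words_delta sy) ?sy ?eqxx ?mulr1 // => z sz /negPf->.
  by rewrite andbF mulr0.
rewrite (homk0 hK) ?sy ?orbT // big_seq big1 // => z; rewrite mem_words => /eqP sz.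
rewrite sz eqxx; have [zy|_] := eqVneq z y; last by rewrite mulr0.
by rewrite -zy sz eqxx in sy.
Qed.

Lemma kmul1l m n K : homk m n K -> kmul m (kid m) K = K.
Proof.
move=> hK; apply: kernelP => x y; rewrite /kmul /kid.
have [sx|sx] := eqVneq (size x) m.
  rewrite (words_delta sx) ?sx ?eqxx ?mul1r // => z sz zx.
  by rewrite eq_sym (negPf zx) mul0r.
by rewrite (homk0 hK) ?sx // big1 // => z _; rewrite mul0r.
Qed.

Lemma ktrM n K L : ktr (kmul n K L) = kmul n (ktr L) (ktr K).
Proof. by apply: kernelP => x y; apply: eq_bigr => z _; rewrite mulrC. Qed.

Lemma homk_mul l m n k K L : homk m n K -> homk l k L -> homk m k (kmul n K L).
Proof.
move=> hK hL x y /negP nz; split.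
- apply/eqP/negP => sx; apply: nz; apply/eqP; apply: big1 => z _.
  by rewrite (homk0 hK) ?mul0r //; apply/orP; left; apply/negP.
- apply/eqP/negP => sy; apply: nz; apply/eqP; apply: big1 => z _.
  by rewrite (homk0 hL) ?mulr0 //; apply/orP; right; apply/negP.
Qed.

Lemma homk_add m n K L : homk m n K -> homk m n L -> homk m n (kadd K L).
Proof.
move=> hK hL x y; rewrite /kadd; have [->|/hK//] := eqVneq (K x y) 0.
by rewrite add0r => /hL.
Qed.

Lemma homk_scale m n c K : homk m n K -> homk m n (kscale c K).
Proof. by move=> hK x y; rewrite mulf_eq0 => /norP[_ /hK]. Qed.

Lemma homk_tr m n K : homk m n K -> homk n m (ktr K).
Proof. by move=> hK x y /hK[]. Qed.

Lemma homk_id n : homk n n (kid n).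
Proof.
move=> x y; rewrite /kid; have [<-|_] := eqVneq (size x) n; last by rewrite eqxx.
by have [<-|_] := eqVneq x y; rewrite ?eqxx.
Qed.

(* Words list the strands from right to left: the head is the rightmost one,
   so that tensoring with an identity strand on the right is a cons. *)
Definition kten (K : kernel) : kernel := fun x y =>
  match x, y with
  | c :: x, d :: y => (c == d)%:R * K x y
  | _, _ => 0
  end.

(* The rightmost output becomes an input, paired by the symplectic form. *)
Definition kbend (K : kernel) : kernel := fun x y =>
  if x is c :: x then (-1) ^+ (~~ c) * K x (~~ c :: y) else 0.

Lemma homk_ten m n K : homk m n K -> homk m.+1 n.+1 (kten K).
Proof.
by move=> hK [|c x] [|d y] //=; rewrite ?eqxx // mulf_eq0 => /norP[_ /hK[-> ->]].
Qed.

Lemma homk_bend m n K : homk m n.+1 K -> homk m.+1 n (kbend K).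
Proof.
by move=> hK [|c x] y; rewrite /kbend ?eqxx // mulf_eq0 => /norP[_ /hK[/= -> [->]]].
Qed.

Lemma ktenM n K L : kmul n.+1 (kten K) (kten L) = kten (kmul n K L).
Proof.
apply: kernelP => -[|c x] [|d z]; rewrite /kmul /= ?words_cons /=.
- by rewrite !big1 ?addr0 // => *; rewrite mul0r.
- by rewrite !big1 ?addr0 // => *; rewrite mul0r.
- by rewrite !big1 ?addr0 // => *; rewrite mulr0.
- rewrite -big_split mulr_sumr /=; apply: eq_bigr => y _.
  by case: c d => -[] /=; ring.
Qed.

(** Bending is natural in the inputs. With L an identity, [kbend K] becomes K next to a strand,
    followed by a cap. *)
Lemma kten_bend n K L : kmul n.+1 (kten K) (kbend L) = kbend (kmul n K L).
Proof.
apply: kernelP => -[|c x] z; rewrite /kmul /= ?words_cons /=.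
- by rewrite !big1 ?addr0 // => *; rewrite mul0r.
- rewrite -big_split mulr_sumr /=; apply: eq_bigr => y _.
  by case: c => /=; ring.
Qed.

Lemma kbend_mul n K L : kmul n (kbend K) L = kbend (kmul n.+1 K (kten L)).
Proof.
apply: kernelP => -[|c x] z; rewrite /kmul /=.
- by rewrite big1 // => *; rewrite mul0r.
- rewrite words_cons -big_split mulr_sumr /=; apply: eq_bigr => y _.
  by case: c => /=; ring.
Qed.

Lemma kten_tr K : ktr (kten K) = kten (ktr K).
Proof. by apply: kernelP => -[|c x] [|d y] //=; rewrite /ktr /= eq_sym. Qed.

Lemma ktenD K L : kten (kadd K L) = kadd (kten K) (kten L).
Proof. by apply: kernelP => -[|c x] [|d y]; rewrite /kadd /= ?addr0 // mulrDr. Qed.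

Lemma ktenZ c K : kten (kscale c K) = kscale c (kten K).
Proof. by apply: kernelP => -[|a x] [|d y]; rewrite /kscale /= ?mulr0 // mulrCA. Qed.

Lemma kten_id n : kten (kid n) = kid n.+1.
Proof.
apply: kernelP => -[|c x] [|d y]; rewrite /kid //= ?andbF //.
by rewrite eqSS eqseq_cons; case: (c == d) => /=; rewrite ?mul1r ?mul0r ?andbF.
Qed.

Definition kop0 : kernel := fun _ _ => 0.

(** * The symmetrizer *)

Definition cnt (x : seq bool) : nat := count id x.

Lemma cnt_le x : (cnt x <= size x)%N.
Proof. exact: count_size. Qed.

Lemma sum_cnt n b :
  \sum_(x <- words n) ((cnt x == b)%:R : rat) = 'C(n, b)%:R.
Proof.
elim: n b => [|n IH] b; first by rewrite big_seq1; case: b.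
rewrite words_cons /=; under eq_bigr do rewrite add0n.
rewrite IH; case: b => [|b].
  by rewrite !bin0 big1 ?addr0.
by under eq_bigr do rewrite add1n eqSS; rewrite IH binS natrD addrC addrC.
Qed.

(* The projection onto symmetric tensors; it will be the image of JW_n. *)
Definition symk n : kernel := fun x y =>
  [&& size x == n, size y == n & cnt x == cnt y]%:R / 'C(n, cnt x)%:R.

Arguments symk n%_N x y.

Lemma homk_sym n : homk n n (symk n).
Proof.
move=> x y; rewrite /symk; have [->|] := eqVneq (size x) n; last by rewrite mul0r eqxx.
by have [->//|] := eqVneq (size y) n; rewrite mul0r eqxx.
Qed.

Lemma symk_tr n : ktr (symk n) = symk n.
Proof.
apply: kernelP => x y; rewrite /ktr /symk.
by case: (size x == n); case: (size y == n); rewrite ?mul0r //= eq_sym; case: eqP => [->|]; rewrite ?mul0r.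
Qed.

Lemma binr_neq0 n b : (b <= n)%N -> 'C(n, b)%:R != 0 :> rat.
Proof. by rewrite pnatr_eq0 -lt0n bin_gt0. Qed.

Lemma sum_symk n (g : seq bool -> rat) z : size z = n ->
  (forall x, size x = n -> cnt x = cnt z -> g x = g z) ->
  \sum_(x <- words n) g x * symk n x z = g z.
Proof.
move=> sz gz; rewrite (@eq_words _ _ _ (fun x => g z / 'C(n, cnt z)%:R * (cnt x == cnt z)%:R)); last first.
  move=> x sx; rewrite /symk sx sz !eqxx /=; case: eqP => [e|_]; last by rewrite !mulr0 mul0r mulr0.
  by rewrite e gz //; ring.
rewrite -mulr_sumr sum_cnt divfK // binr_neq0 //; move: (cnt_le z); lia.
Qed.

(** Words of equal length and [cnt] are permutations of one another, so this says that the outputs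
    of K are symmetric tensors. *)
Definition symr n (K : kernel) := forall x y z,
  size y = n -> size z = n -> cnt y = cnt z -> K x y = K x z.

Arguments symr n%_N K.

Lemma symr_absorb m n K : homk m n K -> symr n K -> kmul n K (symk n) = K.
Proof.
move=> hK sK; apply: (homk_eq _ hK); first exact: homk_mul hK (@homk_sym n).
by move=> x z sx sz; apply: (sum_symk sz) => y sy e; apply: sK.
Qed.

Lemma symr_sym n : symr n (symk n).
Proof. by move=> x y z sy sz e; rewrite /symk sy sz e. Qed.

Lemma symkk n : kmul n (symk n) (symk n) = symk n.
Proof. exact: symr_absorb (@homk_sym n) (@symr_sym n). Qed.

Lemma symr_bend n K : symr n.+1 K -> symr n (kbend K).
Proof.
move=> sK [|c x] y z sy sz e //=.
by rewrite (sK _ (~~ c :: y) (~~ c :: z)) //= ?sy ?sz ?e.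
Qed.

Lemma symk_ten n : kmul n.+1 (symk n.+1) (kten (symk n)) = symk n.+1.
Proof.
apply: homk_eq; [exact: homk_mul (@homk_sym _) (homk_ten (@homk_sym n))|exact: homk_sym|].
move=> x [//|d z] sx [sz]; rewrite /kmul words_cons /= -big_split /=.
rewrite (@eq_words _ _ _ (fun y => symk n.+1 x (d :: y) * symk n y z)).
  by apply: sum_symk => // y sy e; apply: symr_sym; rewrite /= ?sy ?sz ?e.
by move=> y _; case: d => /=; ring.
Qed.

Lemma symk0 : symk 0 = kid 0.
Proof.
apply: kernelP => x y; rewrite /symk /kid.
by case: x => [|? ?]; case: y => [|? ?]; rewrite //= ?mul0r ?bin0 ?divr1.
Qed.

Lemma kten_sym0 : kten (symk 0) = symk 1.
Proof.
apply: (homk_eq (homk_ten (@homk_sym 0)) (@homk_sym 1)).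
case=> [|c [|? ?]] // -[|d [|? ?]] // _ _; rewrite /symk /= /cnt /=.
by case: c d => -[]; rewrite ?mul0r ?bin0 ?bin1 ?divr1 ?mulr1.
Qed.

Lemma bin_up n a : 'C(n.+1, a.+1)%:R = n.+1%:R * 'C(n, a)%:R / a.+1%:R :> rat.
Proof.
have E : (n.+1 * 'C(n, a) = a.+1 * 'C(n.+1, a.+1))%N := mul_bin_diag n.+1 a.
by rewrite -natrM E natrM mulrAC divff ?mul1r // pnatr_eq0.
Qed.

Lemma bin_next n a : (a <= n)%N ->
  'C(n, a.+1)%:R = 'C(n, a)%:R * (n%:R - a%:R) / a.+1%:R :> rat.
Proof.
move=> an; have E := mul_bin_left n a.
by rewrite -natrB // -natrM mulnC -E natrM mulrAC divff ?mul1r // pnatr_eq0.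
Qed.

Lemma bin_down n a : (a <= n.+1)%N ->
  'C(n, a)%:R = 'C(n.+1, a)%:R * (n.+1%:R - a%:R) / n.+1%:R :> rat.
Proof.
move=> an; have E : (n.+1 * 'C(n, a) = (n.+1 - a) * 'C(n.+1, a))%N.
  by have := mul_bin_down n.+1 a.
by rewrite -natrB // -natrM mulnC -E natrM mulrAC divff ?mul1r // pnatr_eq0.
Qed.

Definition wenzl n := kmul n (kbend (symk n.+1)) (ktr (kbend (symk n.+1))).

Arguments wenzl n%_N x y.

(** Wenzl's recursion for the symmetrizers. The constant makes the second summand a projection: with
    B = [kbend (symk n.+1)], the transpose of B times B is the partial trace of [symk n.+1], which
    is (n+2)/(n+1) times [symk n]. The proof compares entries. *)
Lemma kten_sym n :
  kten (symk n.+1) = kadd (symk n.+2) (kscale (n.+1%:R / n.+2%:R) (wenzl n)).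
Proof.
have hb := homk_bend (@homk_sym n.+1).
apply: homk_eq; first exact: homk_ten (@homk_sym _).
  apply: homk_add; first exact: homk_sym.
  by apply: homk_scale; apply: homk_mul hb (homk_tr hb).
move=> [|c x] [|d y] //= [sx] [sy]; rewrite /kadd /kscale /wenzl /kmul /=.
(* Entries of [symk] are constant where they are non-zero. What remains is to count the words w
   whose [cnt] satisfies two conditions; these fix it or contradict each other. *)
have -> : \sum_(w <- words n) (-1) ^+ (~~ c) * symk n.+1 x (~~ c :: w) *
     ktr (kbend (symk n.+1)) w (d :: y) =
   (-1) ^+ (c != d) * ('C(n.+1, cnt x)%:R^-1 * 'C(n.+1, cnt y)%:R^-1 *
     \sum_(w <- words n) ((cnt w + ~~ c == cnt x)%N && (cnt w + ~~ d == cnt y)%N)%:R) :> rat.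
  rewrite !mulr_sumr; apply: eq_words => w sw; rewrite /ktr /= /symk sx sy /= sw !eqxx /=.
  rewrite /cnt /= -!/(cnt _) ![cnt x == _]eq_sym ![cnt y == _]eq_sym !(addnC _ (cnt w)).
  rewrite -mulnb natrM; case: c d => -[] /=; ring.
have cx := cnt_le x; have cy := cnt_le y; rewrite sx in cx; rewrite sy in cy.
have n1 : (n.+1%:R != 0 :> rat) by rewrite pnatr_eq0.
have n2 : (n.+2%:R != 0 :> rat) by rewrite pnatr_eq0.
have S0 (P : pred nat) b : (forall i, P i = (i == b)) ->
    \sum_(w <- words n) (P (cnt w))%:R = 'C(n, b)%:R :> rat.
  by move=> Pb; rewrite -sum_cnt; apply: eq_bigr => w _; rewrite Pb.
have S1 (P : pred nat) : (forall i, (i <= n)%N -> P i = false) ->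
    \sum_(w <- words n) (P (cnt w))%:R = 0 :> rat.
  move=> P0; rewrite (@eq_words _ _ _ (fun=> 0)) ?big1 // => w sw.
  by rewrite P0 // -sw cnt_le.
rewrite /symk sx sy /= !eqxx /= {1 4}/cnt /= -/(cnt x).
set a := cnt x in cx *; set b := cnt y in cy *.
have B k : (k <= n.+1)%N -> 'C(n.+1, k)%:R != 0 :> rat by exact: binr_neq0.
have sx' : (size x).+1 == n.+2 by rewrite sx.
have sy' : (size y).+1 == n.+2 by rewrite sy.
case: c d => -[] /=; rewrite ?add1n ?add0n ?mul1r ?mul0r sx' sy' /= -?[cnt (_ :: y)]/(addn _ b).
- rewrite eqSS.
  have [e|ne] := eqVneq a b; last first.
    rewrite (S1 (fun i => (i + 0 == a) && (i + 0 == b))%N); last by move=> i _; lia.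
    by rewrite !(mulr0, mul0r) addr0.
  rewrite -e (S0 (fun i => (i + 0 == a) && (i + 0 == a))%N a); last by move=> i; lia.
  have alg (A N k : rat) : A != 0 -> N != 0 -> N + 1 != 0 -> k + 1 != 0 ->
      1 / A = 1 / ((N + 1) * A / (k + 1)) + N / (N + 1) * (A^-1 / A * (A * (N - k) / N)).
    by move=> *; field; apply/and4P.
  rewrite bin_up (bin_down cx) [true%:R]mulr1n -(natr1 a) -(natr1 n.+1).
  by apply: alg; rewrite ?natr1 ?B ?pnatr_eq0.
- have [e|ne] := eqVneq a.+1 b; last first.
    rewrite (S1 (fun i => (i + 0 == a) && (i + 1 == b))%N); last by move=> i _; lia.
    by rewrite !(mulr0, mul0r) addr0.
  rewrite -e (S0 (fun i => (i + 0 == a) && (i + 1 == a.+1))%N a); last by move=> i; lia.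
  have an : (a <= n)%N by lia.
  have alg (A N k : rat) : A != 0 -> N != 0 -> N + 1 != 0 -> k + 1 != 0 -> N - k != 0 ->
      0 = 1 / ((N + 1) * A / (k + 1)) +
        N / (N + 1) * ((-1) * (A^-1 / (A * (N - k) / (k + 1)) * (A * (N - k) / N))).
    by move=> *; field; apply/and5P.
  rewrite bin_up (bin_down cx) (bin_next cx) [true%:R]mulr1n -(natr1 a) -(natr1 n.+1) expr1.
  by apply: alg; rewrite ?natr1 ?B ?pnatr_eq0 // -natrB // pnatr_eq0; lia.
- have [e|ne] := eqVneq a b.+1; last first.
    rewrite (S1 (fun i => (i + 1 == a) && (i + 0 == b))%N); last by move=> i _; lia.
    by rewrite !(mulr0, mul0r) addr0.
  rewrite e (S0 (fun i => (i + 1 == b.+1) && (i + 0 == b))%N b); last by move=> i; lia.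
  have bn : (b <= n)%N by lia.
  have alg (A N k : rat) : A != 0 -> N != 0 -> N + 1 != 0 -> k + 1 != 0 -> N - k != 0 ->
      0 = 1 / ((N + 1) * A / (k + 1)) +
        N / (N + 1) * ((-1) * ((A * (N - k) / (k + 1))^-1 / A * (A * (N - k) / N))).
    by move=> *; field; apply/and5P.
  rewrite bin_up (bin_down cy) (bin_next cy) [true%:R]mulr1n -(natr1 b) -(natr1 n.+1) expr1.
  by apply: alg; rewrite ?natr1 ?B ?pnatr_eq0 // -natrB // pnatr_eq0; lia.
- have [e|ne] := eqVneq a b; last first.
    rewrite (S1 (fun i => (i + 1 == a) && (i + 1 == b))%N); last by move=> i _; lia.
    by rewrite !(mulr0, mul0r) addr0.
  rewrite -e; have [a0|a0] := posnP a.
    rewrite (S1 (fun i => (i + 1 == a) && (i + 1 == a))%N); last by move=> i _; lia.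
    by rewrite a0 !bin0 !mulr0 addr0.
  case: a a0 cx {e} => // a _ cx.
  rewrite (S0 (fun i => (i + 1 == a.+1) && (i + 1 == a.+1))%N a); last by move=> i; lia.
  have an : (a <= n)%N by lia.
  have alg (A N k : rat) : A != 0 -> N != 0 -> N + 1 != 0 -> k + 1 != 0 -> N - k != 0 ->
      1 / (N * A / (k + 1)) =
      1 / ((N + 1) * (N * A / (N - k)) / (k + 1)) +
        N / (N + 1) * ((N * A / (k + 1))^-1 / (N * A / (k + 1)) * A).
    by move=> *; field; apply/and5P.
  have e1 : 'C(n.+1, a)%:R = n.+1%:R * 'C(n, a)%:R / (n.+1%:R - a%:R) :> rat.
    have E : (n.+1 * 'C(n, a) = (n.+1 - a) * 'C(n.+1, a))%N by have := mul_bin_down n.+1 a.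
    have nz : (n.+1 - a)%:R != 0 :> rat by rewrite pnatr_eq0; lia.
    by rewrite -natrB ?(leqW an) // -natrM E natrM mulrAC divff ?mul1r.
  rewrite (@bin_up n.+1) e1 (bin_up n) [true%:R]mulr1n -(natr1 a) -(natr1 n.+1).
  by apply: alg; rewrite ?natr1 ?binr_neq0 ?pnatr_eq0 // -natrB ?pnatr_eq0; lia.
Qed.

(** * Equivariant matrices *)

(** Partial trace over the rightmost strand. *)
Definition kptr (M : kernel) : kernel := fun x y =>
  M (false :: x) (false :: y) + M (true :: x) (true :: y).

(** The signs of the two bends cancel, and complementing both heads only permutes the summands of
    the trace. *)
Lemma kbend_trM n K L :
  kmul n.+1 (ktr (kbend K)) (kbend L) = kptr (kmul n (ktr K) L).
Proof.
apply: kernelP => x y; rewrite /kmul words_flip /kptr /ktr /= -big_split /=.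
by apply: eq_bigr => z _; rewrite /=; ring.
Qed.

Lemma kptrZ c M : kptr (kscale c M) = kscale c (kptr M).
Proof. by apply: kernelP => x y; rewrite /kptr /kscale mulrDr. Qed.

Lemma kptr_sym n : kptr (symk n.+1) = kscale (n.+2%:R / n.+1%:R) (symk n).
Proof.
apply: kernelP => x y; rewrite /kptr /kscale /symk /=.
have [sx|/negPf sx] := eqVneq (size x) n; last by rewrite !eqSS sx /= !mul0r addr0 mulr0.
rewrite sx !eqxx eqSS; case: (size y == n); rewrite /= ?mul0r ?addr0 ?mulr0 //.
rewrite /cnt /= !add0n !add1n eqSS -!/(cnt _); case: (cnt x == cnt y); rewrite ?mul0r ?addr0 ?mulr0 //=.
have an := cnt_le x; rewrite sx in an; rewrite bin_up (bin_down (leqW an)).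
have alg (A N k : rat) : A != 0 -> N != 0 -> k + 1 != 0 -> N - k != 0 ->
    1 / A + 1 / (N * (A * (N - k) / N) / (k + 1)) = (N + 1) / N * (1 / (A * (N - k) / N)).
  by move=> *; field; apply/and4P.
rewrite [true%:R]mulr1n -(natr1 (cnt x)) -(natr1 n.+1).
by apply: alg; rewrite ?natr1 ?binr_neq0 ?(leqW an) ?pnatr_eq0 // -natrB ?pnatr_eq0; lia.
Qed.

(* The divided power E^k / k! of the raising operator of sl_2. *)
Fixpoint upk k (x y : seq bool) : rat :=
  match x, y with
  | [::], [::] => (k == 0)%:R
  | c :: x, d :: y => (c == d)%:R * upk k x y +
      (~~ c && d)%:R * (if k is k'.+1 then upk k' x y else 0)
  | _, _ => 0
  end.

Arguments upk k%_N x y.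

Lemma upk_neq0 k x y : upk k x y != 0 -> size x = size y /\ cnt y = (cnt x + k)%N.
Proof.
elim: x k y => [|c x IH] k [|d y] //=; rewrite ?eqxx //.
  by case: k; rewrite ?eqxx.
have [->|/IH[-> e]] := eqVneq (upk k x y) 0; last first.
  case: c d => -[]; rewrite /cnt /= -!/(cnt _) ?mul0r ?add0r ?mul1r => nz; split=> //; try lia.
  by case: k e nz => [|k] e; rewrite ?eqxx // => /IH[_]; lia.
rewrite mulr0 add0r; case: k => [|k]; first by rewrite mulr0 eqxx.
rewrite mulf_eq0 => /norP[]; case: c d => -[]; rewrite ?eqxx //= => _ /IH[-> e].
by rewrite /cnt /= -!/(cnt _) e; split=> //; lia.
Qed.

Lemma upk0 x y : upk 0 x y = (x == y)%:R.
Proof.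
elim: x y => [|c x IH] [|d y] //=; rewrite IH mulr0 addr0 eqseq_cons.
by case: (c == d); rewrite ?mul1r ?mul0r.
Qed.

Lemma upkM n k x y : size x = n ->
  kmul n (upk 1) (upk k) x y = k.+1%:R * upk k.+1 x y.
Proof.
elim: x n k y => [|c x IH] n k y <- /=.
  rewrite /kmul big_seq1; case: y => [|d y] /=; rewrite ?mul0r ?mulr0 //.
rewrite /kmul words_cons; case: y => [|d y] /=.
  by rewrite !big1 ?addr0 ?mulr0 // => *; rewrite mulr0.
rewrite -big_split /=.
have IHk j : \sum_(z <- words (size x)) upk 1 x z * upk j z y = j.+1%:R * upk j.+1 x y by apply: IH.
have I0 j : \sum_(z <- words (size x)) upk 0 x z * upk j z y = upk j x y.
  rewrite (words_delta (erefl (size x))) ?upk0 ?eqxx ?mul1r // => z _ /negPf.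
  by rewrite upk0 eq_sym => ->; rewrite mul0r.
transitivity ((c == d)%:R * (\sum_(z <- words (size x)) upk 1 x z * upk k z y)
  + (~~ c && d)%:R * ((\sum_(z <- words (size x)) upk 0 x z * upk k z y) +
     (if k is k'.+1 then \sum_(z <- words (size x)) upk 1 x z * upk k' z y else 0))).
  rewrite !mulrDr !mulr_sumr addrA -!big_split.
  case: k {IHk I0} => [|k]; rewrite ?mulr0 ?addr0 ?mulr_sumr -?big_split;
    apply: eq_bigr => z _; case: c d => -[] /=; ring.
rewrite IHk I0; case: k {IH I0} IHk => [|k] IHk; rewrite ?IHk; case: c d => -[] /=; rewrite -?natr1; ring.
Qed.

Lemma upk_row n k x : size x = n -> \sum_(y <- words n) upk k x y = 'C(n - cnt x, k)%:R.
Proof.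
elim: x n k => [|c x IH] n k <- /=; first by rewrite big_seq1 /=; case: k.
rewrite words_cons -big_split /=.
transitivity (\sum_(y <- words (size x)) upk k x y +
  (~~ c)%:R * (if k is k'.+1 then \sum_(y <- words (size x)) upk k' x y else 0)).
  case: k => [|k]; rewrite ?mulr0 ?addr0 ?mulr_sumr -?big_split;
    apply: eq_bigr => z _; case: c => /=; ring.
rewrite IH //; have cx := cnt_le x; case: c; rewrite /cnt /= -/(cnt x) ?add1n ?subSS ?mul0r ?addr0 // add0n mul1r subSn //.
by case: k => [|k]; rewrite ?bin0 ?addr0 // IH // binS natrD.
Qed.

Lemma upk_col n k y : size y = n -> \sum_(x <- words n) upk k x y = 'C(cnt y, k)%:R.
Proof.
elim: y n k => [|d y IH] n k <- /=; first by rewrite big_seq1 /=; case: k.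
rewrite words_cons -big_split /=.
transitivity (\sum_(x <- words (size y)) upk k x y +
  d%:R * (if k is k'.+1 then \sum_(x <- words (size y)) upk k' x y else 0)).
  case: k => [|k]; rewrite ?mulr0 ?addr0 ?mulr_sumr -?big_split;
    apply: eq_bigr => z _; case: d => /=; ring.
rewrite IH //; case: d; rewrite /cnt /= -/(cnt y) ?mul0r ?addr0 // add1n mul1r.
by case: k => [|k]; rewrite ?bin0 ?addr0 // IH // binS natrD.
Qed.

(** Turns one letter b into its complement; the two values are the raising and lowering generators
    of sl_2. *)
Definition raise (b : bool) : kernel := if b then ktr (upk 1) else upk 1.

Definition raise_head (b : bool) : kernel := fun x y =>
  match x, y with
  | c :: x, d :: y => ((c == b) && (d == ~~ b))%:R * (x == y)%:R
  | _, _ => 0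
  end.

(** The coproduct of a primitive element: either the tail or the head is acted on. *)
Lemma raise_cons b : raise b = kadd (kten (raise b)) (raise_head b).
Proof.
apply: kernelP => x y; rewrite /kadd; case: b; rewrite /raise /ktr; case: x y => [|c x] [|d y] //=;
  rewrite ?addr0 // upk0; case: c d => -[] /=; rewrite // eq_sym //; ring.
Qed.

(** Equivariance under sl_2; the middle clause is conservation of the weight, which is twice [cnt]
    minus the length. *)
Definition eqv m n (K : kernel) :=
  [/\ homk m n K,
      forall x y, K x y != 0 -> (m + (cnt y).*2 = n + (cnt x).*2)%N &
      forall b, kmul m (raise b) K = kmul n K (raise b)].

Arguments eqv m%_N n%_N K.

Lemma eqv_mul l m n K L : eqv m n K -> eqv n l L -> eqv m l (kmul n K L).
Proof.
move=> [hK wK eK] [hL wL eL]; split; first exact: homk_mul hK hL.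
  move=> x y nz; have [z Kz Lz] : exists2 z, K x z != 0 & L z y != 0.
    apply: contrapT => nex; case/eqP: nz; apply: big1 => z _.
    have [->|Kz] := eqVneq (K x z) 0; first by rewrite mul0r.
    have [->|Lz] := eqVneq (L z y) 0; first by rewrite mulr0.
    by case: nex; exists z.
  by move: (wK _ _ Kz) (wL _ _ Lz); lia.
by move=> b; rewrite kmulA eK -kmulA eL kmulA.
Qed.

Lemma ktrK K : ktr (ktr K) = K. Proof. by []. Qed.

Lemma eqv_tr m n K : eqv m n K -> eqv n m (ktr K).
Proof.
move=> [hK wK eK]; split; first exact: homk_tr.
  by move=> x y /wK ->.
by move=> b; have := congr1 ktr (eK (~~ b)); rewrite !ktrM; case: b => ->.
Qed.

Lemma eqv_add m n K L : eqv m n K -> eqv m n L -> eqv m n (kadd K L).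
Proof.
move=> [hK wK eK] [hL wL eL]; split; first exact: homk_add.
  by move=> x y; rewrite /kadd; have [->|/wK//] := eqVneq (K x y) 0; rewrite add0r => /wL.
by move=> b; rewrite kmulDr kmulDl eK eL.
Qed.

Lemma eqv_scale m n c K : eqv m n K -> eqv m n (kscale c K).
Proof.
move=> [hK wK eK]; split; first exact: homk_scale.
  by move=> x y; rewrite mulf_eq0 => /norP[_ /wK].
by move=> b; rewrite kmulZr kmulZl eK.
Qed.

Lemma raise_homk b x y : raise b x y != 0 -> size x = size y.
Proof. by case: b => /upk_neq0[]. Qed.

Lemma eqv_id n : eqv n n (kid n).
Proof.
split; first exact: homk_id.
  by move=> x y; rewrite /kid; have [<-//|] := eqVneq x y; rewrite andbF eqxx.
move=> b; apply: kernelP => x y; rewrite /kmul /kid.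
have [e|ne] := eqVneq (raise b x y) 0; last first.
  have sxy := raise_homk ne; have [sy|sy] := eqVneq (size y) n.
    have sx : size x = n by rewrite sxy.
    rewrite (words_delta sy) ?(words_delta sx) ?sx ?sy ?eqxx ?mulr1 ?mul1r // => z sz.
      by rewrite eq_sym => /negPf->; rewrite andbF mul0r.
    by move=> /negPf->; rewrite andbF mulr0.
  rewrite !big1 // => z _; first by rewrite sxy (negPf sy) mul0r.
  have [->|_] := eqVneq z y; first by rewrite (negPf sy) mulr0.
  by rewrite andbF mulr0.
rewrite !big1 // => z _.
  by have [<-|_] := eqVneq x z; rewrite ?e ?mulr0 // andbF mul0r.
by have [->|_] := eqVneq z y; rewrite ?e ?mul0r // andbF mulr0.
Qed.

Lemma eqv_ten m n K : eqv m n K -> eqv m.+1 n.+1 (kten K).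
Proof.
move=> [hK wK eK]; split; first exact: homk_ten.
  case=> [|c x] [|d y] //=; rewrite ?eqxx // mulf_eq0 => /norP[].
  by have [->|] := eqVneq c d; rewrite ?eqxx // => _ /wK; rewrite /cnt /=; lia.
move=> b; rewrite raise_cons kmulDl kmulDr !ktenM eK; congr kadd.
apply: kernelP => -[|c x] [|d y]; rewrite /kmul !words_cons /=.
- by rewrite !big1 ?addr0 // => *; rewrite mul0r.
- by rewrite !big1 ?addr0 // => *; rewrite mul0r.
- by rewrite !big1 ?addr0 // => *; rewrite mulr0.
rewrite -!big_split /=.
transitivity (((c == b) && (d == ~~ b))%:R * K x y).
  have [sx|sx] := eqVneq (size x) m; last first.
    rewrite (homk0 hK) ?sx // mulr0 big_seq big1 // => z; rewrite mem_words => /eqP sz.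
    have [xz|_] := eqVneq x z; last by rewrite !(mulr0, mul0r) addr0.
    by rewrite xz sz eqxx in sx.
  rewrite (words_delta sx); last by move=> z _; rewrite eq_sym => /negPf->; rewrite !(mulr0, mul0r) addr0.
  by rewrite eqxx; case: b c d => -[] [] /=; ring.
have [sy|sy] := eqVneq (size y) n; last first.
  rewrite (homk0 hK) ?sy ?orbT // mulr0 big_seq big1 // => z; rewrite mem_words => /eqP sz.
  have [yz|_] := eqVneq z y; last by rewrite !(mulr0, mul0r) addr0.
  by rewrite -yz sz eqxx in sy.
rewrite (words_delta sy); last by move=> z _ /negPf->; rewrite !(mulr0, mul0r) addr0.
by rewrite eqxx; case: b c d => -[] [] /=; ring.
Qed.

(** Invariance of the symplectic form: the two terms in which a letter at the bend is changed, as
    the new input or as the former output, cancel by the sign in [kbend]. *)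
Lemma eqv_bend m n K : eqv m n.+1 K -> eqv m.+1 n (kbend K).
Proof.
move=> [hK wK eK]; split; first exact: homk_bend.
  case=> [|c x] y /=; rewrite ?eqxx // mulf_eq0 => /norP[_ /wK].
  by rewrite /cnt /=; case: c; lia.
move=> b; rewrite {1}raise_cons kmulDl kten_bend eK kbend_mul {1}raise_cons kmulDr.
apply: kernelP => x y; rewrite {1}/kadd.
have -> : kbend (kadd (kmul n.+1 K (kten (raise b))) (kmul n.+1 K (raise_head b))) x y
  = kbend (kmul n.+1 K (kten (raise b))) x y + kbend (kmul n.+1 K (raise_head b)) x y.
  by case: x => [|c x]; rewrite /= ?addr0 // /kadd mulrDr.
rewrite -addrA -[RHS]addr0; congr (_ + _).
case: x => [|c x]; rewrite /kmul !words_cons /=.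
  by rewrite add0r !big1 ?addr0 // => *; rewrite mul0r.
rewrite -!big_split /=.
rewrite -/(words n.+1) words_cons -big_split /=.
have -> : \sum_(i <- words n) (K x (false :: i) * (((false == b) && (~~ c == ~~ b))%:R * (i == y)%:R) +
     K x (true :: i) * (((true == b) && (~~ c == ~~ b))%:R * (i == y)%:R)) = (c == b)%:R * K x (b :: y) :> rat.
  have [sy|sy] := eqVneq (size y) n; last first.
    rewrite (homk0 hK) /= ?eqSS ?sy ?orbT // mulr0 big_seq big1 // => z; rewrite mem_words => /eqP sz.
    have [yz|_] := eqVneq z y; last by rewrite !(mulr0, mul0r) addr0.
    by rewrite -yz sz eqxx in sy.
  rewrite (words_delta sy); last by move=> z _ /negPf->; rewrite !(mulr0, mul0r) addr0.
  by rewrite eqxx; case: b c => -[] /=; ring.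
have [sx|sx] := eqVneq (size x) m; last first.
  rewrite (homk0 hK) ?sx // !mulr0 add0r big_seq big1 // => z; rewrite mem_words => /eqP sz.
  have [xz|_] := eqVneq x z; last by rewrite !(mulr0, mul0r) addr0.
  by rewrite xz sz eqxx in sx.
rewrite (words_delta sx); last by move=> z _; rewrite eq_sym => /negPf->; rewrite !(mulr0, mul0r) addr0.
by rewrite eqxx; case: b c => -[] /=; ring.
Qed.

(** Wenzl's recursion, solved for its leading term, expresses each symmetrizer through kernels
    already known to be equivariant. *)
Lemma eqv_sym n : eqv n n (symk n).
Proof.
elim: n => [|[|n] IH]; first by rewrite symk0; apply: eqv_id.
  by rewrite -kten_sym0; apply: eqv_ten.
have -> : symk n.+2 = kadd (kten (symk n.+1)) (kscale (- (n.+1%:R / n.+2%:R)) (wenzl n)).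
  by rewrite kten_sym; apply: kernelP => x y; rewrite /kadd /kscale; ring.
apply: eqv_add; first exact: eqv_ten.
by apply/eqv_scale/eqv_mul/eqv_tr; apply: eqv_bend.
Qed.

Lemma eqv_upk m n K k : eqv m n K -> kmul m (upk k) K = kmul n K (upk k).
Proof.
move=> eK; have [hK wK rK] := eK; elim: k => [|k IH].
  have I0 l : kmul l (upk 0) = kmul l (kid l).
    apply/funext => L; apply: kernelP => x y; apply: eq_words => z sz.
    rewrite upk0 /kid; have [->|_] := eqVneq x z; by rewrite ?sz ?eqxx ?andbF.
  rewrite I0 (kmul1l hK) -[LHS](kmul1r hK); apply: kernelP => x y; apply: eq_words => z sz.
  by rewrite upk0 /kid sz eqxx.
have U l M : kmul l (kmul l (upk 1) (upk k)) M = kscale k.+1%:R (kmul l (upk k.+1) M).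
  apply: kernelP => x y; rewrite /kscale {1}/kmul mulr_sumr; apply: eq_words => z sz.
  have [sx|sx] := eqVneq (size x) l; first by rewrite upkM // mulrA.
  have [->|/upk_neq0[]] := eqVneq (upk k.+1 x z) 0; last by rewrite sz => /eqP; rewrite (negPf sx).
  rewrite mul0r mulr0 /kmul big_seq big1 ?mul0r // => w; rewrite mem_words => /eqP sw.
  have [->|/upk_neq0[]] := eqVneq (upk 1 x w) 0; first by rewrite mul0r.
  by rewrite sw => /eqP; rewrite (negPf sx).
have U' l M : homk m l M -> kmul l M (kmul l (upk 1) (upk k)) = kscale k.+1%:R (kmul l M (upk k.+1)).
  move=> hM; apply: kernelP => x y; rewrite /kscale {1}/kmul mulr_sumr; apply: eq_words => z sz.
  by rewrite upkM // mulrCA.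
have := U m K; rewrite -kmulA IH kmulA (rK false) -kmulA (U' _ _ hK).
move=> E; apply: kernelP => x y; have := congr1 (fun f => f x y) E; rewrite /kscale.
by move/mulfI => ->//; rewrite pnatr_eq0.
Qed.

(** Reading rows as inputs, k letters [true] are lowered, and then k letters [false] are raised. *)
Definition yk n k := kmul n (ktr (upk k)) (upk k).

Arguments yk n%_N k%_N x y.

Lemma yk_neq0 n k x y : yk n k x y != 0 -> [/\ size x = n, size y = n & cnt x = cnt y].
Proof.
move=> nz; have [z [sz Kz Lz]] : exists z, [/\ size z = n, upk k z x != 0 & upk k z y != 0].
  apply: contrapT => nex; case/eqP: nz; rewrite /yk /kmul big_seq; apply: big1 => z.
  rewrite mem_words => /eqP sz; rewrite /ktr.
  have [->|Kz] := eqVneq (upk k z x) 0; first by rewrite mul0r.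
  have [->|Lz] := eqVneq (upk k z y) 0; first by rewrite mulr0.
  by case: nex; exists z.
by have [<- ->] := upk_neq0 Kz; have [<- ->] := upk_neq0 Lz.
Qed.

Lemma eqv_yk m n K k : eqv m n K -> kmul m (yk m k) K = kmul n K (yk n k).
Proof.
move=> eK; have E : kmul m (ktr (upk k)) K = kmul n K (ktr (upk k)).
  by have := congr1 ktr (eqv_upk k (eqv_tr eK)); rewrite !ktrM.
by rewrite /yk -kmulA (eqv_upk _ eK) kmulA E -kmulA.
Qed.

(** [symk n] is constant on words of equal [cnt], so the eigenvalue is a row sum of [yk]: choose k
    letters [true] of x to lower, then k of the n - cnt x + k letters [false] to raise. *)
Lemma yk_sym n k x y : size x = n ->
  kmul n (yk n k) (symk n) x y = ('C(cnt x, k) * 'C(n - cnt x + k, k))%:R * symk n x y.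
Proof.
move=> sx; transitivity (\sum_(z <- words n) yk n k x z * symk n x y).
  apply: eq_words => z sz; have [->|/yk_neq0[_ _ e]] := eqVneq (yk n k x z) 0; first by rewrite !mul0r.
  by congr (_ * _); rewrite /symk sx sz e.
rewrite -mulr_suml; congr (_ * _); rewrite /yk /kmul exchange_big /=.
under eq_words => z sz do rewrite -mulr_sumr (upk_row _ sz).
have [kx|xk] := leqP k (cnt x); last first.
  rewrite bin_small // mul0n big1 // => z _; rewrite /ktr.
  by have [->|/upk_neq0[_ e]] := eqVneq (upk k z x) 0; [rewrite mul0r|lia].
rewrite natrM -(upk_col k sx) mulr_suml; apply: eq_words => z sz; rewrite /ktr.
have [->|/upk_neq0[_ e]] := eqVneq (upk k z x) 0; first by rewrite !mul0r.
congr (_ * 'C(_, _)%:R); have := cnt_le x; rewrite sx e; lia.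
Qed.

Lemma kaddA K L M : kadd K (kadd L M) = kadd (kadd K L) M.
Proof. by apply: kernelP => x y; rewrite /kadd addrA. Qed.
Lemma kaddC K L : kadd K L = kadd L K.
Proof. by apply: kernelP => x y; rewrite /kadd addrC. Qed.
Lemma kadd0 K : kadd K kop0 = K.
Proof. by apply: kernelP => x y; rewrite /kadd addr0. Qed.
Lemma kmul0 n K : kmul n K kop0 = kop0.
Proof. by apply: kernelP => x y; rewrite /kmul big1 // => *; rewrite mulr0. Qed.
Lemma kmul0l n K : kmul n kop0 K = kop0.
Proof. by apply: kernelP => x y; rewrite /kmul big1 // => *; rewrite mul0r. Qed.
Lemma kten0 : kten kop0 = kop0.
Proof. by apply: kernelP => -[|c x] [|d y]; rewrite //= /kop0 mulr0. Qed.
Lemma kscaleD c K L : kscale c (kadd K L) = kadd (kscale c K) (kscale c L).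
Proof. by apply: kernelP => x y; rewrite /kscale /kadd mulrDr. Qed.
Lemma kscale0 c : kscale c kop0 = kop0.
Proof. by apply: kernelP => x y; rewrite /kscale /kop0 mulr0. Qed.

Lemma eqv_homk m n K : eqv m n K -> homk m n K. Proof. by case. Qed.

(* Kernels in which only the simple constituents j with Q j occur. *)
Inductive isotypic (Q : nat -> Prop) n : kernel -> Prop :=
| Isotypic0 : isotypic Q n kop0
| IsotypicS A B j K : Q j -> eqv n j A -> eqv j n B -> isotypic Q n K ->
    isotypic Q n (kadd (kmul j A (kmul j (symk j) B)) K).

Arguments isotypic Q n%_N K.

Lemma isotypic_one (Q : nat -> Prop) n j A B :
  Q j -> eqv n j A -> eqv j n B -> isotypic Q n (kmul j A (kmul j (symk j) B)).
Proof.
by move=> qj eA eB; rewrite -[kmul _ _ _]kadd0; apply: IsotypicS => //; apply: Isotypic0.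
Qed.

Lemma isotypic_add Q n K L : isotypic Q n K -> isotypic Q n L -> isotypic Q n (kadd K L).
Proof.
by elim=> [|A B j {}K qj eA eB _ IH] iL; [rewrite kaddC kadd0|rewrite -kaddA; apply: IsotypicS; auto].
Qed.

Lemma isotypic_conj Q m n K A B : eqv m n A -> eqv n m B ->
  isotypic Q n K -> isotypic Q m (kmul n A (kmul n K B)).
Proof.
move=> eA eB; elim=> [|A' B' j {}K qj eA' eB' _ IH]; first by rewrite kmul0l kmul0; apply: Isotypic0.
rewrite kmulDl kmulDr -!kmulA kmulA; apply: IsotypicS => //; first exact: eqv_mul eA'.
exact: eqv_mul eB.
Qed.

Lemma isotypic_scale Q n c K : isotypic Q n K -> isotypic Q n (kscale c K).
Proof.
elim=> [|A B j {}K qj eA eB _ IH]; first by rewrite kscale0; apply: Isotypic0.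
by rewrite kscaleD -kmulZl; apply: IsotypicS => //; apply: eqv_scale.
Qed.

Lemma isotypic_sub (Q Q' : nat -> Prop) n K :
  (forall j, Q j -> Q' j) -> isotypic Q n K -> isotypic Q' n K.
Proof.
move=> QQ'; elim=> [|A B j {}K qj eA eB _ IH]; first exact: Isotypic0.
by apply: IsotypicS => //; apply: QQ'.
Qed.

(** The shape of U_n^i, with q in the role of p_n^i and the transpose in that of the flip. *)
Definition sandwich i q := kmul i q (kmul i (symk i) (ktr q)).

Arguments sandwich i%_N q x y.

Lemma wenzlE n : wenzl n = sandwich n (kbend (symk n.+1)).
Proof.
have h := homk_bend (@homk_sym n.+1).
by rewrite /sandwich kmulA (symr_absorb h) //; apply/symr_bend/symr_sym.
Qed.

(** The Clebsch-Gordan rule: one more strand turns a constituent j into j + 1 and, for positive j,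
    also j - 1. The splitting is that of [kten_sym]. *)
Lemma isotypic_ten (Q Q' : nat -> Prop) n K :
  (forall j, Q j -> Q' j.+1) -> (forall j, Q j.+1 -> Q' j) ->
  isotypic Q n K -> isotypic Q' n.+1 (kten K).
Proof.
move=> Qs Qp; elim=> [|A B j {}K qj eA eB _ IH]; first by rewrite kten0; apply: Isotypic0.
rewrite ktenD -!ktenM; apply: isotypic_add => //.
have {}eA := eqv_ten eA; have {}eB := eqv_ten eB.
case: j => [|j] in qj eA eB *.
  by rewrite kten_sym0; apply: isotypic_one => //; apply: Qs.
rewrite kten_sym kmulDl kmulDr; apply: isotypic_add.
  by apply: isotypic_one => //; apply: Qs.
rewrite kmulZl kmulZr wenzlE; apply: isotypic_scale.
have eb := eqv_bend (eqv_sym j.+1).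
rewrite /sandwich -!kmulA kmulA; apply: isotypic_one; first exact: Qp.
  exact: eqv_mul eA eb.
by apply: eqv_mul eB; apply: eqv_tr.
Qed.

Lemma isotypic_id n :
  exists2 K, isotypic (fun j => (j < n)%N && (odd j == odd n)) n K &
    kid n = kadd (symk n) K.
Proof.
elim: n => [|n [K iK E]]; first by exists kop0; [exact: Isotypic0|rewrite kadd0 symk0].
rewrite -kten_id E ktenD.
have iK' : isotypic (fun j => (j < n.+1)%N && (odd j == odd n.+1)) n.+1 (kten K).
  by apply: isotypic_ten iK => j /=; lia.
case: n => [|n] in K iK E iK' *; first by exists (kten K); rewrite ?kten_sym0.
rewrite kten_sym -kaddA; exists (kadd (kscale (n.+1%:R / n.+2%:R) (wenzl n)) (kten K)) => //.
apply: isotypic_add => //; apply: isotypic_scale; rewrite wenzlE.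
have eb := eqv_bend (eqv_sym n.+1).
by apply: isotypic_one => //; [lia|apply: eqv_tr].
Qed.

Lemma symr_iter_bend k m K : symr (m + k) K -> symr k (iter m kbend K).
Proof.
elim: m k => [|m IH] k //= sK; apply: symr_bend; apply: IH.
by rewrite addnS -addSn.
Qed.

Lemma eqv_iter_bend k l m K : eqv l (m + k) K -> eqv (m + l) k (iter m kbend K).
Proof.
elim: m k => [|m IH] k //= eK; apply: eqv_bend; apply: IH.
by rewrite addnS -addSn.
Qed.

Lemma eqv_iter_ten l k m K : eqv l k K -> eqv (m + l) (m + k) (iter m kten K).
Proof. by move=> eK; elim: m => //= m IH; apply: eqv_ten. Qed.

(** Wenzl's recursion iterated, with the two extreme constituents m + i and k = i - m made explicit,
    as these will be the linked ones. Each further strand multiplies the coefficient of the lowest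
    summand by (k+1)/(k+2), and these factors telescope to the ratio that occurs in [lambda]. *)
Lemma iter_ten_sym i k m : (m + k = i)%N -> (0 < m)%N ->
  exists2 K,
    isotypic (fun j => [&& (k < j)%N, (j < m + i)%N & odd j == odd k]) (m + i) K &
    iter m kten (symk i) =
      kadd (kadd (symk (m + i))
                 (kscale (k.+1%:R / i.+1%:R) (sandwich k (iter m kbend (symk i))))) K.
Proof.
case: m => // m + _; elim: m k => [|m IH] k ik.
  exists kop0; first exact: Isotypic0.
  by rewrite kadd0 -ik /= add1n kten_sym wenzlE.
have [K iK E] := IH k.+1 ltac:(lia).
rewrite [iter m.+2 kten _]iterS E !ktenD ktenZ {E}.
have n1 (j : nat) : j.+1%:R != 0 :> rat by rewrite pnatr_eq0.
have eb j := eqv_bend (eqv_sym j.+1).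
have sB : symr k.+1 (iter m.+1 kbend (symk i)).
  by apply: symr_iter_bend; rewrite (_ : m.+1 + k.+1 = i)%N; [exact: symr_sym|lia].
have eB : eqv (m.+1 + i) k.+1 (iter m.+1 kbend (symk i)).
  by apply: eqv_iter_bend; rewrite (_ : m.+1 + k.+1 = i)%N; [exact: eqv_sym|lia].
have -> : (m.+2 + i = (m.+1 + i).+1)%N by lia.
have [N NE] : {N | N = (m.+1 + i)%N} by exists (m.+1 + i)%N.
rewrite -!NE in iK eB *.
rewrite [iter m.+2 kbend _]iterS; move: (iter m.+1 kbend (symk i)) => B in sB eB *.
have -> : kten (symk N) = kadd (symk N.+1) (kscale (N%:R / N.+1%:R) (wenzl N.-1)).
  by rewrite NE addSn kten_sym.
have -> : kten (sandwich k.+1 B) =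
    kadd (kmul k.+2 (kten B) (kmul k.+2 (symk k.+2) (ktr (kten B))))
      (kscale (k.+1%:R / k.+2%:R) (sandwich k (kbend B))).
  have E : kmul k.+2 (kten B) (kbend (symk k.+1)) = kbend B.
    by rewrite kten_bend (symr_absorb (eqv_homk eB) sB).
  rewrite /sandwich -!ktenM kten_sym -kten_tr kmulDl kmulDr; congr kadd.
  rewrite kmulZl kmulZr wenzlE; congr kscale.
  by rewrite /sandwich -!kmulA -ktrM E kmulA E.
rewrite kscaleD kscaleA.
have -> : k.+2%:R / i.+1%:R * (k.+1%:R / k.+2%:R) = k.+1%:R / i.+1%:R :> rat.
  by rewrite mulrC mulrA divfK.
(* b is the lower half of the previous top summand, c the upper half of the previous bottom one;
   both lie strictly between the new extremes. *)
set b := kscale (_ / N.+1%:R) _; set c := kscale _ (kmul _ _ _).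
exists (kadd b (kadd c (kten K))); last first.
  by apply: kernelP => x y; rewrite /kadd; ring.
apply: isotypic_add; last apply: isotypic_add.
- apply: isotypic_scale; rewrite wenzlE /sandwich.
  have e := eb N.-1; have NN : N.-1.+1 = N by lia.
  by rewrite NN in e *; apply: isotypic_one => //; [lia|exact: eqv_tr].
- apply: isotypic_scale; have e := eqv_ten eB.
  by apply: isotypic_one => //; [lia|exact: eqv_tr].
- by apply: isotypic_ten iK => j /=; lia.
Qed.

Lemma iter_ten_bend_mul m n K L :
  kmul (m + n) (iter m kten K) (iter m kbend L) = iter m kbend (kmul n K L).
Proof. by elim: m => //= m IH; rewrite kten_bend IH. Qed.

Lemma iter_tenM m n K L :
  kmul (m + n) (iter m kten K) (iter m kten L) = iter m kten (kmul n K L).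
Proof. by elim: m => //= m IH; rewrite ktenM IH. Qed.

Lemma iter_ten_tr m K : ktr (iter m kten K) = iter m kten (ktr K).
Proof. by elim: m => //= m IH; rewrite kten_tr IH. Qed.

Lemma iter_bend_trM m n K L :
  kmul (m + n) (ktr (iter m kbend K)) (iter m kbend L) = iter m kptr (kmul n (ktr K) L).
Proof. by elim: m => //= m IH; rewrite kbend_trM IH. Qed.

Lemma iter_ptr_sym k m :
  iter m kptr (symk (m + k)) = kscale ((m + k).+1%:R / k.+1%:R) (symk k).
Proof.
have n1 (j : nat) : j.+1%:R != 0 :> rat by rewrite pnatr_eq0.
elim: m k => [|m IH] k; first by rewrite divff // kscale1.
rewrite iterSr /= addSn kptr_sym.
have Z c M j : iter j kptr (kscale c M) = kscale c (iter j kptr M).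
  by elim: j => //= j ->; rewrite kptrZ.
by rewrite Z IH kscaleA mulrA divfK.
Qed.

(** * Linkage modulo p *)

Section Arithmetic.
Variable p : nat.
Hypothesis p_pr : prime p.

Lemma dvdn_bin_pexp i k : (0 < k < p ^ i)%N -> (p %| 'C(p ^ i, k))%N.
Proof.
case: k => // k /andP[_ kP]; have p0 := prime_gt0 p_pr.
have P0 : (0 < p ^ i)%N by rewrite expn_gt0 p0.
have E : (p ^ i * 'C((p ^ i).-1, k) = k.+1 * 'C(p ^ i, k.+1))%N by exact: mul_bin_diag.
apply/negPn/negP => npC; have : (p ^ i %| k.+1)%N.
  have cop : coprime (p ^ i) 'C(p ^ i, k.+1) by rewrite coprimeXl // prime_coprime.
  by rewrite -(Gauss_dvdl _ cop) -E dvdn_mulr.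
by move/dvdn_leq => /(_ isT); lia.
Qed.

(** A case of Lucas's theorem. By Vandermonde's convolution, whose inner binomials are divisible by
    p, adding p^i to a adds 1 to the left side modulo p. *)
Lemma bin_pexp_mod i a : 'C(a, p ^ i) = a %/ p ^ i %[mod p].
Proof.
have p0 := prime_gt0 p_pr; have P0 : (0 < p ^ i)%N by rewrite expn_gt0 p0.
have dv k : (0 < k < p ^ i)%N -> (p %| 'C(p ^ i, k))%N by exact: dvdn_bin_pexp.
rewrite [in LHS](divn_eq a (p ^ i)); have := ltn_pmod a P0.
move: (a %% p ^ i)%N (a %/ p ^ i)%N => r q; case: (p ^ i)%N P0 dv => // P _ dv rP.
elim: q => [|q IH]; first by rewrite mul0n add0n bin_small.
rewrite mulSn -addnA -binomial.Vandermonde big_ord_recl big_ord_recr /=.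
rewrite bin0 mul1n subn0 /bump /= add1n subnn binn bin0 muln1.
rewrite -modnDm IH -[X in (_ + X)%N]modnDm -modn_summ big1 ?mod0n; last first.
  by move=> [j /= jP] _; apply/eqP; apply: dvdn_mulr; apply: dv; lia.
by rewrite add0n modn_mod modnDm addn1.
Qed.

(* With a - b fixed, x |-> x (x + c + 1) separates digits up to the reflection
   exchanging a with - (b + 1). *)
Definition digit_form (i a b : nat) : nat := (a %/ p ^ i * (b %/ p ^ i).+1)%N.

Lemma pexp_gt0 i : (0 < p ^ i)%N. Proof. by rewrite expn_gt0 prime_gt0. Qed.

Lemma carry P a b : (0 < P)%N -> (P %| a + b + 1)%N -> (a %% P + b %% P + 1 = P)%N.
Proof.
move=> P0 d; have ra := ltn_pmod a P0; have rb := ltn_pmod b P0.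
have : (P %| a %% P + b %% P + 1)%N.
  by rewrite /dvdn -modnDml modnDm modnDml.
by case/dvdnP => -[|[|k]]; rewrite ?mulSn; lia.
Qed.

Lemma digit_form_refl s a b a0 b0 i : (i <= s)%N -> (a + b0 = a0 + b)%N ->
  (a = a0 %[mod p ^ s.+1])%N \/ (p ^ s.+1 %| a + b0 + 1)%N ->
  digit_form i a b = digit_form i a0 b0 %[mod p].
Proof.
move=> is_ e; have P0 := pexp_gt0 i; have p0 := prime_gt0 p_pr.
have Pd : (p ^ i.+1 %| p ^ s.+1)%N by rewrite dvdn_exp2l.
case=> [ea|d].
  have q x y : (x = y %[mod p ^ s.+1])%N -> (x %/ p ^ i = y %/ p ^ i %[mod p])%N.
    move=> exy; have exy' : (x = y %[mod p ^ i.+1])%N by rewrite -(modn_dvdm x Pd) exy modn_dvdm.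
    by rewrite !modn_divl -expnS exy'.
  have eb : (b = b0 %[mod p ^ s.+1])%N.
    by apply/eqP; rewrite -(eqn_modDl a0) -e; apply/eqP; rewrite -modnDml ea modnDml.
  by rewrite /digit_form -modnMm -(addn1 (b %/ _)) -modnDml (q _ _ ea) (q _ _ eb) modnDml addn1 modnMm.
have {}d := dvdn_trans Pd d.
have key x y : (p ^ i.+1 %| x + y + 1)%N -> (p %| x %/ p ^ i + y %/ p ^ i + 1)%N.
  move=> dxy; have := carry P0 (dvdn_trans _ dxy); rewrite expnS dvdn_mull // => /(_ isT) c.
  have : (x + y + 1 = p ^ i * (x %/ p ^ i + y %/ p ^ i + 1))%N.
    by rewrite !mulnDr muln1 !(mulnC (p ^ i)%N); move: (divn_eq x (p ^ i)) (divn_eq y (p ^ i)) c; clear; lia.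
  by move=> E; rewrite E expnSr dvdn_pmul2l // in dxy.
have /dvdnP[u hu] := key _ _ d.
have /dvdnP[v hv] : (p %| b %/ p ^ i + a0 %/ p ^ i + 1)%N by apply: key; rewrite (addnC b) -e.
rewrite /digit_form; move: (a %/ _)%N (b %/ _)%N (a0 %/ _)%N (b0 %/ _)%N hu hv => x y x0 y0 hu hv.
apply/eqP; suff : (x * y.+1 + (v * p) * y0.+1 = x0 * y0.+1 + (u * p) * y.+1)%N.
  by move/(congr1 (modn^~ p)); rewrite !(mulnAC _ p) !(addnC _ (_ * p)%N) !modnMDl => /eqP.
rewrite -hv -hu; ring.
Qed.

(** If the quotients q, q' of a, b exceed q0, q0' by t, the two forms differ by t (q + q0' + 1), and
    p divides one of the factors: the first gives a congruence at the next level, the second a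
    reflection. The other sign of the difference is symmetric. *)
Lemma digit_form_step a b a0 b0 i : (a + b0 = a0 + b)%N ->
  (p ^ i %| a0 + b0 + 1)%N -> (a = a0 %[mod p ^ i])%N ->
  (digit_form i a b = digit_form i a0 b0 %[mod p])%N ->
  (a = a0 %[mod p ^ i.+1])%N \/ (p ^ i.+1 %| a + b0 + 1)%N.
Proof.
move=> e d ea; have P0 := pexp_gt0 i; have c := carry P0 d.
have eb : (b = b0 %[mod p ^ i])%N.
  by apply/eqP; rewrite -(eqn_modDl a0) -e; apply/eqP; rewrite -modnDml ea modnDml.
rewrite /digit_form; move: (divn_eq a (p ^ i)) (divn_eq b (p ^ i)) (divn_eq a0 (p ^ i)) (divn_eq b0 (p ^ i)).
rewrite expnS ea eb; move: (p ^ i)%N (a %/ _)%N (b %/ _)%N (a0 %/ _)%N (b0 %/ _)%N (a0 %% _)%N (b0 %% _)%N c P0.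
move=> P q q' q0 q0' r r' c P0 Ea Eb Ea0 Eb0 h.
have E : (q + q0' = q0 + q')%N.
  by apply/eqP; rewrite -(eqn_pmul2r P0) !mulnDl; apply/eqP; move: e Ea Eb Ea0 Eb0; clear; lia.
have diff x y t : ((x + t) * (y + t).+1 = x * y.+1 + t * (x + t + y + 1))%N by ring.
have : exists t, ((p %| t * (q + q0' + 1)) && ((q == q0 + t) || (q0 == q + t)))%N.
  case: (leqP q0 q) => qq.
    have [t tE] : exists t, q = (q0 + t)%N by exists (q - q0)%N; rewrite subnKC.
    have tE' : q' = (q0' + t)%N by move: E tE; clear; lia.
    exists t; rewrite tE eqxx andbT; move/eqP: h; rewrite tE tE' diff.
    by rewrite eqn_mod_dvd ?leq_addr // addKn.
  have [t tE] : exists t, q0 = (q + t)%N by exists (q0 - q)%N; rewrite subnKC // ltnW.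
  have tE' : q0' = (q' + t)%N by move: E tE; clear; lia.
  exists t; rewrite tE eqxx orbT andbT; move/esym/eqP: h; rewrite tE tE' diff.
  by rewrite eqn_mod_dvd ?leq_addr // addKn (addnC q') addnA.
case=> t /andP[]; rewrite Euclid_dvdM // => /orP[pt|pt] tt; [left|right].
  case/dvdnP: pt tt => u -> /orP[] /eqP tt.
    by rewrite Ea Ea0 tt mulnDl -mulnA (addnC (q0 * P)%N) -addnA modnMDl.
  by apply: esym; rewrite Ea Ea0 tt mulnDl -mulnA (addnC (q * P)%N) -addnA modnMDl.
have -> : (a + b0 + 1 = (q + q0' + 1) * P)%N by rewrite !mulnDl mul1n; move: c Ea Eb0; clear; lia.
by rewrite dvdn_mul.
Qed.

Lemma digit_form_sep s a b a0 b0 : (a + b0 = a0 + b)%N ->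
  (p ^ s %| a0 + b0 + 1)%N ->
  (forall i, (i <= s)%N -> digit_form i a b = digit_form i a0 b0 %[mod p])%N ->
  (a = a0 %[mod p ^ s.+1])%N \/ (p ^ s.+1 %| a + b0 + 1)%N.
Proof.
move=> e d h; have ds i : (i <= s)%N -> (p ^ i %| a0 + b0 + 1)%N.
  by move=> is_; apply: dvdn_trans d; rewrite dvdn_exp2l.
suff ea : (a = a0 %[mod p ^ s])%N by apply: (digit_form_step e d ea (h s (leqnn s))).
elim: {-2}s (leqnn s) => [|i IH] is_; first by rewrite expn0 !modn1.
(* Up to level s a reflection is also a congruence, since a0 + b0 + 1 vanishes there as well. *)
have [//|d'] := digit_form_step e (ds i (ltnW is_)) (IH (ltnW is_)) (h _ (ltnW is_)).
apply/eqP; rewrite -(eqn_modDr (b0 + 1)) !addnA; have := ds _ is_.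
by move: d'; rewrite /dvdn => /eqP-> /eqP->.
Qed.

(* [block s n j] is the linkage relation j + 1 = +- (n + 1) modulo 2 p^(s+1). *)
Definition block s n j : bool :=
  (j == n %[mod (p ^ s.+1).*2])%N || ((p ^ s.+1).*2 %| j + n + 2)%N.

(** The eigenvalue from [yk_sym] on a constituent j, seen at words of length n with b letters
    [true]: by conservation of weight the matching words of length j have a of them. *)
Definition eig n b k j : nat :=
  let a := (j + b.*2 - n)./2 in ('C(a, k) * 'C(j - a + k, k))%N.

Lemma eig_digit n b a j i : (a <= j)%N -> (n + a.*2 = j + b.*2)%N ->
  eig n b (p ^ i) j = digit_form i a (j - a) %[mod p].
Proof.
move=> aj e; have -> : eig n b (p ^ i) j = ('C(a, p ^ i) * 'C(j - a + p ^ i, p ^ i))%N.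
  by rewrite /eig (_ : _./2 = a) //; lia.
by rewrite -modnMm !bin_pexp_mod divnDr ?dvdnn // divnn pexp_gt0 modnMm addn1.
Qed.

Lemma modn_double x y M : (x.*2 == y.*2 %[mod M.*2])%N = (x == y %[mod M])%N.
Proof. by rewrite -!muln2 -!muln_modl eqn_pmul2r. Qed.

Lemma block_eig s n b a j : (b <= n)%N -> (p ^ s %| n.+1)%N ->
  (a <= j)%N -> (n + a.*2 = j + b.*2)%N ->
  reflect (forall i, (i <= s)%N -> eig n b (p ^ i) j = eig n b (p ^ i) n %[mod p])%N
          (block s n j).
Proof.
move=> bn d aj e; have E i := eig_digit i aj e.
have E0 i : eig n b (p ^ i) n = digit_form i b (n - b) %[mod p] by exact: eig_digit.
have eab : (a + (n - b) = b + (j - a))%N by lia.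
have B : block s n j = (a == b %[mod p ^ s.+1])%N || (p ^ s.+1 %| a + (n - b) + 1)%N.
  rewrite /block; congr (_ || _).
    by rewrite -(eqn_modDr b.*2) -e -(modn_double a b) -(eqn_modDl n a.*2).
  rewrite (_ : j + n + 2 = (a + (n - b) + 1).*2)%N; last by lia.
  by rewrite -!muln2 dvdn_pmul2r.
rewrite B; apply: (iffP idP) => [h i is_|h].
  rewrite E E0; apply: digit_form_refl is_ eab _.
  by case/orP: h => [/eqP|]; [left|right].
have d' : (p ^ s %| b + (n - b) + 1)%N by rewrite addn1 subnKC.
have h' i : (i <= s)%N -> digit_form i a (j - a) = digit_form i b (n - b) %[mod p].
  by move=> is_; rewrite -E -E0 h.
by have [->|->] := digit_form_sep eab d' h'; rewrite ?eqxx ?orbT.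
Qed.

(** [p.-1] stands for -1, so that the weights remain natural numbers. By Fermat each factor is 1 -
    z^(p-1), the indicator modulo p of the equality of two eigenvalues. *)
Definition xi s n b j : nat :=
  \prod_(i < s.+1) (1 + p.-1 * (eig n b (p ^ i) j + p.-1 * eig n b (p ^ i) n) ^ p.-1).

Lemma fermat_indicator z : (1 + p.-1 * z ^ p.-1 = (p %| z) %[mod p])%N.
Proof.
have p0 := prime_gt0 p_pr; have p1 := prime_gt1 p_pr.
have [pz|pz] := boolP (p %| z)%N.
  have : (p %| p.-1 * z ^ p.-1)%N by apply/dvdn_mull/dvdn_exp; lia.
  by rewrite /dvdn -modnDmr => /eqP->; rewrite addn0.
have cop : coprime z p by rewrite coprime_sym prime_coprime.
have := Euler_exp_totient cop; rewrite totient_prime // => h.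
by rewrite -modnDmr -modnMmr h modnMmr modnDmr muln1 add1n prednK // modnn mod0n.
Qed.

Lemma xi_mod s n b a j : (b <= n)%N -> (p ^ s %| n.+1)%N ->
  (a <= j)%N -> (n + a.*2 = j + b.*2)%N ->
  (xi s n b j = block s n j %[mod p])%N.
Proof.
move=> bn d aj e; have p0 := prime_gt0 p_pr.
have dE x y : (p %| x + p.-1 * y)%N = (x == y %[mod p])%N.
  rewrite -(eqn_modDr (p.-1 * y)) (_ : y + p.-1 * y = p * y)%N; last by rewrite -mulSn prednK.
  by rewrite modnMr.
have -> : (xi s n b j = \prod_(i < s.+1)
    (eig n b (p ^ i) j == eig n b (p ^ i) n %[mod p]) %[mod p])%N.
  rewrite /xi; elim/big_ind2: _ => // [x1 x2 y1 y2 h1 h2|i _].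
    by rewrite -modnMm h1 h2 modnMm.
  by rewrite fermat_indicator dE.
congr (_ %% _)%N; have [h|h] := block_eig bn d aj e.
  by rewrite big1 // => i _; rewrite (h i _) ?eqxx // -ltnS.
apply/eqP; rewrite eqn0Ngt; apply/negP => /gt0_prodn g; apply: h => i is_.
by have := g (Ordinal (is_ : (i < s.+1)%N)) isT; rewrite lt0b => /eqP.
Qed.
End Arithmetic.

(** * Integrality of block components *)

Section Integrality.
Variable p : nat.
Hypothesis p_pr : prime p.

(** Any denominator prime to p is allowed, not just the reduced one, which makes closure under sums
    and products immediate. *)
Definition pint (r : rat) : Prop :=
  exists2 d : nat, ~~ (p %| d)%N & exists z : int, d%:R * r = z%:~R.

Lemma pint_int (z : int) : pint z%:~R.
Proof.
exists 1%N; first by rewrite gtnNdvd // prime_gt1.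
by exists z; rewrite mul1r.
Qed.

Lemma pint_nat (n : nat) : pint n%:R.
Proof. exact: (pint_int n%:Z). Qed.

Lemma pint_add x y : pint x -> pint y -> pint (x + y).
Proof.
move=> [d pd [z dz]] [e pe [w ew]]; exists (d * e)%N; first by rewrite Euclid_dvdM // negb_or pd.
exists (e%:Z * z + d%:Z * w); rewrite natrM intrD !intrM -dz -ew -!pmulrn; ring.
Qed.

Lemma pint_mul x y : pint x -> pint y -> pint (x * y).
Proof.
move=> [d pd [z dz]] [e pe [w ew]]; exists (d * e)%N; first by rewrite Euclid_dvdM // negb_or pd.
by exists (z * w); rewrite natrM intrM -dz -ew; ring.
Qed.

Lemma pint_opp x : pint x -> pint (- x).
Proof. by rewrite -mulN1r; apply: pint_mul; apply: (pint_int (-1)). Qed.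

Lemma pint_sum (I : Type) (r : seq I) (P : pred I) (F : I -> rat) :
  (forall i, P i -> pint (F i)) -> pint (\sum_(i <- r | P i) F i).
Proof. by move=> h; elim/big_ind: _ => //; [apply: (pint_int 0)|apply: pint_add]. Qed.

Lemma pint_denq r : pint r -> ~~ (p%:Z %| denq r)%Z.
Proof.
move=> [d pd [z dz]]; apply: contra pd => pr.
have E : d%:Z * numq r = z * denq r.
  apply: (@intr_inj rat); rewrite !intrM -dz -pmulrn -mulrA; congr (_ * _).
  by rewrite -{2}(divq_num_den r) divfK // intr_eq0 denq_neq0.
have : (denq r %| d%:Z * numq r)%Z by rewrite E dvdz_mull.
rewrite Gauss_dvdzl; last by rewrite coprimez_sym coprimezE coprime_num_den.
by move=> h; have := dvdz_trans pr h; rewrite dvdzE.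
Qed.

Lemma pint_clear r : exists e, pint (p%:R ^+ e * r).
Proof.
have d0 : (0 < `|denq r|)%N by rewrite absz_gt0 denq_neq0.
have [m pm E] := pfactor_coprime p_pr d0.
exists (logn p `|denq r|); exists m; first by rewrite -prime_coprime.
exists (numq r); rewrite mulrA -natrX -natrM -E pmulrn gez0_abs ?denq_ge0 //.
by rewrite -{2}(divq_num_den r) mulrC divfK // intr_eq0 denq_neq0.
Qed.

Lemma pint_clear_fin (I : finType) (c : I -> rat) : exists e, forall i, pint (p%:R ^+ e * c i).
Proof.
have [e h] := choice (fun i => pint_clear (c i)); exists (\sum_i e i)%N => i.
rewrite (bigD1 i) //= exprD mulrAC mulrC -natrX.
by apply: pint_mul => //; apply: pint_nat.
Qed.

(** b^p - 1 is b - 1 times a sum of p powers of b, each of them 1 modulo p; so every p-th power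
    gains a factor p. *)
Lemma exp_pexp_mod (a e : nat) : (a = 1 %[mod p])%N -> (a ^ p ^ e = 1 %[mod p ^ e.+1])%N.
Proof.
move=> a1; elim: e => [|e IH]; first by rewrite expn1.
rewrite expnSr expnM; move: (a ^ p ^ e)%N IH => b IH.
have b1 : (b = 1 %[mod p])%N.
  have dp : (p %| p ^ e.+1)%N by rewrite expnS dvdn_mulr.
  by rewrite -(modn_dvdm b dp) IH modn_dvdm //.
have bgt : (0 < b)%N.
  by case: b b1 {IH} => //; rewrite mod0n modn_small ?prime_gt1.
have : (p ^ e.+2 %| b ^ p - 1)%N.
  have -> : (b ^ p - 1 = (b - 1) * (\sum_(i < p) b ^ (p.-1 - i)))%N.
    have := subn_exp b 1 p; rewrite exp1n => ->; congr (_ * _)%N.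
    by apply: eq_bigr => i _; rewrite exp1n muln1.
  rewrite expnSr; apply: dvdn_mul; first by rewrite -eqn_mod_dvd //; apply/eqP.
  rewrite /dvdn -modn_summ (eq_bigr (fun=> 1 %% p)%N); last first.
    by move=> i _; rewrite -modnXm b1 modnXm exp1n.
  by rewrite modn_summ sum_nat_const card_ord muln1 modnn.
by rewrite -eqn_mod_dvd ?expn_gt0 ?bgt // => /eqP.
Qed.

(* If the weights x i are 0 or 1 mod p, the p^e-th powers of the weights
   converge p-adically to the indicator of those that are 1. *)
Lemma pint_select (I : finType) (c : I -> rat) (x : I -> nat) (A : pred I) :
  (forall N, pint (\sum_i (x i ^ N)%:R * c i)) ->
  (forall i, c i != 0 -> (x i = A i %[mod p])%N) ->
  pint (\sum_(i | A i) c i).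
Proof.
(* p^e clears the powers of p in all denominators of c. Replacing the p^e-th power of a weight by
   its indicator is a change by a multiple of p^e, hence changes the sum by a p-integral number. *)
move=> hN hx; have [e he] := pint_clear_fin c.
have key i : exists z : int, (x i ^ p ^ e)%:R * c i = (A i)%:R * c i + z%:~R * (p%:R ^+ e * c i).
  have [->|/hx {}hx] := eqVneq (c i) 0; first by exists 0; rewrite !mulr0 addr0.
  suff [z hz] : exists z : int, (x i ^ p ^ e)%:R = (A i)%:R + z%:~R * p%:R ^+ e :> rat.
    by exists z; rewrite hz mulrDl mulrA.
  case: (A i) hx => [/(exp_pexp_mod e)|] /eqP hx.
    have : (x i ^ p ^ e == 1 %[mod p ^ e])%N.
      have dp : (p ^ e %| p ^ e.+1)%N by rewrite expnS dvdn_mull.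
      by rewrite -(modn_dvdm _ dp) (eqP hx) modn_dvdm //.
    have g : (0 < x i ^ p ^ e)%N.
      case: (x i ^ p ^ e)%N hx => //; rewrite mod0n modn_small //.
      by rewrite -(exp1n e.+1) ltn_exp2r // prime_gt1.
    rewrite eqn_mod_dvd // => /dvdnP[k hk]; exists k%:Z.
    by rewrite -pmulrn -natrX -natrM -hk natrB // addrC subrK.
  rewrite mod0n in hx; have : (p ^ e %| x i ^ p ^ e)%N.
    apply: dvdn_trans (dvdn_exp2l (x i) (ltnW (ltn_expl e (prime_gt1 p_pr)))) => //.
    by rewrite dvdn_exp2r.
  by case/dvdnP => k ->; exists k%:Z; rewrite natrM natrX add0r -pmulrn.
have [z hz] := choice key; have := hN (p ^ e)%N.
rewrite (eq_bigr _ (fun i _ => hz i)) big_split /= => h.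
have -> : \sum_(i | A i) c i = \sum_i (A i)%:R * c i.
  by rewrite big_mkcond; apply: eq_bigr => i _; case: (A i); rewrite ?mul1r ?mul0r.
rewrite -[X in pint X](addrK (\sum_i (z i)%:~R * (p%:R ^+ e * c i))).
apply: pint_add h _; apply/pint_opp/pint_sum => i _.
by apply: pint_mul => //; apply: pint_int.
Qed.

Definition pintk (K : kernel) := forall x y, pint (K x y).

(** What the integrality argument needs of one summand of an isotypic kernel: the eigenvalues of all
    [yk], and, on its non-zero rows, that the halving in [eig] is exact. *)
Definition constituent n j (L : kernel) := [/\ homk n n L,
  forall k x y, size x = n -> kmul n (yk n k) L x y = (eig n (cnt x) k j)%:R * L x y &
  forall x y, L x y != 0 -> exists2 a, (a <= j)%N & (n + a.*2 = j + (cnt x).*2)%N].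

Lemma constituent_one n j A B : eqv n j A -> eqv j n B ->
  constituent n j (kmul j A (kmul j (symk j) B)).
Proof.
move=> eA eB; have [hA wA rA] := eA; have [hB _ _] := eB; split.
- exact/(homk_mul hA)/(homk_mul (@homk_sym j) hB).
- move=> k x y sx; rewrite kmulA (eqv_yk _ eA) -kmulA {1 3}/kmul mulr_sumr.
  apply: eq_words => z sz; have [->|nz] := eqVneq (A x z) 0; first by rewrite !(mul0r, mulr0).
  have -> : kmul j (yk j k) (kmul j (symk j) B) z y = (eig n (cnt x) k j)%:R * kmul j (symk j) B z y.
    rewrite kmulA /kmul mulr_sumr; apply: eq_words => w sw.
    rewrite -/(kmul j (yk j k) (symk j) z w) yk_sym // -mulrA /eig.
    by rewrite -(wA _ _ nz) addKn doubleK.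
  by rewrite mulrCA.
- move=> x y nz; have [z [sz nA]] : exists z, size z = j /\ A x z != 0.
    apply: contrapT => nex; case/eqP: nz; rewrite /kmul big_seq big1 // => z.
    rewrite mem_words => /eqP sz; have [->|nA] := eqVneq (A x z) 0; first by rewrite mul0r.
    by case: nex; exists z.
  by exists (cnt z); [rewrite -sz cnt_le|apply: wA nA].
Qed.

Lemma isotypic_constituents Q n K : isotypic Q n K ->
  exists (I : finType) (j : I -> nat) (L : I -> kernel),
    [/\ forall x y, K x y = \sum_i L i x y,
        forall i, constituent n (j i) (L i) & forall i, Q (j i)].
Proof.
elim=> [|A B j {}K qj eA eB _ [I [ji [L [KL cL QL]]]]].
  exists void, (fun=> 0%N), (fun=> kop0); by split=> [x y|[]|[]]; rewrite big_pred0 // => -[].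
exists (option I), (fun o => if o is Some i then ji i else j),
  (fun o => if o is Some i then L i else kmul j A (kmul j (symk j) B)); split.
- move=> x y; rewrite /kadd KL (bigD1 None) //=; congr (_ + _).
  rewrite (reindex_omap Some id) /=; last by case.
  by apply: eq_bigl => i; rewrite eqxx.
- by case=> // ; apply: constituent_one.
- by case.
Qed.

Section Selection.
Variables (n b : nat).

(** Weighting the constituents by [xi] keeps their sum p-integral. The number b is fixed because the
    eigenvalues depend on it, while [yk] preserves it. Closure under sums and products gives all
    polynomials in the eigenvalues with natural coefficients. *)
Definition selects (xi : nat -> nat) := forall (I : finType) (j : I -> nat) (L : I -> kernel),
  (forall i, constituent n (j i) (L i)) ->
  (forall x y, size x = n -> cnt x = b -> pint (\sum_i L i x y)) ->
  (forall x y, size x = n -> cnt x = b -> pint (\sum_i (xi (j i))%:R * L i x y)).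

Lemma constituent_scale j L (c : rat) : constituent n j L -> constituent n j (kscale c L).
Proof.
move=> [hL yL wL]; split; first exact: homk_scale.
  by move=> k x y sx; rewrite kmulZr /kscale yL // mulrCA.
by move=> x y; rewrite mulf_eq0 => /norP[_ /wL].
Qed.

Lemma selects_const c : selects (fun=> c).
Proof.
move=> I j L cL pL x y sx cx; rewrite -mulr_sumr; apply: pint_mul (pL _ _ sx cx).
exact: pint_nat.
Qed.

Lemma selects_add f g : selects f -> selects g -> selects (fun j => f j + g j)%N.
Proof.
move=> hf hg I j L cL pL x y sx cx.
rewrite (eq_bigr (fun i => (f (j i))%:R * L i x y + (g (j i))%:R * L i x y)); last first.
  by move=> i _; rewrite natrD mulrDl.
by rewrite big_split; apply: pint_add; [apply: hf|apply: hg].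
Qed.

Lemma selects_mul f g : selects f -> selects g -> selects (fun j => f j * g j)%N.
Proof.
move=> hf hg I j L cL pL x y sx cx.
rewrite (eq_bigr (fun i => (f (j i))%:R * kscale (g (j i))%:R (L i) x y)); last first.
  by move=> i _; rewrite /kscale natrM mulrA.
apply: (hf I j (fun i => kscale (g (j i))%:R (L i))) => //; first by move=> i; apply: constituent_scale.
by move=> x' y' sx' cx'; apply: hg.
Qed.

Lemma selects_exp f N : selects f -> selects (fun j => f j ^ N)%N.
Proof.
move=> hf; elim: N => [|N IH]; first exact: (selects_const 1).
have -> : (fun j => f j ^ N.+1)%N = (fun j => f j * f j ^ N)%N by apply/funext => j; rewrite expnS.
exact: selects_mul.
Qed.

Lemma selects_prod s (f : nat -> nat -> nat) :
  (forall i, selects (f i)) -> selects (fun j => \prod_(i < s) f i j)%N.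
Proof.
move=> hf; elim: s => [|s IH].
  have -> : (fun j => \prod_(i < 0) f i j)%N = fun=> 1%N by apply/funext => j; rewrite big_ord0.
  exact: selects_const.
have -> : (fun j => \prod_(i < s.+1) f i j)%N = fun j => ((\prod_(i < s) f i j) * f s j)%N.
  by apply/funext => j; rewrite big_ord_recr.
exact: selects_mul.
Qed.

Lemma upk_pint k x y : pint (upk k x y).
Proof.
elim: x k y => [|c x IH] k [|d y] /=; try exact: pint_nat; try exact: (pint_int 0).
by apply: pint_add; apply: pint_mul; rewrite ?pmulrn; try exact: pint_int; case: k => // ; apply: (pint_int 0).
Qed.

(** This weighting is multiplication by the integral matrix [yk n k]. *)
Lemma selects_eig k : selects (eig n b k).
Proof.
move=> I j L cL pL x y sx cx.
have -> : \sum_i (eig n b k (j i))%:R * L i x y = \sum_(r <- words n) yk n k x r * \sum_i L i r y.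
  under [RHS]eq_bigr do rewrite mulr_sumr.
  rewrite exchange_big; apply: eq_bigr => i _ /=.
  by case: (cL i) => _ /(_ k x y sx) yL _; rewrite cx in yL; rewrite -yL.
apply: pint_sum => r _; have [->|/yk_neq0[_ sr cr]] := eqVneq (yk n k x r) 0.
  by rewrite mul0r; apply: (pint_int 0).
apply: pint_mul; last by apply: pL; rewrite // -cr.
by apply: pint_sum => z _; apply: pint_mul; apply: upk_pint.
Qed.

End Selection.

(** All powers of [xi] are admissible weights, and [xi] is 1 on the constituents of P and 0 on those
    of R modulo p, so [pint_select] extracts P. Integrality of R follows but is not the aim. *)
Lemma block_integral s n P R : (p ^ s %| n.+1)%N ->
  isotypic (fun j => block p s n j) n P -> isotypic (fun j => ~~ block p s n j) n R ->
  pintk (kadd P R) -> pintk P.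
Proof.
move=> ps iP iR pPR x y.
have [I [j [L [EP cL QL]]]] := isotypic_constituents iP.
have [I' [j' [L' [ER cL' QL']]]] := isotypic_constituents iR.
have [sx|sx] := eqVneq (size x) n; last first.
  rewrite EP big1; first exact: (pint_int 0).
  by move=> i _; case: (cL i) => h _ _; rewrite (homk0 h) // sx.
have bn : (cnt x <= n)%N by rewrite -sx cnt_le.
pose J (i : I + I') := match i with inl i => j i | inr i => j' i end.
pose M (i : I + I') := match i with inl i => L i | inr i => L' i end.
have cM i : constituent n (J i) (M i) by case: i => i; [apply: cL|apply: cL'].
have SM x' y' : \sum_i M i x' y' = kadd P R x' y'.
  by rewrite big_sumType /= /kadd EP ER.
pose A (i : I + I') := block p s n (J i).
have -> : P x y = \sum_(i | A i) M i x y.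
  rewrite EP [RHS]big_mkcond big_sumType /= [X in _ + X]big1 ?addr0.
    by apply: eq_bigr => i _; rewrite /A /= QL.
  by move=> i _; rewrite /A /= (negPf (QL' i)).
apply: (pint_select (x := fun i => xi p s n (cnt x) (J i))).
  move=> N; have sel : selects n (cnt x) (fun j => xi p s n (cnt x) j ^ N)%N.
    apply: selects_exp; set b := cnt x.
    apply: (@selects_prod n b s.+1 (fun i j => 1 +
      p.-1 * (eig n b (p ^ i) j + p.-1 * eig n b (p ^ i) n) ^ p.-1)%N) => i.
    apply: selects_add; first exact: selects_const.
    apply: selects_mul; first exact: selects_const.
    apply: (@selects_exp _ _ (fun j => eig n b (p ^ i) j + p.-1 * eig n b (p ^ i) n)%N).
    by apply: selects_add; [exact: selects_eig|exact: selects_const].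
  by apply: sel => // x' y' _ _; rewrite SM.
move=> i nz; have [_ _ /(_ _ _ nz)[a aj e]] := cM i.
exact: xi_mod bn ps aj e.
Qed.

End Integrality.

(** * Orthogonal families *)

Lemma isotypic_sum Q n (I : Type) (r : seq I) (P : pred I) (c : I -> rat) (K : I -> kernel) :
  (forall i, P i -> isotypic Q n (K i)) ->
  isotypic Q n (fun x y => \sum_(i <- r | P i) c i * K i x y).
Proof.
move=> h; elim: r => [|i r IH].
  rewrite (_ : (fun _ _ => _) = kop0); first exact: Isotypic0.
  by apply: kernelP => x y; rewrite big_nil.
rewrite (_ : (fun _ _ => _) = if P i then kadd (kscale (c i) (K i))
    (fun x y => \sum_(i <- r | P i) c i * K i x y) else fun x y => \sum_(i <- r | P i) c i * K i x y).
  by case: ifP => [/h {}h|//]; apply: isotypic_add => //; apply: isotypic_scale.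
by case: ifP => Pi; apply: kernelP => x y; rewrite big_cons Pi.
Qed.

(** Schur's lemma. Comparing the eigenvalues of [yk] for k = 1 on both sides gives a (i - a + 1) = b
    (j - b + 1), and equality of weights i + 2 b = j + 2 a then forces i = j. *)
Lemma sym_orthogonal i j T : eqv i j T -> i != j ->
  kmul i (symk i) (kmul j T (symk j)) = kop0.
Proof.
move=> eT ij; set S := kmul _ _ _.
have eS : eqv i j S by apply: eqv_mul (eqv_sym i) (eqv_mul eT (eqv_sym j)).
have [hS wS _] := eS; have E := eqv_yk 1 eS.
have Sl k L x y : size x = k -> kmul k (yk k 1) (kmul k (symk k) L) x y =
    (cnt x * (k - cnt x).+1)%:R * kmul k (symk k) L x y.
  move=> sx; rewrite kmulA {1 3}/kmul mulr_sumr; apply: eq_words => z sz.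
  by rewrite yk_sym // bin1 -mulrA addn1 bin1.
have Sr x y : size y = j -> kmul j S (yk j 1) x y = (cnt y * (j - cnt y).+1)%:R * S x y.
  move=> sy; have ykT : ktr (yk j 1) = yk j 1 by rewrite /yk ktrM ktrK.
  have ST : ktr S = kmul j (symk j) (kmul i (ktr T) (symk i)).
    by rewrite /S !ktrM !symk_tr -kmulA.
  rewrite -[LHS]/(ktr (kmul j S (yk j 1)) y x) ktrM ykT ST Sl //.
  by rewrite -ST.
apply: kernelP => x y; rewrite /kop0; apply/eqP/negPn/negP => nz.
have [sx sy] := hS _ _ nz; have w := wS _ _ nz.
have := Sl i (kmul j T (symk j)) x y sx; rewrite -/S E Sr // => /(mulIf nz)/eqP; rewrite eqr_nat => /eqP.
have cx := cnt_le x; have cy := cnt_le y; move: cx cy; rewrite sx sy.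
move: (cnt x) (cnt y) w => a b w ai bj.
have [d|d|d] := ltngtP a b; last by case/eqP: ij; lia.
- have [t bE] : exists t, b = (a + t.+1)%N by exists (b - a).-1; lia.
  rewrite bE in w bj *.
  have -> : (j - (a + t.+1))%N = (i - a + t.+1)%N by lia.
  nia.
- have [t aE] : exists t, a = (b + t.+1)%N by exists (a - b).-1; lia.
  rewrite aE in w ai *.
  have -> : (i - (b + t.+1))%N = (j - b + t.+1)%N by lia.
  nia.
Qed.

Section Family.
Variables (n : nat) (I : pred nat) (mu : nat -> rat) (q : nat -> kernel).

(** The last clause normalizes [mu i] so that [mu i] times [sandwich i (q i)] is idempotent. *)
Definition family := forall i, I i -> [/\ (i <= n)%N, eqv n i (q i), mu i != 0 &
  kmul i (symk i) (kmul i (kmul n (ktr (q i)) (q i)) (symk i)) = kscale (mu i)^-1 (symk i)].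

Definition family_sum : kernel :=
  fun x y => \sum_(i < n.+1 | I i) mu i * sandwich i (q i) x y.

Hypothesis fam : family.

Lemma sandwich_mul i j : I i -> I j ->
  kmul n (sandwich i (q i)) (sandwich j (q j)) =
  if i == j then kscale (mu i)^-1 (sandwich i (q i)) else kop0.
Proof.
move=> Ii Ij; have [_ ei mi ni] := fam Ii; have [_ ej _ _] := fam Ij.
rewrite /sandwich; transitivity (kmul i (q i) (kmul j (kmul i (symk i) (kmul j (kmul n (ktr (q i)) (q j)) (symk j))) (ktr (q j)))).
  by rewrite -!kmulA.
case: eqP => [e|/eqP ne].
  by rewrite -e ni kmulZl kmulZr.
by rewrite (sym_orthogonal _ ne) ?kmul0l ?kmul0 //; apply: eqv_mul (eqv_tr ei) ej.
Qed.

Lemma family_idem : kmul n family_sum family_sum = family_sum.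
Proof.
apply: kernelP => x y; rewrite /kmul /family_sum.
under eq_bigr do rewrite mulr_suml.
rewrite exchange_big /=; apply: eq_bigr => i Ii.
under eq_bigr do rewrite mulr_sumr.
rewrite exchange_big /= (bigD1 i) //= [X in _ + X]big1 ?addr0 => [|j /andP[Ij ji]].
  transitivity (mu i * mu i * kmul n (sandwich i (q i)) (sandwich i (q i)) x y).
    by rewrite [in RHS]/kmul mulr_sumr; apply: eq_bigr => z _; ring.
  have [_ _ mi _] := fam Ii.
  by rewrite sandwich_mul // eqxx /kscale; field.
transitivity (mu i * mu j * kmul n (sandwich i (q i)) (sandwich j (q j)) x y).
  by rewrite [in RHS]/kmul mulr_sumr; apply: eq_bigr => z _; ring.
by rewrite sandwich_mul // val_eqE eq_sym (negPf ji) /kop0 mulr0.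
Qed.

End Family.

(** * From the father f to n = m + f *)

Section Step.
Variables (f m : nat) (I I' : pred nat) (mu mu' : nat -> rat) (q q' : nat -> kernel).
Hypothesis fam : family f I mu q.
Hypothesis m_gt0 : (0 < m)%N.
Hypothesis Im : forall i, I i -> (m <= i)%N.
Hypothesis I'E : forall j, I' j = ((m <= j)%N && I (j - m)%N) || I (j + m)%N.
Hypothesis Idisj : forall i, I i -> ~~ I (i + m.*2)%N.
Hypothesis up : forall i, I i -> mu' (i + m)%N = mu i /\ q' (i + m)%N = iter m kten (q i).
Hypothesis down : forall i, I i ->
  mu' (i - m)%N = (i.+1 - m)%:R / i.+1%:R * mu i /\
  q' (i - m)%N = iter m kbend (kmul i (q i) (symk i)).

(** An upper summand keeps its norm, since [symk (m + i)] absorbs [symk i] on i strands. The norm of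
    a lower one is an m-fold partial trace of [symk i], divided by [mu i]; this is the origin of the
    ratio in [mu']. *)
Lemma family_step : family (m + f) I' mu' q'.
Proof.
move=> j; rewrite I'E => /orP[/andP[mj]|] Ii.
  have [lef ei mi ni] := fam Ii; have [] := up Ii; rewrite subnK // => -> ->.
  move: (j - m)%N (subnKC mj) => i ij in Ii lef ei mi ni *; rewrite -ij.
  split=> //; [by rewrite leq_add2l|exact: eqv_iter_ten|].
  rewrite iter_ten_tr iter_tenM.
  have aL : kmul (m + i) (symk (m + i)) (iter m kten (symk i)) = symk (m + i).
    elim: m => [|l IH]; first exact: symkk.
    by rewrite addSn /= -{1}(symk_ten (l + i)) -kmulA ktenM IH symk_ten.
  have aR : kmul (m + i) (iter m kten (symk i)) (symk (m + i)) = symk (m + i).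
    by have := congr1 ktr aL; rewrite ktrM iter_ten_tr !symk_tr.
  rewrite -{1}aL -{2}aR -!kmulA (kmulA _ (m + i) (iter m kten (kmul f _ _))).
  rewrite (kmulA _ _ (iter m kten (symk i))) !iter_tenM ni.
  have ktenZ' c K l : iter l kten (kscale c K) = kscale c (iter l kten K).
    by elim: l => //= l ->; rewrite ktenZ.
  by rewrite ktenZ' kmulZl kmulZr aR symkk.
have [lef ei mi ni] := fam Ii; have [] := down Ii; rewrite addnK => -> ->.
have i1 : (j + m).+1%:R != 0 :> rat by rewrite pnatr_eq0.
have j1 : ((j + m).+1 - m)%:R != 0 :> rat by rewrite pnatr_eq0; lia.
have eqi := eqv_mul ei (eqv_sym (j + m)).
split; first by lia.
- by apply: eqv_iter_bend; rewrite addnC.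
- by rewrite !mulf_neq0 // invr_eq0.
have := iter_bend_trM m f (kmul (j + m) (q (j + m)) (symk (j + m))) (kmul (j + m) (q (j + m)) (symk (j + m))).
rewrite ktrM symk_tr -kmulA (kmulA f) ni => ->.
have kptrZ' c K l : iter l kptr (kscale c K) = kscale c (iter l kptr K).
  by elim: l => //= l ->; rewrite kptrZ.
rewrite kptrZ' (addnC j m) iter_ptr_sym kscaleA kmulZl kmulZr !symkk; congr kscale.
have alg (A B c : rat) : A != 0 -> B != 0 -> c != 0 -> c^-1 * (A / B) = (B / A * c)^-1.
  by move=> *; field; apply/and3P.
rewrite (_ : (m + j).+1 - m = j.+1)%N; last by lia.
by rewrite (addnC m j); apply: alg; rewrite ?pnatr_eq0.
Qed.

Lemma family_sum_step x y : family_sum (m + f) I' mu' q' x y =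
  \sum_(i < f.+1 | I i) (mu i * sandwich (m + i) (iter m kten (q i)) x y +
    mu i * ((i.+1 - m)%:R / i.+1%:R) *
      sandwich (i - m) (iter m kbend (kmul i (q i) (symk i))) x y).
Proof.
rewrite /family_sum -(big_mkord I' (fun j => mu' j * sandwich j (q' j) x y)).
pose G j := mu' j * sandwich j (q' j) x y.
rewrite big_split /=.
have -> : \sum_(0 <= j < (m + f).+1 | I' j) G j =
    \sum_(0 <= j < (m + f).+1 | (m <= j)%N && I (j - m)%N) G j +
    \sum_(0 <= j < (m + f).+1 | I (j + m)%N) G j.
  rewrite [LHS]big_mkcond [X in _ = X + _]big_mkcond [X in _ = _ + X]big_mkcond -big_split /=.
  apply: eq_bigr => j _; rewrite I'E.
  have [/andP[mj Ij]|_] /= := boolP ((m <= j)%N && I (j - m)%N); last by rewrite add0r.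
  have := Idisj Ij; rewrite (_ : j - m + m.*2 = j + m)%N; last by lia.
  by move/negPf->; rewrite addr0.
congr (_ + _).
  rewrite (@big_cat_nat _ _ _ m) //=; last by lia.
  rewrite big_nat_cond big1 ?add0r => [|i]; last by lia.
  rewrite -{1}[m]add0n big_addn (_ : (m + f).+1 - m = f.+1)%N; last by lia.
  rewrite big_mkord; apply: eq_big => i /=; first by rewrite leq_addl addnK.
  by rewrite leq_addl addnK /= => /up[]; rewrite /G addnC => -> ->.
transitivity (\sum_(m <= i < f.+1 | I i) G (i - m)%N).
  rewrite [RHS](_ : _ = \sum_(0 + m <= i < f.+1 | I i) G (i - m)%N) // big_addn.
  rewrite (@big_cat_nat _ _ _ (f.+1 - m)%N) //=; last by lia.
  rewrite [X in _ + X]big_nat_cond [X in _ + X]big1 ?addr0 => [|i /andP[ib /fam[le _ _ _]]]; last by lia.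
  by apply: eq_bigr => i _; rewrite addnK.
rewrite -[RHS](big_mkord I (fun i => mu i * ((i.+1 - m)%:R / i.+1%:R) *
   sandwich (i - m) (iter m kbend (kmul i (q i) (symk i))) x y)).
have [mf|mf] := leqP m f.+1.
  rewrite [RHS](@big_cat_nat _ _ _ m) //= [X in _ = X + _]big_nat_cond [X in _ = X + _]big1 ?add0r.
    by apply: eq_bigr => i Ii; rewrite /G; have [-> ->] := down Ii; ring.
  by move=> i /andP[ib /Im]; lia.
rewrite [LHS]big_geq; last by lia.
by rewrite big_nat_cond big1 // => i /andP[ib /Im]; lia.
Qed.

Variables (p s : nat).
Hypothesis p_pr : prime p.
Hypothesis m_lt : (m < p ^ s.+1)%N.
Hypothesis m_div : (p ^ s %| m)%N.
Hypothesis f_div : (p ^ s.+1 %| f.+1)%N.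
Hypothesis I_mod : forall i, I i -> (i.+1 = f.+1 %[mod (p ^ s.+1).*2])%N.

Lemma pintk_iter_ten l K : pintk p K -> pintk p (iter l kten K).
Proof.
move=> pK; elim: l => //= l IH [|c x] [|d y] /=; try exact: (pint_int p_pr 0).
by apply: pint_mul => //; apply: pint_nat.
Qed.

(** By [iter_ten_sym] the sum of f, tensored with m strands, is the sum of m + f plus a remainder.
    As i + 1 = f + 1 modulo 2 p^(s+1) and p^(s+1) divides f + 1, both i + m and i - m are linked to
    m + f. No j strictly between them is, because 2 m < 2 p^(s+1). *)
Lemma family_step_pint : pintk p (family_sum f I mu q) ->
  pintk p (family_sum (m + f) I' mu' q').
Proof.
move=> pf; have mlt := m_lt; have fdiv := f_div; have Imod := I_mod.
have [M ME] : {M | M = p ^ s.+1}%N by exists (p ^ s.+1)%N.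
rewrite -ME in mlt fdiv Imod.
have dM i : I i -> (M.*2 %| f.+1 + i.+1)%N.
  by move=> Ii; rewrite /dvdn -modnDmr Imod // modnDmr addnn -!muln2 -/(dvdn _ _) dvdn_pmul2r.
have split_i (i : nat) : I i -> exists2 K, isotypic (fun j => ~~ block p s (m + f) j) (m + f) K &
    iter m kten (sandwich i (q i)) = kadd (kadd (sandwich (m + i) (iter m kten (q i)))
     (kscale ((i.+1 - m)%:R / i.+1%:R) (sandwich (i - m) (iter m kbend (kmul i (q i) (symk i)))))) K.
  move=> Ii; have mi := Im Ii; have [_ ei _ _] := fam Ii.
  have [K iK E] := iter_ten_sym (subnKC mi) m_gt0.
  have e := eqv_iter_ten m ei.
  exists (kmul (m + i) (iter m kten (q i)) (kmul (m + i) K (ktr (iter m kten (q i))))).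
    apply: isotypic_conj => //; first exact: eqv_tr.
    apply: isotypic_sub iK => j /and3P[kj ji _].
    have {}dM := dM i Ii.
    rewrite /block -ME negb_or; apply/andP; split.
      apply/negP => /eqP ej; have : (m + i == j %[mod M.*2])%N.
        rewrite ej -(eqn_modDr 1) -!addnA !addn1 -modnDmr Imod // modnDmr eqxx //.
      rewrite eqn_mod_dvd; last exact: ltnW.
      move=> dv; have := dvdn_leq _ dv; move: mlt kj ji mi; clear; lia.
    rewrite (_ : j + (m + f) + 2 = (f.+1 + i.+1) + (j - (i - m)))%N; last by move: kj mi; clear; lia.
    rewrite dvdn_addr //; apply/negP => dv; have := dvdn_leq _ dv; move: mlt kj ji mi; clear; lia.
  rewrite /sandwich -!iter_tenM E -iter_ten_tr !kmulDl !kmulDr; congr (kadd (kadd _ _) _).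
  rewrite kmulZl kmulZr; congr kscale; first by congr (_%:R / _); lia.
  by rewrite /sandwich -iter_ten_bend_mul ktrM -!kmulA.
have H i : exists K : kernel, I i ->
    isotypic (fun j => ~~ block p s (m + f) j) (m + f) K /\
    iter m kten (sandwich i (q i)) = kadd (kadd (sandwich (m + i) (iter m kten (q i)))
     (kscale ((i.+1 - m)%:R / i.+1%:R) (sandwich (i - m) (iter m kbend (kmul i (q i) (symk i)))))) K.
  have [Ii|_] := boolP (I i); last by exists kop0.
  by have [K ? ?] := split_i i Ii; exists K.
have [K hK] := choice H.
have pm : (p ^ s %| (m + f).+1)%N.
  by rewrite -addnS dvdn_addr // (dvdn_trans _ fdiv) // ME dvdn_exp2l.
pose R : kernel := fun x y => \sum_(i < f.+1 | I i) mu i * K i x y.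
apply: (@block_integral p p_pr s (m + f) _ R pm).
- rewrite (_ : family_sum _ _ _ _ = kadd
    (fun x y => \sum_(i < f.+1 | I i) mu i * sandwich (m + i) (iter m kten (q i)) x y)
    (fun x y => \sum_(i < f.+1 | I i) mu i * ((i.+1 - m)%:R / i.+1%:R) *
      sandwich (i - m) (iter m kbend (kmul i (q i) (symk i))) x y)); last first.
    by apply: kernelP => x y; rewrite family_sum_step big_split.
  apply: isotypic_add; apply: isotypic_sum => i Ii; have [_ ei _ _] := fam Ii.
    have e := eqv_iter_ten m ei.
    apply: isotypic_one e (eqv_tr e); rewrite /block -ME; apply/orP; left.
    by rewrite -(eqn_modDr 1) -!addnA !addn1 -modnDmr Imod // modnDmr.
  have e : eqv (m + f) (i - m) (iter m kbend (kmul i (q i) (symk i))).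
    by apply: eqv_iter_bend; rewrite subnKC ?Im //; apply: eqv_mul ei (eqv_sym i).
  apply: isotypic_one e (eqv_tr e); rewrite /block -ME; apply/orP; right.
  by have mi := Im Ii; rewrite (_ : i - m + (m + f) + 2 = f.+1 + i.+1)%N ?dM //; lia.
- by apply: isotypic_sum => i /hK[].
- rewrite (_ : kadd _ _ = iter m kten (family_sum f I mu q)); first exact: pintk_iter_ten.
  have lin l : iter l kten (family_sum f I mu q) =
      fun x y => \sum_(i < f.+1 | I i) mu i * iter l kten (sandwich i (q i)) x y.
    elim: l => [|l IH] //=; rewrite IH; apply: kernelP => -[|c x] [|d y] /=;
      try by rewrite big1 // => i _; rewrite mulr0.
    by rewrite mulr_sumr; apply: eq_bigr => i _; rewrite mulrCA.
  rewrite lin; apply: kernelP => x y; rewrite /kadd family_sum_step /R -big_split /=.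
  by apply: eq_bigr => i Ii; have [_ ->] := hK i Ii; rewrite /kadd /kscale; ring.
Qed.
End Step.

(** * Crossingless matchings *)

Lemma pos_lt m n (x : point m n) : (pos x < m + n)%N.
Proof. by case: x => i /=; have := ltn_ord i; lia. Qed.

Lemma pos_inj m n : injective (@pos m n).
Proof.
move=> [i|i] [j|j] /= e; have hi := ltn_ord i; have hj := ltn_ord j;
  try (by exfalso; lia); congr (_ _); apply: val_inj => /=; lia.
Qed.

Section Matching.
Variables m n : nat.
Implicit Types f : matching m n.

Lemma matchingK f : involutive f.
Proof. by have /crossinglessP[] := valP f. Qed.

Lemma matching_neq f x : f x != x.
Proof. by have /crossinglessP[_ h _] := valP f; apply/eqP. Qed.

Lemma matching_cross f x y :
  ~ [/\ pos x < pos y, pos y < pos (f x) & pos (f x) < pos (f y)]%N.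
Proof. by have /crossinglessP[_ _] := valP f; apply. Qed.

Lemma matching_inj f : injective f. Proof. exact: inv_inj (matchingK f). Qed.

Lemma pos_neq f x : pos (f x) != pos x.
Proof. by apply/eqP => /pos_inj/eqP; rewrite (negPf (matching_neq f x)). Qed.

Definition stable f (A : pred (point m n)) := forall x, A (f x) = A x.

(** Each arc inside A contributes two numbers of equal parity; the sum is regrouped by the end of
    smaller position. *)
Lemma stable_sum_even f (A : pred (point m n)) (c : point m n -> nat) :
  stable f A -> (forall x, A x -> odd (c (f x)) = odd (c x)) ->
  ~~ odd (\sum_(x | A x) c x).
Proof.
move=> sA oc; rewrite (bigID (fun x => pos x < pos (f x))%N) /= addnC.
rewrite (reindex_inj (@matching_inj f)) /=.
have -> : (\sum_(x | A (f x) && ~~ (pos (f x) < pos (f (f x)))) c (f x) =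
    \sum_(x | A x && (pos x < pos (f x))) c (f x))%N.
  by apply: eq_bigl => x; rewrite sA matchingK -leqNgt ltn_neqAle eq_sym pos_neq.
rewrite -big_split /=; elim/big_ind: _ => // [x y hx hy|x /andP[Ax _]]; first by rewrite oddD (negPf hx).
by rewrite oddD oc // addbb.
Qed.

Lemma stable_even f (A : pred (point m n)) : stable f A -> ~~ odd #|A|.
Proof. by move=> sA; rewrite -sum1_card; apply: (stable_sum_even sA). Qed.

Definition between (a b : nat) (x : point m n) :=
  (a < pos x < b)%N || (b < pos x < a)%N.

(** An arc leaving the interval would interleave with the arc of x. *)
Lemma between_stable f x : stable f (between (pos x) (pos (f x))).
Proof.
suff H y z : between (pos y) (pos (f y)) z -> between (pos y) (pos (f y)) (f z).
  by move=> z; apply/idP/idP => [/H|/H//]; rewrite matchingK.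
wlog yfy : y / (pos y < pos (f y))%N.
  move=> W; have [h|h|h] := ltngtP (pos y) (pos (f y)); first exact: W.
    have := W (f y); rewrite matchingK /between => /(_ h).
    by rewrite ![(pos (f y) < _ < _)%N || _]orbC.
  by have := pos_neq f y; rewrite h eqxx.
rewrite /between => /orP[/andP[h1 h2]|]; last by lia.
apply/orP; left.
have zy : pos (f z) != pos y.
  by apply/eqP => /pos_inj e; move: h2; rewrite -e matchingK ltnn.
have zy' : pos (f z) != pos (f y).
  by apply/eqP => /pos_inj/matching_inj e; move: h1; rewrite e ltnn.
have := matching_cross (f := f) (x := y) (y := z).
have := matching_cross (f := f) (x := f z) (y := y); rewrite matchingK.
have [h|h|h] := ltngtP (pos (f z)) (pos y); last by rewrite h eqxx in zy.
  by move=> []; split.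
have [//|h'|h'] := ltngtP (pos (f z)) (pos (f y)); last by rewrite h' eqxx in zy'.
by move=> _ []; split.
Qed.

(* Across two stable sets the number of pairs in decreasing position is even,
   since arcs of a crossingless matching do not interleave. *)
Lemma stable_pairs_even f (A B : pred (point m n)) : stable f A -> stable f B ->
  (forall x, A x -> B x -> False) ->
  ~~ odd (\sum_(x | A x) \sum_(y | B y) (pos y < pos x)%N).
Proof.
move=> sA sB AB; apply: (stable_sum_even sA) => x Ax.
have e (u v : nat) : ~~ odd (u + v) -> odd u = odd v by rewrite oddD; case: odd; case: odd.
apply: e; rewrite -big_split /=.
(* Counting against x and [f x] together, a y outside the arc counts twice or not at all and a y
   under the arc counts once; the latter are even in number. *)
rewrite (eq_bigr (fun y => between (pos x) (pos (f x)) y + (pos y < minn (pos x) (pos (f x))).*2)%N); last first.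
  move=> y By; have yx : pos y != pos x by apply/eqP => /pos_inj e'; apply: (AB x); rewrite // -e'.
  have yfx : pos y != pos (f x).
    by apply/eqP => /pos_inj e'; apply: (AB (f x)); rewrite ?sA // -e'.
  by rewrite /between; move: yx yfx; clear; lia.
rewrite big_split /= oddD.
have -> : odd (\sum_(y | B y) (pos y < minn (pos x) (pos (f x)))%N.*2) = false.
  by elim/big_rec: _ => // y k _ h; rewrite oddD odd_double h.
rewrite addbF; have := stable_sum_even (f := f) (A := fun y => B y && between (pos x) (pos (f x)) y) (c := fun=> 1%N).
have -> : (\sum_(y | B y && between (pos x) (pos (f x)) y) 1 =
    \sum_(y | B y) between (pos x) (pos (f x)) y)%N.
  by rewrite big_mkcondr; apply: eq_bigr => y _; case: between.
by apply=> // y; rewrite sB between_stable.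
Qed.
End Matching.

Section Parity.
Variables m n : nat.
Implicit Types (f : matching m n) (x : point m n).

(* The parity of [pos x], since m + n is even as soon as there is a matching. *)
Definition cls x : bool :=
  match x with inl i => odd i | inr j => ~~ odd j end.

Lemma card_pos_lt b : (b <= m + n)%N -> #|[pred x : point m n | pos x < b]%N| = b.
Proof.
move=> bmn; pose g x := Ordinal (pos_lt x).
have gi : injective g by move=> x y /(congr1 val)/pos_inj.
have gb : bijective g by apply: inj_card_bij => //; rewrite card_ord card_sum !card_ord.
have -> : #|[pred x : point m n | pos x < b]%N| = #|[pred k : 'I_(m + n) | k < b]%N|.
  have [h hg gh] := gb.
  rewrite -(card_image gi); apply: eq_card => k; apply/fintype.imageP/idP => [[x xb ->]//|kb].
  by exists (h k); rewrite ?gh // inE -[pos _]/(val (g (h k))) gh.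
rewrite -sum1_card (eq_bigl (fun k : 'I_(m + n) => (k < b)%N)) //.
by rewrite (big_ord_narrow bmn) sum1_card card_ord.
Qed.

Lemma matching_even f : ~~ odd (m + n).
Proof.
have := @stable_even m n f predT (fun=> erefl).
by rewrite card_sum !card_ord.
Qed.

Lemma cls_pos x : ~~ odd (m + n) -> cls x = odd (pos x).
Proof.
case: x => // j; rewrite /= oddD => e; have jn := ltn_ord j.
by rewrite oddD oddB //=; move: e; case: (odd m); case: (odd n); case: (odd j).
Qed.

(** The points between the ends of an arc are matched among themselves, so their number is even. *)
Lemma cls_matching f x : cls (f x) = ~~ cls x.
Proof.
have e := matching_even f; rewrite !cls_pos //.
wlog xfx : x / (pos x < pos (f x))%N.
  move=> W; have [h|h|h] := ltngtP (pos x) (pos (f x)); first exact: W.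
    by have := W (f x); rewrite matchingK => /(_ h) ->; rewrite negbK.
  by have := pos_neq f x; rewrite h eqxx.
have := stable_even (between_stable f x).
have -> : #|@between m n (pos x) (pos (f x))| = (pos (f x) - (pos x).+1)%N.
  have : #|[pred y : point m n | pos y < pos (f x)]%N| =
      (#|[pred y : point m n | pos y < (pos x).+1]%N| + #|@between m n (pos x) (pos (f x))|)%N.
    rewrite -(cardID [pred y : point m n | pos y < (pos x).+1]%N).
    by congr addn; apply: eq_card => y; rewrite !inE /between; move: xfx; clear; lia.
  rewrite !card_pos_lt; [by move=> E; rewrite {2}E addKn|exact: pos_lt|exact: ltnW (pos_lt _)].
by rewrite oddB //=; case: (odd (pos x)); case: (odd (pos (f x))).
Qed.

End Parity.

(** * Stacking *)

(** [pos] runs along the bottom edge and then backwards along the top one: top points come after all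
    bottom points, and their order is reversed. *)
Lemma pairs_split p q (A B : pred (point p q)) :
  (\sum_(u | A u) \sum_(v | B v) (pos v < pos u) =
   \sum_(i | A (inl i)) \sum_(i' | B (inl i')) (i' < i) +
   (\sum_(j | A (inr j)) 1) * (\sum_(i | B (inl i)) 1) +
   \sum_(j | A (inr j)) \sum_(j' | B (inr j')) (j < j'))%N.
Proof.
rewrite big_sumType /= -addnA; congr addn.
  apply: eq_bigr => i _; rewrite big_sumType /= [X in (_ + X)%N]big1 ?addn0 // => j _.
  by have := ltn_ord i; case: ltnP => //; lia.
rewrite big_distrl /= -big_split /=; apply: eq_bigr => j _.
rewrite big_sumType mul1n /=; congr addn; apply: eq_bigr => i _.
  by have := ltn_ord i; case: ltnP => //; lia.
by have := ltn_ord i; have := ltn_ord j => hj hi; congr nat_of_bool; lia.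
Qed.

Section Stack.
Variables m n k : nat.
Variables (g : matching n k) (f : matching m n).
Local Notation X := (spoint m n k).
Local Notation low := (@low_point m n k).
Local Notation high := (@high_point m n k).
Local Notation outer := (@outer_point m n k).
Local Notation e := (stack_rel g f).

Lemma stack_relP x y :
  reflect ((exists u, x = low u /\ y = low (f u)) \/ (exists v, x = high v /\ y = high (g v)))
          (e x y).
Proof.
apply: (iffP orP) => -[].
- by case/existsP => u /andP[/eqP-> /eqP->]; left; exists u.
- by case/existsP => u /andP[/eqP-> /eqP->]; right; exists u.
- by case=> u [-> ->]; left; apply/existsP; exists u; rewrite !eqxx.
- by case=> u [-> ->]; right; apply/existsP; exists u; rewrite !eqxx.
Qed.

Lemma stack_rel_low u : e (low u) (low (f u)).
Proof. by apply/stack_relP; left; exists u. Qed.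

Lemma stack_rel_high v : e (high v) (high (g v)).
Proof. by apply/stack_relP; right; exists v. Qed.

Lemma stack_rel_sym : symmetric e.
Proof.
suff H x y : e x y -> e y x by move=> x y; apply/idP/idP; apply: H.
case/stack_relP => -[u [-> ->]].
  by rewrite -{2}(matchingK f u) stack_rel_low.
by rewrite -{2}(matchingK g u) stack_rel_high.
Qed.

Lemma stack_connect_sym : connect_sym e.
Proof. exact: sym_connect_sym stack_rel_sym. Qed.

(* Curves of the stacked diagram are travelled along in the direction in which
   the marked points of class [o] are left. *)
Definition step (o : bool) (x : X) : X :=
  match x with
  | inl u => if cls u == o then low (f u) else
      match u with inl _ => x | inr j => high (g (inl j)) end
  | inr l => if cls (inr l : point n k) == o then high (g (inr l)) else x
  end.

Variant step_spec (o : bool) : X -> X -> Type :=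
| StepLow u of cls u = o : step_spec o (low u) (low (f u))
| StepHigh v of cls v = o : step_spec o (high v) (high (g v))
| StepStop y of cls y = ~~ o : step_spec o (outer y) (outer y).

Lemma stepP o x : step_spec o x (step o x).
Proof.
case: x => [u|l] /=; case: eqP => h; try exact: StepLow.
- case: u h => [i|j] /= h.
    by apply: (@StepStop o (inl i : point m k)); move: h => /=; case: odd; case: o.
  by apply: (@StepHigh o (inl j : point n k)); move: h => /=; case: odd; case: o.
- exact: (@StepHigh o (inr l : point n k)).
- by apply: (@StepStop o (inr l : point m k)); move: h => /=; case: odd; case: o.
Qed.

Lemma step_low o u : cls u = o -> step o (low u) = low (f u).
Proof. by move=> h; rewrite /= h eqxx. Qed.

Lemma step_high o v : cls v = o -> step o (high v) = high (g v).
Proof.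
case: v => [j|l] /= h; last by rewrite h eqxx.
by rewrite h; case: o {h}.
Qed.

Lemma step_stop o y : cls y = ~~ o -> step o (outer y) = outer y.
Proof. by case: y => [i|l] /= ->; case: o. Qed.

Lemma stack_rel_step o x y : e x y -> step o x = y \/ step o y = x.
Proof.
case/stack_relP => -[u [-> ->]].
  have [h|h] := eqVneq (cls u) o; first by left; apply: step_low.
  by right; rewrite step_low ?matchingK // cls_matching; move: h; case: cls; case: o.
have [h|h] := eqVneq (cls u) o; first by left; apply: step_high.
by right; rewrite step_high ?matchingK // cls_matching; move: h; case: cls; case: o.
Qed.

Lemma outer_inj : injective outer.
Proof. by case=> [i|l] [i'|l'] //= [->]. Qed.

(** Every edge is a [step o] in one direction and y' is fixed by it, so the points from which
    [step o] leads to y' form a union of components. It contains y, which is fixed as well. *)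
Lemma end_unique o y y' : cls y = ~~ o -> cls y' = ~~ o ->
  connect e (outer y) (outer y') -> y = y'.
Proof.
move=> cy cy' c.
have sy := step_stop cy; have sy' := step_stop cy'.
pose A := [pred x | fconnect (step o) x (outer y')].
have back x : fconnect (step o) x (outer y') = fconnect (step o) (step o x) (outer y').
  apply/idP/idP => [h|h]; last exact: connect_trans (fconnect1 _ _) h.
  have := iter_findex h; case: (findex _ _ _) => [/= ->|i <-]; first by rewrite sy'.
  by rewrite iterSr fconnect_iter.
have clA : closed e A.
  by move=> x z /(stack_rel_step o) [<-|<-]; [apply: back|apply/esym/back].
have /iter_findex : fconnect (step o) (outer y) (outer y').
  by have := closed_connect clA c; rewrite !inE => ->; apply: connect0.
suff -> i : iter i (step o) (outer y) = outer y by move/outer_inj.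
by elim: i => //= i ->.
Qed.

Section Closed.
Variables A B : pred X.
Hypothesis clA : closed e A.
Hypothesis clB : closed e B.

Lemma low_stable : stable f (fun u => A (low u)).
Proof. by move=> u; have := clA (stack_rel_low u). Qed.

Lemma high_stable : stable g (fun v => A (high v)).
Proof. by move=> v; have := clA (stack_rel_high v). Qed.

Lemma outer_even : ~~ odd #|[pred y | A (outer y)]|.
Proof.
have := stable_even low_stable; have := stable_even high_stable.
rewrite -!sum1_card !big_sumType /= !oddD.
by do 3 case: (odd (bigop.body _ _ _)).
Qed.

Hypothesis AB : forall x, A x -> B x -> False.

(** Add the counts for f and g. On the common edge the two orders are opposite, so its pairs
    contribute the product of the numbers of points of A and B there. Modulo 2, B has as many points
    on the common edge as on the bottom one, which turns the mixed terms into those of the outer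
    rectangle. *)
Lemma outer_pairs_even :
  ~~ odd (\sum_(y | A (outer y)) \sum_(y' | B (outer y')) (pos y' < pos y)%N).
Proof.
have lB u : B (low (f u)) = B (low u) by have := clB (stack_rel_low u).
have hB v : B (high (g v)) = B (high v) by have := clB (stack_rel_high v).
have := stable_pairs_even low_stable lB (fun x => @AB (low x)).
have := stable_pairs_even high_stable hB (fun x => @AB (high x)).
have := stable_even lB.
have mid : (\sum_(j | A (inl (inr j))) \sum_(j' | B (inl (inr j'))) (j < j') +
    \sum_(j | A (inl (inr j))) \sum_(j' | B (inl (inr j'))) (j' < j) =
    (\sum_(j | A (inl (inr j))) 1) * (\sum_(j | B (inl (inr j))) 1))%N.
  rewrite big_distrl -big_split; apply: eq_bigr => j Aj /=; rewrite -big_split mul1n.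
  apply: eq_bigr => j' Bj' /=; case: ltngtP => // e'; case: (AB Aj).
  by rewrite (_ : j = j') //; apply: val_inj.
rewrite !pairs_split -sum1_card big_sumType /= !oddD !oddM.
have := congr1 odd mid; rewrite oddD oddM.
do 11 case: (odd (bigop.body _ _ _)) => //.
Qed.

End Closed.

(** A component has an even number of outer points, so x is not the only one. *)
Lemma mate_exists x : exists y, (y != x) && connect e (outer x) (outer y).
Proof.
apply: contrapT => nex.
have cl : closed e (connect e (outer x)).
  by move=> y z yz; apply: same_connect_r => //; [exact: stack_connect_sym|exact: connect1].
have := outer_even cl; rewrite (@eq_card1 _ x) // => y.
rewrite !inE; apply/idP/eqP => [c|->]; last exact: connect0.
by apply: contrapT => /eqP yx; case: nex; exists y; rewrite yx.
Qed.

Definition mate x : point m k := xchoose (mate_exists x).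

Lemma mate_neq x : mate x != x.
Proof. by have /andP[] := xchooseP (mate_exists x). Qed.

Lemma mate_connect x : connect e (outer x) (outer (mate x)).
Proof. by have /andP[] := xchooseP (mate_exists x). Qed.

Lemma connect_cls x y : connect e (outer x) (outer y) -> y != x -> cls y = ~~ cls x.
Proof.
move=> c yx; apply/eqP; apply: contraNT yx => h.
have h' : cls y = cls x by move: h; case: (cls y); case: (cls x).
by rewrite eq_sym; apply/eqP/(@end_unique (~~ cls x)); rewrite ?negbK.
Qed.

Lemma mate_unique x y : connect e (outer x) (outer y) -> y != x -> y = mate x.
Proof.
move=> c yx; apply: (@end_unique (cls x)).
- exact: connect_cls.
- exact: connect_cls (mate_connect x) (mate_neq x).
- by rewrite stack_connect_sym in c; apply: connect_trans c (mate_connect x).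
Qed.

Lemma mateK : involutive mate.
Proof.
move=> x; apply/esym/mate_unique; last by rewrite eq_sym mate_neq.
by rewrite stack_connect_sym mate_connect.
Qed.

Lemma connect_mate x z : connect e (outer x) (outer z) = (z == x) || (z == mate x).
Proof.
apply/idP/orP => [c|[/eqP->|/eqP->]]; [|exact: connect0|exact: mate_connect].
by have [->|zx] := eqVneq z x; [left|right; apply/eqP/mate_unique].
Qed.

(** Interleaved pairs would give exactly one decreasing pair of positions between the two
    components, against [outer_pairs_even]. *)
Lemma mate_crossingless : crossingless (finfun mate).
Proof.
apply/crossinglessP; split=> [x|x|x y]; rewrite !ffunE ?mateK //.
  by apply/eqP/mate_neq.
move=> [xy yx' xy'].
have cl z : closed e (connect e (outer z)).
  by move=> u v uv; apply: same_connect_r => //; [exact: stack_connect_sym|exact: connect1].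
have dis z : connect e (outer x) z -> connect e (outer y) z -> False.
  move=> cx cy; have : connect e (outer x) (outer y).
    by apply: connect_trans cx _; rewrite stack_connect_sym.
  by rewrite connect_mate => /orP[] /eqP E; move: xy yx'; rewrite E ltnn.
have := outer_pairs_even (cl x) (cl y) dis.
have S (z : point m k) (G : point m k -> nat) :
    (\sum_(u | connect e (outer z) (outer u)) G u = G z + G (mate z))%N.
  rewrite (bigD1 z) ?connect0 //= (bigD1 (mate z)) ?mate_connect ?mate_neq //=.
  rewrite big1 ?addn0 // => u; rewrite connect_mate.
  by case: eqP; case: eqP.
rewrite !S !oddD; move: xy yx' xy'.
have := mateK x.
by do 4 (case: ltnP => ? //=); lia.
Qed.

Definition stack : matching m k := Matching mate_crossingless.

Lemma stackedP (h : matching m k) : reflect (h = stack) (stacked g f h).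
Proof.
apply: (iffP forallP) => [hc|-> x]; last by rewrite /= ffunE mate_connect.
apply: val_inj; apply/ffunP => x; rewrite ffunE.
by apply: mate_unique (hc x) (matching_neq h x).
Qed.
End Stack.

(** * Labellings constant along curves *)

Definition lab m n (x : 'I_m -> bool) (y : 'I_n -> bool) (u : point m n) : bool :=
  match u with inl i => x i | inr j => y j end.

Definition invariant_lab m n (f : matching m n) (l : point m n -> bool) : bool :=
  [forall u, l (f u) == l u].

Lemma invariant_labP m n (f : matching m n) l :
  reflect (forall u, l (f u) = l u) (invariant_lab f l).
Proof. exact: eqfunP. Qed.

Section Labels.
Variables m n k : nat.
Variables (g : matching n k) (f : matching m n).
Variables (x : 'I_m -> bool) (z : 'I_k -> bool).
Local Notation X := (spoint m n k).
Local Notation low := (@low_point m n k).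
Local Notation high := (@high_point m n k).
Local Notation outer := (@outer_point m n k).
Local Notation e := (stack_rel g f).

Let full (y : 'I_n -> bool) (a : X) : bool :=
  match a with inl u => lab x y u | inr l => z l end.

Lemma full_low y u : full y (low u) = lab x y u. Proof. by []. Qed.
Lemma full_high y v : full y (high v) = lab y z v. Proof. by case: v. Qed.
Lemma full_outer y w : full y (outer w) = lab x z w. Proof. by case: w. Qed.

Let good (y : {ffun 'I_n -> bool}) : bool :=
  invariant_lab f (lab x y) && invariant_lab g (lab y z).

Lemma goodP (y : {ffun 'I_n -> bool}) : reflect (forall a b, e a b -> full y a = full y b) (good y).
Proof.
apply: (iffP andP) => [[/invariant_labP hf /invariant_labP hg] a b|h].
  case/stack_relP => -[u [-> ->]]; first by rewrite !full_low hf.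
  by rewrite !full_high hg.
split; apply/invariant_labP => u.
  by rewrite -!full_low; apply/esym/h/stack_rel_low.
by rewrite -!full_high; apply/esym/h/stack_rel_high.
Qed.

Lemma good_connect (y : {ffun 'I_n -> bool}) a b : good y -> connect e a b -> full y a = full y b.
Proof.
move=> /goodP h; pose A := [pred c | full y a == full y c].
have clA : closed e A by move=> c d /h; rewrite !inE => ->.
by move/(closed_connect clA); rewrite !inE eqxx => /esym/eqP.
Qed.

Let loop := [pred a : X | [forall w, ~~ connect e a (outer w)]].
Let D := [set a | (a \in roots e) && loop a].

Lemma card_D : #|D| = loops g f.
Proof. by rewrite cardsE; apply: eq_card => a; rewrite !inE. Qed.

Let value (R : {set X}) (a : X) : bool :=
  if [pick w | connect e a (outer w)] is Some w then lab x z w else fingraph.root e a \in R.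

Lemma value_connect R a b : e a b -> value R a = value R b.
Proof.
move=> ab; have c := connect1 ab; have sym := stack_connect_sym g f.
have E : [pick w | connect e a (outer w)] = [pick w | connect e b (outer w)].
  by apply: eq_pick => w /=; rewrite (same_connect sym c).
by rewrite /value E (fingraph.rootP sym c).
Qed.

(** Compatible labels of the common edge are forced by the outer ones on open curves and free on
    each loop. They are encoded by the set of roots of loops labelled [true], of which there are 2
    to the number of loops. *)
Lemma card_labels :
  #|[set y | good y]| = if invariant_lab (stack g f) (lab x z) then (2 ^ loops g f)%N else 0%N.
Proof.
have sym := stack_connect_sym g f.
have [inv|ninv] := boolP (invariant_lab _ _); last first.
  apply/eqP; rewrite cards_eq0; apply/eqP/setP => y; rewrite !inE.
  apply: contraNF ninv => gy; apply/invariant_labP => w.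
  rewrite -!(full_outer y); apply: good_connect => //.
  by rewrite sym /= ffunE mate_connect.
pose phi (y : {ffun 'I_n -> bool}) := [set r in D | full y r].
have -> : #|[set y | good y]| = #|phi @: [set y | good y]|.
  apply/esym/card_in_imset => y y'; rewrite !inE => gy gy' /setP E.
  apply/ffunP => j; rewrite -[y j]/(full y (inl (inr j))) -[y' j]/(full y' (inl (inr j))).
  move: (inl _ : X) => a; have [/existsP[w c]|na] := boolP [exists w, connect e a (outer w)].
    by rewrite (good_connect gy c) (good_connect gy' c) !full_outer.
  rewrite (good_connect gy (connect_root e a)) (good_connect gy' (connect_root e a)).
  have := E (fingraph.root e a); rewrite !inE roots_root //=.
  have -> // : [forall w, ~~ connect e (fingraph.root e a) (outer w)].
  rewrite negb_exists in na; apply/forallP => w; have := forallP na w.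
  by rewrite (same_connect sym (connect_root e a)).
rewrite -card_D -card_powerset; apply: eq_card => R; rewrite powersetE.
apply/imsetP/fintype.subsetP => [[y gy ->] r|RD]; first by rewrite inE => /andP[].
have inv' := invariant_labP _ _ inv.
have vo w : value R (outer w) = lab x z w.
  rewrite /value; case: pickP => [w'|/(_ w)]; last by rewrite connect0.
  by rewrite connect_mate => /orP[/eqP->//|/eqP->]; have := inv' w; rewrite /= ffunE.
pose y := [ffun j => value R (inl (inr j))] : {ffun 'I_n -> bool}.
have fy a : full y a = value R a.
  case: a => [[i|j]|l] /=; first exact: esym (vo (inl i)).
    by rewrite ffunE.
  exact: esym (vo (inr l)).
exists y; first by rewrite inE; apply/goodP => a b ab; rewrite !fy (value_connect _ ab).
apply/setP => r; rewrite inE fy; apply/idP/andP => [rR|[rD]].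
  have rD := RD _ rR; split=> //; move: rD; rewrite inE => /andP[rr /forallP lr].
  rewrite /value; case: pickP => [w c|_]; first by have := lr w; rewrite c.
  by move/eqP: rr => ->.
move: rD; rewrite inE => /andP[rr /forallP lr].
rewrite /value; case: pickP => [w c|_]; first by have := lr w; rewrite c.
by move/eqP: rr => ->.
Qed.

End Labels.

(** * Signs *)

Section PermExtension.
Variables (A B : finType) (j : A -> B).
Hypothesis j_inj : injective j.

Lemma perm_extend (s : {perm A}) : exists t : {perm B},
  [/\ forall a, t (j a) = j (s a), forall b, b \notin codom j -> t b = b &
      odd_perm t = odd_perm s].
Proof.
have [ts -> dts] := prod_tpermP s.
exists (\prod_(t <- ts) tperm (j t.1) (j t.2))%g; split.
- move=> a; elim: ts {dts} a => [|t ts IH] a; first by rewrite !big_nil !perm1.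
  by rewrite !big_cons !permM -inj_tperm // IH.
- move=> b bj; elim: ts {dts} => [|t ts IH]; first by rewrite big_nil perm1.
  rewrite big_cons permM tpermD ?IH //; apply: contraNneq bj => <-; exact: codom_f.
- rewrite odd_perm_prod // -(big_map (fun t => (j t.1, j t.2)) xpredT (fun t => tperm t.1 t.2)).
  rewrite odd_perm_prod ?size_map // all_map; apply: sub_all dts => t /=.
  by rewrite /dpair /= inj_eq.
Qed.

Lemma odd_perm_extend (s : {perm A}) (t : {perm B}) :
  (forall a, t (j a) = j (s a)) -> (forall b, b \notin codom j -> t b = b) ->
  odd_perm t = odd_perm s.
Proof.
move=> ts tb; have [t' [ts' tb' <-]] := perm_extend s; congr odd_perm.
apply/permP => b; have [/codomP[a ->]|bj] := boolP (b \in codom j); first by rewrite ts ts'.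
by rewrite tb // tb'.
Qed.

End PermExtension.

Section RelativeSign.
Variables m n : nat.
Implicit Types f : matching m n.

Definition rel_fun (o : bool) f f' (x : point m n) : point m n :=
  if cls x == o then f' (f x) else x.

Lemma rel_funK o f f' : cancel (rel_fun o f f') (rel_fun o f' f).
Proof.
move=> x; rewrite /rel_fun; have [<-|/negPf h] := eqVneq (cls x) o; last by rewrite h.
by rewrite !cls_matching negbK eqxx !matchingK.
Qed.

Definition rel_perm o f f' : {perm point m n} := perm (can_inj (rel_funK o f f')).

Lemma rel_permE o f f' x : rel_perm o f f' x = rel_fun o f f' x.
Proof. exact: permE. Qed.

Lemma rel_permV o f f' : (rel_perm o f f')^-1%g = rel_perm o f' f.
Proof.
by apply/permP => x; apply: (@perm_inj _ (rel_perm o f f')); rewrite permKV !rel_permE rel_funK.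
Qed.

(* The sign of f' o f on the points of one class; it plays the role of the
   parity by which the signs of f and f' differ. *)
Definition rsign f f' : bool := odd_perm (rel_perm false f f').

(** f itself conjugates the permutation on one class to the inverse of that on the other. *)
Lemma rsign_true f f' : odd_perm (rel_perm true f f') = rsign f f'.
Proof.
pose F := perm (@matching_inj _ _ f).
have -> : rel_perm true f f' = ((rel_perm false f f')^-1 ^ F)%g.
  apply/permP => x; have -> : x = F (f x) by rewrite permE matchingK.
  rewrite permJ rel_permV !rel_permE !permE /rel_fun matchingK cls_matching.
  by case: (cls x); rewrite /= matchingK.
by rewrite odd_permJ odd_permV.
Qed.

Lemma rsign_trans f f' f'' : rsign f f'' = rsign f f' (+) rsign f' f''.
Proof.
rewrite /rsign -odd_permM; congr odd_perm; apply/permP => x.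
rewrite permM !rel_permE /rel_fun; have [e|/negPf h] := eqVneq (cls x) false; last by rewrite h.
by rewrite !cls_matching e /= matchingK.
Qed.

Lemma rsignxx f : rsign f f = false.
Proof. by have := rsign_trans f f f; case: rsign. Qed.

End RelativeSign.

Lemma juxt_left m n m' n' (f : matching m n) (g : matching m' n') u :
  juxt_matching f g (left_point m' n' u) = left_point m' n' (f u).
Proof. by rewrite /= ffunE split_left. Qed.

Lemma juxt_right m n m' n' (f : matching m n) (g : matching m' n') u :
  juxt_matching f g (right_point m n u) = right_point m n (g u).
Proof. by rewrite /= ffunE split_right. Qed.

Lemma left_point_inj m n m' n' : injective (@left_point m n m' n').
Proof. by move=> u v /(congr1 (@split_point _ _ _ _)); rewrite !split_left => -[]. Qed.

Lemma rsign_juxt m n m' n' (f f' : matching m n) (g : matching m' n') :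
  rsign (juxt_matching f g) (juxt_matching f' g) = rsign f f'.
Proof.
apply: (odd_perm_extend (@left_point_inj m n m' n')) => [u|x].
  have cu w : cls (left_point m' n' w) = cls w by case: w.
  by rewrite !rel_permE /rel_fun !juxt_left cu; case: ifP.
case: (pointP x) => u; first by rewrite codom_f.
by move=> _; rewrite rel_permE /rel_fun !juxt_right matchingK; case: ifP.
Qed.

Lemma flip_pointK m n : cancel (@flip_point m n) (@flip_point n m).
Proof. by case. Qed.

Lemma cls_flip m n (u : point m n) : cls (flip_point u) = ~~ cls u.
Proof. by case: u => i //=; rewrite negbK. Qed.

Lemma flip_matchingE m n (f : matching m n) u :
  flip_matching f (flip_point u) = flip_point (f u).
Proof. by rewrite /= ffunE flip_pointK. Qed.

Lemma rsign_flip m n (f f' : matching m n) :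
  rsign (flip_matching f) (flip_matching f') = rsign f f'.
Proof.
rewrite -rsign_true; apply: (odd_perm_extend (can_inj (@flip_pointK m n))) => [u|x].
  by rewrite !rel_permE /rel_fun !flip_matchingE cls_flip; case: cls.
by case/negP; apply/codomP; exists (flip_point x); rewrite flip_pointK.
Qed.

Section LoopSign.
Variables m n k : nat.
Local Notation X := (spoint m n k).
Local Notation low := (@low_point m n k).
Local Notation high := (@high_point m n k).
Local Notation outer := (@outer_point m n k).

Section Closure.
Variables (g : matching n k) (f : matching m n).
Local Notation e := (stack_rel g f).
Local Notation h := (stack g f).

(** A permutation whose cycles are the curves: it follows them as [step] does and, at the end of an
    open curve, jumps back to its beginning along the stacked matching. *)
Definition close_fun (o : bool) (z : X) : X :=
  match z with
  | inl u => if cls u == o then low (f u) else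
      match u with inl i => outer (h (inl i)) | inr j => high (g (inl j)) end
  | inr l => if cls (inr l : point n k) == o then high (g (inr l)) else outer (h (inr l))
  end.

Lemma close_low o u : cls u = o -> close_fun o (low u) = low (f u).
Proof. by move=> c; rewrite /= c eqxx. Qed.

Lemma close_high o v : cls v = o -> close_fun o (high v) = high (g v).
Proof.
by case: v => [j|l] c; rewrite /= in c *; rewrite c ?eqxx //; case: o {c}.
Qed.

Lemma close_outer o y : cls y = ~~ o -> close_fun o (outer y) = outer (h y).
Proof. by case: y => [i|l] c; rewrite /= in c *; rewrite c; case: o {c}. Qed.

Lemma close_funK o : cancel (close_fun o) (close_fun (~~ o)).
Proof.
move=> z; case: (stepP g f o z) => [u c|v c|y c].
- by rewrite close_low // close_low ?matchingK // cls_matching c.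
- by rewrite close_high // close_high ?matchingK // cls_matching c.
- by rewrite close_outer // close_outer ?matchingK // cls_matching c.
Qed.

Definition close_perm : {perm X} := perm (can_inj (close_funK false)).

Lemma close_permE z : close_perm z = close_fun false z. Proof. exact: permE. Qed.

Lemma connect_close z : connect e z (close_perm z).
Proof.
rewrite close_permE; case: (stepP g f false z) => [u c|v c|y c].
- by rewrite close_low // connect1 // stack_rel_low.
- by rewrite close_high // connect1 // stack_rel_high.
- by rewrite close_outer //= ffunE mate_connect.
Qed.

Lemma porbit_connect a b : (b \in porbit close_perm a) = connect e a b.
Proof.
apply/porbitP/idP => [[i ->]|].
  elim: i => [|i IH]; first by rewrite expg0 perm1 connect0.
  by rewrite expgSr permM; apply: connect_trans IH (connect_close _).
suff cl : closed e (porbit close_perm a).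
  by move/(closed_connect cl); rewrite porbit_id => /esym/porbitP.
have P y : (close_perm y \in porbit close_perm a) = (y \in porbit close_perm a).
  by rewrite ![_ \in porbit _ a]porbit_sym -!eq_porbit_mem; congr (_ == _); rewrite -(porbit_perm _ 1 y) expg1.
move=> c d cd; have [->|->] : c = close_perm d \/ d = close_perm c; last 2 first.
- exact: P.
- exact: esym (P _).
case/stack_relP: cd => -[u [-> ->]]; rewrite !close_permE.
  have [cu|cu] := boolP (cls u); last by right; rewrite close_low //; apply: negbTE.
  by left; rewrite close_low ?matchingK // cls_matching cu.
have [cu|cu] := boolP (cls u); last by right; rewrite close_high //; apply: negbTE.
by left; rewrite close_high ?matchingK // cls_matching cu.
Qed.

(** An open curve has exactly one end y with [cls y] false, so these ends count the open curves. *)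
Lemma card_porbits_close :
  #|porbits close_perm| = (loops g f + #|[pred y : point m k | ~~ cls y]|)%N.
Proof.
have sym := stack_connect_sym g f.
have -> : porbits close_perm = [set porbit close_perm r | r in roots e].
  apply/setP => S; apply/imsetP/imsetP => [[a _ ->]|[a _ ->]]; last by exists a.
  exists (fingraph.root e a); first exact: roots_root.
  by apply/eqP; rewrite eq_porbit_mem porbit_connect sym connect_root.
rewrite card_in_imset; last first.
  move=> a b /eqP ra /eqP rb /eqP; rewrite eq_porbit_mem porbit_connect.
  by move/(fingraph.rootP sym); rewrite ra rb => ->.
pose lp := [pred a | [forall w, ~~ connect e a (outer w)]].
rewrite -(cardID lp); congr addn.
rewrite -(card_in_image (f := fun y => fingraph.root e (outer y))).
  apply: eq_card => a; apply/andP/fintype.imageP => [[]|[y _ ->]].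
    rewrite /= negb_forall => /existsP[w /negbNE c] /eqP ra.
    have [cw|cw] := boolP (cls w); last first.
      by exists w => //; rewrite -(fingraph.rootP sym c) ra.
    exists (h w); first by rewrite inE cls_matching cw.
    rewrite -{1}ra; apply/(fingraph.rootP sym)/(connect_trans c).
    by rewrite /= ffunE mate_connect.
  split; last exact: roots_root.
  rewrite inE negb_forall; apply/existsP; exists y; rewrite negbK sym; exact: connect_root.
move=> y y'; rewrite !inE => cy cy' /(fingraph.rootP sym) c.
by apply: (@end_unique _ _ _ g f true); rewrite // ?(negbTE cy) ?(negbTE cy').
Qed.

End Closure.

(** The parity of a permutation is that of its number of points plus its number of cycles, so loops
    are counted modulo 2 by signs. Changing f and g multiplies [close_perm] by the relative
    permutations of f, of g and of the stacked matchings. *)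
Lemma loops_rsign (g g' : matching n k) (f f' : matching m n) :
  odd (loops g f) (+) odd (loops g' f') =
  rsign f f' (+) rsign g g' (+) rsign (stack g f) (stack g' f').
Proof.
have low_inj : injective low by move=> u v [].
have high_inj : injective high by move=> [i|i] [i'|i'] //= [->].
have [tf [tfE tf0 tfo]] := perm_extend low_inj (rel_perm false f f').
have [tg [tgE tg0 tgo]] := perm_extend high_inj (rel_perm false g g').
have [th [thE th0 tho]] := perm_extend (@outer_inj m n k) (rel_perm true (stack g f) (stack g' f')).
have E : close_perm g f = (th * (tg * (tf * close_perm g' f')))%g.
  apply/permP => z; rewrite !permM !close_permE; case: (stepP g f false z) => [u c|v c|y c].
  - have -> : th (low u) = low u.
      case: u c => [i|j] c; last by rewrite th0 //; apply/codomP => -[[]].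
      by rewrite -[low _]/(outer (inl i)) thE rel_permE /rel_fun /= in c *; rewrite c.
    have -> : tg (low u) = low u.
      case: u c => [i|j] c; first by rewrite tg0 //; apply/codomP => -[[]].
      rewrite -[low _]/(high (inl j)) tgE rel_permE /rel_fun /= in c *.
      by move/negbFE: c => ->.
    by rewrite tfE rel_permE /rel_fun c eqxx !close_low ?matchingK ?cls_matching ?c.
  - have -> : th (high v) = high v.
      case: v c => [j|l] c; first by rewrite th0 //; apply/codomP => -[[]].
      rewrite -[high _]/(outer (inr l)) thE rel_permE /rel_fun /= in c *.
      by rewrite c.
    rewrite tgE rel_permE /rel_fun c eqxx.
    have : cls (g' (g v)) = false by rewrite !cls_matching c.
    move: (g' (g v)) (matchingK g' (g v)) => w gw cw.
    have -> : tf (high w) = high w.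
      case: w cw {gw} => [j|l] cw; last by rewrite tf0 //; apply/codomP => -[[]].
      by rewrite -[high _]/(low (inr j)) tfE rel_permE /rel_fun /= in cw *; rewrite cw.
    by rewrite !close_high // gw.
  - rewrite thE rel_permE /rel_fun c eqxx.
    have : cls (stack g' f' (stack g f y)) = true by rewrite !cls_matching c.
    move: (stack g' f' (stack g f y)) (matchingK (stack g' f') (stack g f y)) => w hw cw.
    have -> : tg (outer w) = outer w.
      case: w cw {hw} => [i|l] cw; first by rewrite tg0 //; apply/codomP => -[[]].
      by rewrite -[outer _]/(high (inr l)) tgE rel_permE /rel_fun /= in cw *; rewrite cw.
    have -> : tf (outer w) = outer w.
      case: w cw {hw} => [i|l] cw; last by rewrite tf0 //; apply/codomP => -[[]].
      by rewrite -[outer _]/(low (inl i)) tfE rel_permE /rel_fun /= in cw *; rewrite cw.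
    by rewrite !close_outer // hw.
have := congr1 (@odd_perm _) E; rewrite !odd_permM tfo tgo tho rsign_true.
rewrite -!/(rsign _ _) /odd_perm /= !card_porbits_close !oddD.
move: (rsign f f') (rsign g g') (rsign (stack g f) _) (odd (loops g f)) (odd (loops g' f')).
by move: (odd #|_|) (odd #|_|); clear; do 7 case.
Qed.

End LoopSign.

(** * The functor to matrices *)

(** A reference matching from which signs are measured; it is the identity when m = n, so that
    identities get a plus sign. *)
Definition base m n : option (matching m n) :=
  match m =P n with
  | ReflectT e => Some (ecast n' (matching m n') e (id_matching m))
  | _ => [pick b : matching m n]
  end.

Lemma base_some m n (f : matching m n) : exists b, base m n = Some b.
Proof.
rewrite /base; case: eqP => e; first by eexists.
by case: pickP => [b _|/(_ f)//]; exists b.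
Qed.

Definition sgb m n (f : matching m n) : bool :=
  if base m n is Some b then rsign b f else false.

Lemma sgb_id n : sgb (id_matching n) = false.
Proof.
rewrite /sgb /base; case: eqP => // e; rewrite (eq_axiomK e) /=; exact: rsignxx.
Qed.

Lemma sgb_rsign m n (f f' : matching m n) : sgb f' = sgb f (+) rsign f f'.
Proof. by rewrite /sgb; have [b ->] := base_some f; apply: rsign_trans. Qed.

(** The failure of the signs to be multiplicative; by [loops_rsign] any pair of diagrams gives the
    same value. *)
Definition comp_sgb m n k : bool :=
  if [pick gf : matching n k * matching m n] is Some gf then
    odd (loops gf.1 gf.2) (+) sgb (stack gf.1 gf.2) (+) sgb gf.1 (+) sgb gf.2 else false.

Lemma sgb_comp m n k (g : matching n k) (f : matching m n) :
  odd (loops g f) (+) sgb (stack g f) = comp_sgb m n k (+) sgb g (+) sgb f.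
Proof.
rewrite /comp_sgb; case: pickP => [[g' f'] _ /=|/(_ (g, f))//].
have := loops_rsign g g' f f'; rewrite (sgb_rsign g g') (sgb_rsign f f').
rewrite (sgb_rsign (stack g f) (stack g' f')).
by case: odd; case: odd; case: rsign; case: rsign; case: rsign; case: sgb; case: sgb; case: sgb.
Qed.

Definition eps m n (f : matching m n) : rat := (-1) ^+ sgb f.

Definition comp_sign m n k : rat := (-1) ^+ comp_sgb m n k.

Lemma eps_comp m n k (g : matching n k) (f : matching m n) :
  (-1) ^+ loops g f * eps (stack g f) = comp_sign m n k * (eps g * eps f).
Proof. by rewrite -signr_odd /eps /comp_sign -!signr_addb sgb_comp addbA. Qed.

Lemma sign_sqr (b : bool) : (-1) ^+ b * (-1) ^+ b = 1 :> rat.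
Proof. by rewrite -expr2 sqrr_sign. Qed.

(** Strands are counted from the left, whereas words list them from the right. *)
Definition wlab m (x : seq bool) (i : 'I_m) : bool := nth false x (m - i.+1).

Definition F0 m n (f : matching m n) : kernel := fun x y =>
  [&& size x == m, size y == n & invariant_lab f (lab (wlab (m := m) x) (wlab (m := n) y))]%:R.

Lemma homk_F0 m n (f : matching m n) : homk m n (F0 f).
Proof.
move=> x y; rewrite /F0; have [->|_] := eqVneq (size x) m; last by rewrite eqxx.
by have [->|_] := eqVneq (size y) n; last by rewrite eqxx.
Qed.

Definition word_of n (y : {ffun 'I_n -> bool}) : seq bool :=
  [seq y (rev_ord i) | i <- enum 'I_n].

Lemma size_word_of n (y : {ffun 'I_n -> bool}) : size (word_of y) = n.
Proof. by rewrite size_map size_enum_ord. Qed.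

Lemma wlab_word n (y : {ffun 'I_n -> bool}) : wlab (m := n) (word_of y) =1 y.
Proof.
move=> i; rewrite /wlab; have lt : (n - i.+1 < n)%N by have := ltn_ord i; lia.
rewrite (nth_map i) ?size_enum_ord //; congr (y _); apply: val_inj => /=.
by rewrite nth_enum_ord //; have := ltn_ord i; lia.
Qed.

Lemma word_of_wlab n s : size s = n -> word_of (finfun (wlab (m := n) s)) = s.
Proof.
move=> sn; apply: (@eq_from_nth _ false); rewrite size_word_of // => i lt.
have := wlab_word (finfun (wlab (m := n) s)) (rev_ord (Ordinal lt)).
by rewrite ffunE /wlab /= (_ : n - (n - i.+1).+1 = i)%N //; lia.
Qed.

Lemma sum_words n (V : nmodType) (H : seq bool -> V) :
  \sum_(s <- words n) H s = \sum_(y : {ffun 'I_n -> bool}) H (word_of y).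
Proof.
rewrite -[RHS](big_map (@word_of n) xpredT); apply: perm_big; apply: uniq_perm.
- exact: uniq_words.
- rewrite map_inj_uniq ?index_enum_uniq // => y y' E; apply/ffunP => i.
  by rewrite -!wlab_word E.
- move=> s; rewrite mem_words; apply/eqP/mapP => [sn|[y _ ->]]; last exact: size_word_of.
  by exists (finfun (wlab (m := n) s)); rewrite ?mem_index_enum ?word_of_wlab.
Qed.

Lemma eq_invariant_lab m n (f : matching m n) l l' : l =1 l' ->
  invariant_lab f l = invariant_lab f l'.
Proof. by move=> E; apply: eq_forallb => u; rewrite !E. Qed.

Lemma F0_comp m n k (g : matching n k) (f : matching m n) :
  kmul n (F0 f) (F0 g) = kscale (2 ^+ loops g f) (F0 (stack g f)).
Proof.
apply: homk_eq; [exact: homk_mul (@homk_F0 _ _ f) (@homk_F0 _ _ g)|exact/homk_scale/homk_F0|].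
move=> x z sx sz; rewrite /kmul sum_words /kscale /F0 sx sz !eqxx /=.
transitivity (\sum_(y : {ffun 'I_n -> bool}) (invariant_lab f (lab (wlab (m := m) x) y) &&
    invariant_lab g (lab y (wlab (m := k) z)))%:R : rat).
  apply: eq_bigr => y _; rewrite size_word_of eqxx /= -natrM mulnb.
  by congr (nat_of_bool (_ && _))%:R; apply: eq_invariant_lab => -[i|j] //=; rewrite wlab_word.
rewrite -natr_sum (_ : \sum_i _ = #|[set y : {ffun 'I_n -> bool} |
    invariant_lab f (lab (wlab (m := m) x) y) && invariant_lab g (lab y (wlab (m := k) z))]|)%N.
  by rewrite card_labels; case: ifP => _; rewrite ?mulr0 ?mulr1 // natrX.
by rewrite -sum1dep_card [RHS]big_mkcond; apply: eq_bigr => y _; case: andb.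
Qed.

Lemma F0_id n : F0 (id_matching n) = kid n.
Proof.
apply: (homk_eq (@homk_F0 _ _ _) (@homk_id n)) => x y sx sy.
rewrite /F0 /kid sx sy !eqxx /=; congr (nat_of_bool _)%:R.
apply/invariant_labP/eqP => [h|<- [i|i]]; last 2 first.
- by rewrite ffunE.
- by rewrite ffunE.
apply: (@eq_from_nth _ false) => [|i]; rewrite ?sy // sx => lt.
have lt' : (n - i.+1 < n)%N by lia.
have := h (inl (Ordinal lt')); rewrite ffunE /= /wlab /= (_ : n - (n - i.+1).+1 = i)%N //; lia.
Qed.

Lemma F0_flip m n (f : matching m n) : F0 (flip_matching f) = ktr (F0 f).
Proof.
apply: kernelP => x y; rewrite /ktr /F0 andbCA; congr (nat_of_bool _)%:R; do 2 congr (_ && _).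
have E u : lab (wlab (m := n) x) (wlab (m := m) y) (flip_point u) =
    lab (wlab (m := m) y) (wlab (m := n) x) u by case: u.
apply/invariant_labP/invariant_labP => h u.
  by have := h (flip_point u); rewrite flip_matchingE !E.
by rewrite -(flip_pointK u) flip_matchingE !E.
Qed.

Lemma F0_juxt m n m' n' (f : matching m n) (g : matching m' n') V Z V' Z' :
  size V = m' -> size V' = n' -> size Z = m -> size Z' = n ->
  F0 (juxt_matching f g) (V ++ Z) (V' ++ Z') = F0 f Z Z' * F0 g V V'.
Proof.
move=> sV sV' sZ sZ'; rewrite /F0 !size_cat sV sV' sZ sZ' (addnC m') (addnC n') !eqxx /=.
rewrite -natrM mulnb; congr (nat_of_bool _)%:R.
have L u : lab (wlab (m := m + m') (V ++ Z)) (wlab (m := n + n') (V' ++ Z')) (left_point m' n' u)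
    = lab (wlab (m := m) Z) (wlab (m := n) Z') u.
  case: u => i /=; rewrite /wlab nth_cat /= ?sV ?sV'; have := ltn_ord i => lt.
    by rewrite (_ : (_ < _)%N = false); [congr nth|]; lia.
  by rewrite (_ : (_ < _)%N = false); [congr nth|]; lia.
have R u : lab (wlab (m := m + m') (V ++ Z)) (wlab (m := n + n') (V' ++ Z')) (right_point m n u)
    = lab (wlab (m := m') V) (wlab (m := n') V') u.
  case: u => i /=; rewrite /wlab nth_cat /= ?sV ?sV'; have := ltn_ord i => lt.
    by rewrite (_ : (_ < _)%N = true); [congr nth|]; lia.
  by rewrite (_ : (_ < _)%N = true); [congr nth|]; lia.
apply/invariant_labP/andP => [h|[/invariant_labP hf /invariant_labP hg] u].
  split; apply/invariant_labP => u.
    by rewrite -!L -(juxt_left f g) h.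
  by rewrite -!R -(juxt_right f g) h.
by case: (pointP u) => v; rewrite ?juxt_left ?juxt_right ?L ?R.
Qed.

Lemma iter_kten_cat d K V Z V' Z' : size V = d -> size V' = d ->
  iter d kten K (V ++ Z) (V' ++ Z') = (V == V')%:R * K Z Z'.
Proof.
elim: d V V' => [|d IH] [|c V] [|c' V'] //=; first by rewrite mul1r.
move=> [sV] [sV']; rewrite IH // eqseq_cons mulrA -natrM mulnb //.
Qed.

Lemma homk_iter_ten d m n K : homk m n K -> homk (d + m) (d + n) (iter d kten K).
Proof. by move=> hK; elim: d => //= d IH; apply: homk_ten. Qed.

Lemma F0_juxt_id m n d (f : matching m n) :
  F0 (juxt_matching f (id_matching d)) = iter d kten (F0 f).
Proof.
have h := @homk_iter_ten d _ _ _ (@homk_F0 _ _ f); rewrite !(addnC d) in h.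
apply: (homk_eq (@homk_F0 _ _ _) h) => x y sx sy.
rewrite -(cat_take_drop d x) -(cat_take_drop d y).
have st k (s : seq bool) : size s = (k + d)%N -> size (take d s) = d /\ size (drop d s) = k.
  by move=> e; rewrite size_takel ?size_drop e; lia.
have [s1 s2] := st _ _ sx; have [s3 s4] := st _ _ sy.
by rewrite F0_juxt // iter_kten_cat // F0_id /kid s1 eqxx mulrC.
Qed.

(** Complements the letters of the strands with odd index. The ends of an arc on one edge have
    indices of different parity and so get opposite letters; those of a through strand have equal
    parity and keep equal letters. *)
Fixpoint flipw (x : seq bool) : seq bool :=
  if x is c :: x' then (c (+) odd (size x')) :: flipw x' else [::].

(** The parity of the number of letters [true] at odd indices. Exchanging the two letters of an arc
    on one edge changes it, which is the minus sign of the symplectic form. *)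
Fixpoint tau (x : seq bool) : bool :=
  if x is c :: x' then (c && odd (size x')) (+) tau x' else false.

(* The change of basis from labellings constant along arcs to the basis in
   which caps and cups are antisymmetric. *)
Definition twist (K : kernel) : kernel :=
  fun x y => (-1) ^+ (tau x (+) tau y) * K (flipw x) (flipw y).

Lemma size_flipw x : size (flipw x) = size x.
Proof. by elim: x => //= c x ->. Qed.

Lemma flipwK : involutive flipw.
Proof. by elim=> //= c x IH; rewrite size_flipw IH addbK. Qed.

Lemma sum_flipw n (V : nmodType) (H : seq bool -> V) :
  \sum_(x <- words n) H (flipw x) = \sum_(x <- words n) H x.
Proof.
rewrite -(big_map flipw xpredT); apply: perm_big; apply: uniq_perm.
- by rewrite map_inj_uniq ?uniq_words //; apply: inv_inj flipwK.
- exact: uniq_words.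
- move=> x; rewrite mem_words; apply/mapP/eqP => [[y] + ->|<-].
    by rewrite mem_words size_flipw => /eqP.
  by exists (flipw x); rewrite ?flipwK // mem_words size_flipw.
Qed.

Lemma twistM n K L : twist (kmul n K L) = kmul n (twist K) (twist L).
Proof.
apply: kernelP => x z; rewrite /twist /kmul -sum_flipw mulr_sumr.
apply: eq_bigr => y _; rewrite mulrACA -signr_addb.
by rewrite -addbA (addbA (tau y)) addbb.
Qed.

Lemma homk_twist m n K : homk m n K -> homk m n (twist K).
Proof.
by move=> hK x y; rewrite /twist mulf_eq0 => /norP[_ /hK]; rewrite !size_flipw.
Qed.

Lemma twist_tr K : twist (ktr K) = ktr (twist K).
Proof. by apply: kernelP => x y; rewrite /twist /ktr addbC. Qed.

Lemma twistZ c K : twist (kscale c K) = kscale c (twist K).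
Proof. by apply: kernelP => x y; rewrite /twist /kscale mulrCA. Qed.

Lemma twist_id n : twist (kid n) = kid n.
Proof.
apply: kernelP => x y; rewrite /twist /kid size_flipw (inj_eq (inv_inj flipwK)).
by have [<-|_] := eqVneq x y; rewrite ?andbF ?mulr0 // addbb mul1r.
Qed.

(** The added letter has index m in the input and n in the output; equal parities make the twist
    treat it alike on both sides. *)
Lemma twist_ten m n K : homk m n K -> odd m = odd n ->
  twist (kten K) = kten (twist K).
Proof.
move=> hK mn; apply: kernelP => -[|c x] [|d y]; rewrite /twist /= ?mulr0 //.
have [->|/hK[]] := eqVneq (K (flipw x) (flipw y)) 0; first by rewrite !mulr0.
rewrite !size_flipw => -> ->; rewrite mn; have [<-|ne] := eqVneq c d.
  rewrite eqxx !mul1r; congr ((-1) ^+ nat_of_bool _ * _).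
  by case: (tau x); case: (tau y); case: c; case: odd.
by rewrite (_ : (_ == _) = false) ?mul0r ?mulr0 //; move: ne; case: c; case: d; case: odd.
Qed.

Definition func m n (T : Hom m n) : kernel :=
  twist (fun x y => \sum_(f : matching m n) T f * eps f * F0 f x y).

Lemma func_diagram m n (f : matching m n) :
  func (diagram f) = kscale (eps f) (twist (F0 f)).
Proof.
rewrite /func -twistZ; congr twist; apply: kernelP => x y.
rewrite (bigD1 f) //= big1 ?addr0 ?ffunE ?eqxx ?mul1r // => h hf.
by rewrite ffunE (negPf hf) !mul0r.
Qed.

Lemma func_id n : func (idH n) = kid n.
Proof. by rewrite func_diagram /eps sgb_id F0_id twist_id kscale1. Qed.

Lemma homk_func m n (T : Hom m n) : homk m n (func T).
Proof.
apply: homk_twist => x y nz; suff [f nf] : exists f : matching m n, F0 f x y != 0 by exact: homk_F0 nf.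
apply: contrapT => h; case/eqP: nz; rewrite big1 // => f _.
by have [->|nf] := eqVneq (F0 f x y) 0; [rewrite mulr0|case: h; exists f].
Qed.

Lemma funcD m n (S T : Hom m n) : func (S + T) = kadd (func S) (func T).
Proof.
apply: kernelP => x y; rewrite /func /twist /kadd -mulrDr -big_split.
by congr (_ * _); apply: eq_bigr => f _; rewrite ffunE !mulrDl.
Qed.

Lemma funcZ m n c (T : Hom m n) : func (c *: T) = kscale c (func T).
Proof.
rewrite /func -twistZ; congr twist; apply: kernelP => x y; rewrite /kscale mulr_sumr.
by apply: eq_bigr => f _; rewrite ffunE -!mulrA.
Qed.

Lemma func0 m n : func (0 : Hom m n) = kop0.
Proof.
apply: kernelP => x y; rewrite /func /twist big1 ?mulr0 // => f _.
by rewrite ffunE !mul0r.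
Qed.

Lemma mul_sum2 (I J : finType) (c : rat) (a : I -> rat) (b : J -> rat) :
  \sum_j \sum_i c * (a i * b j) = c * ((\sum_i a i) * (\sum_j b j)).
Proof.
rewrite mulr_sumr mulr_sumr; apply: eq_bigr => j _.
by rewrite mulr_suml mulr_sumr.
Qed.

Lemma func_comp m n k (S : Hom n k) (T : Hom m n) :
  func (compH S T) = kscale (comp_sign m n k) (kmul n (func T) (func S)).
Proof.
rewrite /func -twistM -twistZ; congr twist; apply: kernelP => x z.
transitivity (\sum_(g : matching n k) \sum_(f : matching m n)
    S g * T f * (-2) ^+ loops g f * eps (stack g f) * F0 (stack g f) x z).
  under eq_bigr do rewrite ffunE.
  transitivity (\sum_(h : matching m k) \sum_(g : matching n k) \sum_(f : matching m n)
      (h == stack g f)%:R * (S g * T f * (-2) ^+ loops g f * eps h * F0 h x z)).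
    apply: eq_bigr => h _; rewrite !mulr_suml; apply: eq_bigr => g _.
    rewrite big_mkcond !mulr_suml; apply: eq_bigr => f _.
    by case: stackedP => [->|ne]; [rewrite eqxx mul1r|have [//|_] := eqVneq h (stack g f); rewrite !mul0r].
  rewrite exchange_big; apply: eq_bigr => g _; rewrite exchange_big; apply: eq_bigr => f _.
  rewrite (bigD1 (stack g f)) //= big1 ?eqxx ?mul1r ?addr0 // => h /negPf->.
  by rewrite mul0r.
rewrite /kscale /kmul mulr_sumr.
transitivity (\sum_(y <- words n) \sum_(g : matching n k) \sum_(f : matching m n)
   comp_sign m n k * (T f * eps f * F0 f x y * (S g * eps g * F0 g y z))); last first.
  by apply: eq_bigr => y _; apply: mul_sum2.
rewrite [RHS]exchange_big; apply: eq_bigr => g _; rewrite [RHS]exchange_big; apply: eq_bigr => f _ /=.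
have := congr1 (fun K => K x z) (F0_comp g f); rewrite /kscale => E.
transitivity (S g * T f * ((-1) ^+ loops g f * eps (stack g f)) * (2 ^+ loops g f * F0 (stack g f) x z)).
  have -> : (-2) ^+ loops g f = (-1) ^+ loops g f * 2 ^+ loops g f :> rat.
    by rewrite -exprMn mulN1r.
  move: (S g : rat) (T f : rat) ((-1) ^+ _ : rat) (2 ^+ _ : rat) (eps _) (F0 _ _ _) => a b c d u v.
  ring.
rewrite eps_comp -E /kmul mulr_sumr; apply: eq_bigr => y _.
move: (S g : rat) (T f : rat) (comp_sign _ _ _) (eps g) (eps f) (F0 f _ _) (F0 g _ _) => a b c d u v w.
ring.
Qed.

Definition bar_sgb m n : bool :=
  if [pick f : matching m n] is Some f then sgb (flip_matching f) (+) sgb f else false.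

Lemma sgb_flip m n (f : matching m n) : sgb (flip_matching f) = bar_sgb m n (+) sgb f.
Proof.
rewrite /bar_sgb; case: pickP => [f0 _|/(_ f)//].
rewrite (sgb_rsign (flip_matching f0) (flip_matching f)) rsign_flip (sgb_rsign f0 f).
by case: sgb; case: sgb; case: rsign.
Qed.

Lemma flip_matchingK m n : cancel (@flip_matching m n) (@flip_matching n m).
Proof.
move=> f; apply: val_inj; apply/ffunP => u.
by have := flip_matchingE (flip_matching f) (flip_point u); rewrite (flip_matchingE f) !flip_pointK.
Qed.

Lemma func_bar m n (T : Hom m n) :
  func (barH T) = kscale ((-1) ^+ bar_sgb m n) (ktr (func T)).
Proof.
rewrite /func -twist_tr -twistZ; congr twist; apply: kernelP => x y.
rewrite (reindex (@flip_matching m n)); last by exists (@flip_matching n m) => f _; apply: flip_matchingK.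
rewrite /kscale /ktr mulr_sumr.
apply: eq_bigr => f _; rewrite ffunE flip_matchingK F0_flip /ktr /eps sgb_flip signr_addb.
by rewrite mulrCA -!mulrA.
Qed.

Lemma func_juxt m n m' n' (g : matching m' n') : exists b : bool, forall T : Hom m n,
  func (tensH T (diagram g)) =
  kscale ((-1) ^+ b) (twist (fun x y => \sum_(f : matching m n) T f * eps f * F0 (juxt_matching f g) x y)).
Proof.
have [b hb] : exists b : bool, forall f : matching m n, sgb (juxt_matching f g) = b (+) sgb f.
  case: (pickP (@predT (matching m n))) => [f0 _|no]; last first.
    by exists true => f; have := no f.
  exists (sgb (juxt_matching f0 g) (+) sgb f0) => f.
  rewrite (sgb_rsign (juxt_matching f0 g) (juxt_matching f g)) rsign_juxt (sgb_rsign f0 f).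
  by case: sgb; case: sgb; case: rsign.
exists b => T; rewrite /func -twistZ; congr twist; apply: kernelP => x y.
transitivity (\sum_(h : matching (m + m') (n + n')) \sum_(f : matching m n)
   (h == juxt_matching f g)%:R * (T f * eps h * F0 h x y)).
  apply: eq_bigr => h _; rewrite ffunE !mulr_suml; apply: eq_bigr => f _.
  rewrite big_mkcond (bigD1 g) //= big1 ?addr0 => [|g' /negPf ne]; last first.
    by rewrite ffunE ne mulr0 if_same.
  by rewrite ffunE eqxx eq_sym; case: eqP => _; rewrite ?mulr1 ?mul1r ?mul0r // !mulrA.
rewrite exchange_big /kscale mulr_sumr; apply: eq_bigr => f _ /=.
rewrite (bigD1 (juxt_matching f g)) //= big1 ?eqxx ?addr0 => [|h /negPf->]; last by rewrite mul0r.
by rewrite mul1r /eps hb signr_addb mulrCA -!mulrA.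
Qed.

Lemma func_ten m n d : exists b : bool, forall T : Hom m n,
  func (tensH T (idH d)) = kscale ((-1) ^+ b) (iter d kten (func T)).
Proof.
have [b hb] := func_juxt m n (id_matching d); exists b => T; rewrite hb; congr kscale.
have [mn|mn] := boolP (odd m == odd n); last first.
  have no (f : matching m n) : False by have := matching_even f; rewrite oddD; move: mn; case: odd; case: odd.
  apply: kernelP => x y; rewrite /twist big1 ?mulr0 => [|f]; last by case: (no f).
  have -> : func T = kop0.
    by apply: kernelP => u v; rewrite /func /twist big1 ?mulr0 // => f; case: (no f).
  by elim: d {hb} x y => //= d IH [|c x] [|e y] //=; rewrite -IH mulr0.
set K : kernel := fun x y => \sum_f T f * eps f * F0 f x y.
have hK : homk m n K.
  move=> x y nz; suff [f nf] : exists f : matching m n, F0 f x y != 0 by exact: homk_F0 nf.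
  apply: contrapT => h; case/eqP: nz; rewrite /K big1 // => f _.
  by have [->|nf] := eqVneq (F0 f x y) 0; [rewrite mulr0|case: h; exists f].
have tw l : twist (iter l kten K) = iter l kten (twist K).
  elim: l => //= l IH; rewrite (twist_ten (@homk_iter_ten l _ _ _ hK)) ?IH // !oddD.
  by rewrite (eqP mn).
rewrite /func -/K -tw; congr twist; apply: kernelP => x y.
under eq_bigr do rewrite F0_juxt_id.
elim: d {hb tw} x y => [|d IH] x y //=.
case: x y => [|c x] [|e y] /=; try by rewrite big1 // => f _; rewrite mulr0.
by rewrite -IH mulr_sumr; apply: eq_bigr => f _; rewrite mulrCA.
Qed.

(** * Unitriangularity: coefficients from matrices *)

Section Saturation.
Variables m n : nat.
Implicit Types f h : matching m n.

Definition opener f (u : point m n) : bool := (pos u < pos (f u))%N.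

Lemma opener_matching f u : opener f (f u) = ~~ opener f u.
Proof. by rewrite /opener matchingK -leqNgt ltn_neqAle pos_neq. Qed.

(** A bracketing is determined by its opening brackets. If h closed u before f does, f would match
    that closing point with an opener strictly inside the arc of h at u, which h closes earlier
    still; hence an induction on the first closing position. *)
Lemma openers_inj f h : opener f =1 opener h -> f = h.
Proof.
move=> E; suff H N f' h' u : opener f' =1 opener h' -> opener f' u ->
    (minn (pos (f' u)) (pos (h' u)) < N)%N -> f' u = h' u.
  apply: val_inj; apply/ffunP => u; have [ou|cu] := boolP (opener f u); first exact: H E ou (ltnSn _).
  have := H _ f h (f u) E; rewrite opener_matching cu => /(_ _ isT (ltnSn _)).
  by rewrite matchingK => e; apply: (@matching_inj _ _ h); rewrite matchingK -e.
elim: N f' h' u => // N IH.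
suff W f' h' u : opener f' =1 opener h' -> opener f' u -> (minn (pos (f' u)) (pos (h' u)) < N.+1)%N ->
    ~ (pos (h' u) < pos (f' u))%N.
  move=> f' h' u E' ou lt; apply: pos_inj; have [l|l|//] := ltngtP (pos (f' u)) (pos (h' u)).
    by case: (W h' f' u) => //; rewrite -?E' // minnC.
  by case: (W f' h' u).
move=> E' ou lt hf; have ou' : opener h' u by rewrite -E'.
have oc : opener f' (f' (h' u)) by rewrite opener_matching E' opener_matching ou'.
have c1 := between_stable f' u (h' u).
have {c1} : between (pos u) (pos (f' u)) (f' (h' u)).
  by rewrite c1 /between; apply/orP; left; apply/andP.
rewrite /between => /orP[/andP[uc _]|]; last by rewrite /opener in ou; lia.
have cb : (pos (f' (h' u)) < pos (h' u))%N by move: oc; rewrite /opener matchingK.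
have c2 := between_stable h' u (f' (h' u)).
have {c2} : between (pos u) (pos (h' u)) (h' (f' (h' u))).
  by rewrite c2 /between uc cb.
rewrite /between => /orP[/andP[_ hb]|]; last by rewrite /opener in ou'; lia.
have lt' : (minn (pos (f' (f' (h' u)))) (pos (h' (f' (h' u)))) < N)%N.
  by move: lt; rewrite matchingK; move: hf hb; clear; lia.
have := IH f' h' _ E' oc lt'; rewrite matchingK => /(@matching_inj _ _ h') e.
by move: uc; rewrite -e ltnn.
Qed.

Definition weight f : nat := (\sum_(u | opener f u) pos u)%N.

Definition compatible h f := forall u, opener h (f u) = ~~ opener h u.

(** Compatibility says that each arc of f has exactly one opener of h among its ends. So [weight h]
    adds up one end of every arc of f, and [weight f] always the smaller one. *)
Lemma weight_lt h f : compatible h f -> f != h -> (weight f < weight h)%N.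
Proof.
move=> c ne; have Eh : weight h =
   (\sum_(u | opener f u && opener h u) pos u + \sum_(u | opener f u && ~~ opener h u) pos (f u))%N.
  rewrite /weight (bigID (opener f)) /=; congr addn; first by apply: eq_bigl => u; rewrite andbC.
  rewrite (reindex_inj (@matching_inj _ _ f)) /=; apply: eq_bigl => u.
  by rewrite c opener_matching negbK andbC.
have Ef : weight f =
   (\sum_(u | opener f u && opener h u) pos u + \sum_(u | opener f u && ~~ opener h u) pos u)%N.
  by rewrite /weight (bigID (opener h)).
rewrite Eh Ef ltn_add2l.
have [u /andP[ou nu]] : exists u, opener f u && ~~ opener h u.
  apply: contrapT => nex; case/eqP: ne; apply: openers_inj => u.
  have sub v : opener f v -> opener h v.
    by move=> ov; apply: contrapT => /negP nv; apply: nex; exists v; rewrite ov.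
  apply/idP/idP => [/sub//|hu]; apply: contrapT => /negP nf.
  have : opener f (f u) by rewrite opener_matching.
  by move/sub; rewrite c hu.
rewrite (bigD1 u) ?ou ?nu //= [X in (_ < X)%N](bigD1 u) ?ou ?nu //=.
by rewrite -addSn leq_add // leq_sum // => v /andP[/andP[ov _] _]; apply: ltnW.
Qed.

(** Triangular elimination by induction on [weight h], for any additive subgroup A: zero alone will
    give injectivity of [func], the p-integral numbers the claim on denominators. *)
Lemma saturation (A : rat -> Prop) (T : Hom m n) :
  A 0 -> (forall x y, A x -> A y -> A (x + y)) -> (forall x, A x -> A (- x)) ->
  (forall x y, A (func T x y)) -> forall h, A (T h).
Proof.
move=> A0 AD AN AT h.
have As (b : bool) x : A ((-1) ^+ b * x) -> A x.
  by case: b; rewrite ?mul1r // expr1 mulN1r => /AN; rewrite opprK.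
have As' (b : bool) x : A x -> A ((-1) ^+ b * x).
  by case: b; rewrite ?mul1r // expr1 mulN1r => /AN.
have {}AT x y : A (\sum_(f : matching m n) T f * eps f * F0 f x y).
  by apply: (As (tau (flipw x) (+) tau (flipw y))); have := AT (flipw x) (flipw y); rewrite /func /twist !flipwK.
move: {2}(weight h).+1 (ltnSn (weight h)) => N; elim: N h => // N IH h hN.
(* As [cls] differs at the ends of any arc, l is constant along an arc of f iff exactly one end is
   an opener of h. So only f = h and matchings of smaller weight contribute to this entry. *)
pose l (u : point m n) := cls u (+) opener h u.
pose x := word_of (finfun (fun i => l (inl i))).
pose y := word_of (finfun (fun j => l (inr j))).
have lE : lab (wlab (m := m) x) (wlab (m := n) y) =1 l.
  by case=> i; rewrite /= wlab_word ffunE.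
have hh : F0 h x y = 1.
  rewrite /F0 !size_word_of !eqxx (eq_invariant_lab _ lE) /=.
  have -> // : invariant_lab h l.
  by apply/invariant_labP => u; rewrite /l cls_matching opener_matching; case: cls; case: opener.
have := AT x y; rewrite (bigD1 h) //= hh mulr1 => S.
have R : A (\sum_(f | f != h) T f * eps f * F0 f x y).
  elim/big_ind: _ => // f fh; have [->|nz] := eqVneq (F0 f x y) 0; first by rewrite mulr0.
  have F1 : F0 f x y = 1 by move: nz; rewrite /F0; set b := [&& _, _ & _]; case: b; rewrite ?eqxx.
  rewrite F1 mulr1 mulrC /eps; apply: As'; apply: IH; apply: (@leq_trans (weight h)); last exact: hN.
  apply: weight_lt fh => u; move: nz; rewrite /F0 !size_word_of !eqxx (eq_invariant_lab _ lE) /=.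
  case: invariant_labP => [inv _|_]; last by rewrite eqxx.
  have := inv u; rewrite /l cls_matching; by case: cls; case: (opener h u); case: opener.
apply: (As (sgb h)); rewrite mulrC -/(eps h).
by have := AD _ _ S (AN _ R); rewrite addrK.
Qed.

Lemma func_inj : injective (@func m n).
Proof.
move=> S T E; apply/eqP; rewrite -subr_eq0; apply/eqP/ffunP => h; rewrite [RHS]ffunE.
apply: (@saturation (fun r => r = 0)) => // [x y -> ->|x ->|x y]; rewrite ?addr0 ?oppr0 //.
have -> : S - T = S + (-1) *: T by rewrite scaleN1r.
by rewrite funcD funcZ E /kadd /kscale mulN1r subrr.
Qed.

End Saturation.

Lemma F0_eq m n (f f' : matching m n) c : F0 f = kscale c (F0 f') -> f = f' /\ c = 1.
Proof.
move=> E; have E' : diagram f = (eps f * c * eps f') *: diagram f'.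
  apply: func_inj; rewrite funcZ !func_diagram E !kscaleA twistZ kscaleA.
  by congr (kscale _ _); rewrite /eps -!mulrA sign_sqr mulr1.
have := congr1 (fun T : Hom m n => T f) E'; rewrite !ffunE eqxx.
have [ff' h|_] := eqVneq f f'; last by rewrite scaler0.
split=> //; rewrite -ff' in h; have {}h : 1 = eps f * c * eps f :> rat by rewrite -[RHS]mulr1; exact: h.
by rewrite h mulrAC /eps sign_sqr mul1r.
Qed.

Lemma expr2_eq (a b : nat) : 2 ^+ a = 2 ^+ b :> rat -> a = b.
Proof. by rewrite -!natrX => /eqP; rewrite eqr_nat eqn_exp2l // => /eqP. Qed.

Lemma stack_idr m k (g : matching m k) : stack g (id_matching m) = g /\ loops g (id_matching m) = 0%N.
Proof.
have := F0_comp g (id_matching m); rewrite F0_id (kmul1l (@homk_F0 _ _ g)) => /F0_eq[<- h].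
by split=> //; apply: expr2_eq; rewrite h.
Qed.

Lemma stack_idl m k (g : matching m k) : stack (id_matching k) g = g /\ loops (id_matching k) g = 0%N.
Proof.
have := F0_comp (id_matching k) g; rewrite F0_id (kmul1r (@homk_F0 _ _ g)) => /F0_eq[<- h].
by split=> //; apply: expr2_eq; rewrite h.
Qed.

(** [comp_sgb] does not depend on the diagrams, so it may be computed with an identity at the
    bottom. *)
Lemma comp_sgbl m k : comp_sgb m m k = false.
Proof.
rewrite {1}/comp_sgb; case: pickP => // -[g f] _ /=.
have := sgb_comp g f; have := sgb_comp g (id_matching m).
have [-> ->] := stack_idr g; rewrite sgb_id addbF /=.
by case: comp_sgb => //; [case: sgb|move=> _ ->; case: sgb; case: sgb].
Qed.

Lemma comp_sgbr m k : comp_sgb m k k = false.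
Proof.
rewrite {1}/comp_sgb; case: pickP => // -[g f] _ /=.
have := sgb_comp g f; have := sgb_comp (id_matching k) f.
have [-> ->] := stack_idl f; rewrite sgb_id /=.
by case: comp_sgb => //=; [case: sgb|move=> _ ->; case: sgb; case: sgb].
Qed.

Lemma func_compl m k (S : Hom m k) (T : Hom m m) : func (compH S T) = kmul m (func T) (func S).
Proof. by rewrite func_comp /comp_sign comp_sgbl kscale1. Qed.

Lemma func_compr m k (S : Hom k k) (T : Hom m k) : func (compH S T) = kmul k (func T) (func S).
Proof. by rewrite func_comp /comp_sign comp_sgbr kscale1. Qed.

(** * Nested caps and the sign of the flip *)

Lemma F0_cap r V : size V = r.*2 -> F0 (cap_matching r) V [::] = (V == rev V)%:R.
Proof.
move=> sV; rewrite /F0 sV !eqxx /=; congr (nat_of_bool _)%:R.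
apply/invariant_labP/eqP => [h|h [i|[]//]].
  apply: (@eq_from_nth _ false) => [|i]; rewrite ?size_rev // sV => lt.
  have lt' : (r.*2 - i.+1 < r.*2)%N by lia.
  have e1 : (r.*2 - (r.*2 - i.+1).+1 = i)%N by lia.
  by have := h (inl (Ordinal lt')); rewrite ffunE /= /wlab /= e1 nth_rev ?sV // => ->.
rewrite ffunE /= /wlab /= [in RHS]h nth_rev ?sV; last by have := ltn_ord i; lia.
by congr (nth _ V _); have := ltn_ord i; lia.
Qed.

Fixpoint flipv k (x : seq bool) : seq bool :=
  if x is c :: x' then (c (+) odd (size x' + k)) :: flipv k x' else [::].

Lemma flipw_cat V Z : flipw (V ++ Z) = flipv (size Z) V ++ flipw Z.
Proof. by elim: V => //= c V ->; rewrite size_cat. Qed.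

Lemma flipv_rcons k V d : flipv k (rcons V d) = rcons (flipv k.+1 V) (d (+) odd k).
Proof. by elim: V => //= c V ->; rewrite size_rcons addSnnS. Qed.

Lemma size_flipv k V : size (flipv k V) = size V.
Proof. by elim: V => //= c V ->. Qed.

(** Induction on the outermost arc: its left end counts as one more through strand, into which its
    right end, the head of the word, is bent last. The sign this costs depends only on the parity of
    k. *)
Lemma nested_caps r k : exists b : bool,
  twist (F0 (juxt_matching (id_matching k) (cap_matching r))) =
  kscale ((-1) ^+ b) (iter r kbend (kid (r + k))).
Proof.
have val k' r' V Z z : size V = r'.*2 -> size Z = k' -> size z = k' ->
    twist (F0 (juxt_matching (id_matching k') (cap_matching r'))) (V ++ Z) z =
    (-1) ^+ (tau (V ++ Z) (+) tau z) * ((Z == z)%:R * (flipv k' V == rev (flipv k' V))%:R).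
  move=> sV sZ sz; rewrite /twist flipw_cat sZ; congr (_ * _).
  rewrite -[flipw z]cat0s F0_juxt ?size_flipv ?size_flipw // F0_cap ?size_flipv //.
  by rewrite F0_id /kid size_flipw sZ eqxx (inj_eq (inv_inj flipwK)).
have hb j l : homk (j + (j + l)) l (iter j kbend (kid (j + l))).
  by have [] := eqv_iter_bend (eqv_id (j + l)).
suff [b hbb] : exists b : bool, forall V Z z, size V = r.*2 -> size Z = k -> size z = k ->
    twist (F0 (juxt_matching (id_matching k) (cap_matching r))) (V ++ Z) z =
    (-1) ^+ b * iter r kbend (kid (r + k)) (V ++ Z) z.
  exists b; have h1 := homk_twist (@homk_F0 _ _ (juxt_matching (id_matching k) (cap_matching r))).
  have h2 : homk (k + r.*2) (k + 0) (iter r kbend (kid (r + k))).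
    by have := hb r k; rewrite addnA addnn addnC addn0.
  apply: (homk_eq h1 (homk_scale h2)) => x z sx sz; rewrite addn0 in sz.
  rewrite -(cat_take_drop r.*2 x) /kscale hbb //; first by rewrite size_takel ?sx; lia.
  by rewrite size_drop sx; lia.
elim: r k => [|r IH] k.
  exists false => V Z z; case: V => //= _ sZ sz; rewrite -[Z]cat0s val //= /kid sZ eqxx mulr1 mul1r /=.
  by case: (eqVneq Z z) => [->|_]; rewrite ?mulr0 // addbb mul1r.
have [b hbb] := IH k.+1; exists (b (+) ~~ odd k) => V Z z sV sZ sz.
case: V sV => // c V; case/lastP: V => // V d sV'.
have sV : size V = r.*2 by move: sV'; rewrite /= size_rcons doubleS => -[].
have E : rcons V d ++ Z = V ++ d :: Z by rewrite -cats1 -catA.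
have oV : odd (size (V ++ d :: Z)) = ~~ odd k by rewrite size_cat /= sV sZ oddD odd_double.
rewrite val //=.
have := hbb V (d :: Z) (~~ c :: z) sV; rewrite /= sZ sz => /(_ erefl erefl).
rewrite val ?sV /= ?sZ ?sz // addnS -addSn => H.
have {H} H : iter r kbend (kid (r.+1 + k)) (V ++ d :: Z) (~~ c :: z) = (-1) ^+ b *
    ((-1) ^+ (tau (V ++ d :: Z) (+) ((~~ c && odd k) (+) tau z)) *
     ((d :: Z == ~~ c :: z)%:R * (flipv k.+1 V == rev (flipv k.+1 V))%:R)).
  by rewrite H mulrA sign_sqr mul1r.
rewrite E H flipv_rcons rev_cons rev_rcons /= !eqseq_cons eqseq_rcons oV size_rcons sV.
rewrite addSn oddS oddD odd_double /=.
case: (flipv k.+1 V == _); last by rewrite !andbF /= !mulr0.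
case: (Z == z); last by rewrite !andbF /= !mul0r !mulr0.
rewrite !andbT !mul1r !mulr1.
move: (tau (V ++ d :: Z)) (tau z) => t1 t2.
by case: c {sV' E H} => /=; case: d {oV}; case: (odd k); case: b {hbb}; case: t1; case: t2;
  rewrite /= ?(expr0, expr1, mulr0, mulr1, mul1r, mulN1r, mulrN1, opprK, oppr0).
Qed.

Lemma kptr_id n : kptr (kid n.+1) = kscale 2 (kid n).
Proof.
apply: kernelP => x y; rewrite /kptr /kscale /kid /= !eqSS !eqseq_cons !eqxx /=.
by case: andb; rewrite ?mulr0 ?addr0 //; ring.
Qed.

Lemma iter_ptr_id r k : iter r kptr (kid (r + k)) = kscale (2 ^+ r) (kid k).
Proof.
elim: r k => [|r IH] k; first by rewrite kscale1.
have Z c M j : iter j kptr (kscale c M) = kscale c (iter j kptr M).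
  by elim: j => //= j ->; rewrite kptrZ.
by rewrite iterSr addSn kptr_id Z IH kscaleA exprS.
Qed.

Lemma ktr_id n : ktr (kid n) = kid n.
Proof.
by apply: kernelP => x y; rewrite /ktr /kid; have [->|_] := eqVneq x y; rewrite ?andbF.
Qed.

Lemma twist_inj : injective twist.
Proof.
move=> K L E; apply: kernelP => x y; have := congr1 (fun M => M (flipw x) (flipw y)) E.
by rewrite /twist !flipwK => /mulfI -> //; rewrite signr_eq0.
Qed.

(* Let d be id_i with r nested caps, and h the diagram obtained by stacking d
   on its flip: then h o h is a power of -2 times h, which determines the sign. *)
Lemma bar_comp_sign i r :
  comp_sgb (i + r.*2) (i + 0) (i + r.*2) (+) bar_sgb (i + r.*2) (i + 0) = odd r.
Proof.
set d := juxt_matching (id_matching i) (cap_matching r).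
have DD : kmul (i + r.*2) (ktr (F0 d)) (F0 d) = kscale (2 ^+ r) (kid (i + 0)).
  have -> : kid (i + 0) = kid i by rewrite addn0.
  apply: twist_inj; rewrite twistM twist_tr twistZ twist_id.
  have [b ->] := nested_caps r i.
  rewrite -[ktr _]/(kscale _ (ktr _)) kmulZl kmulZr kscaleA sign_sqr kscale1.
  have -> : (i + r.*2 = r + (r + i))%N by lia.
  by rewrite iter_bend_trM ktr_id (kmul1r (@homk_id _)) iter_ptr_id.
set h := stack (flip_matching d) d; set l := loops (flip_matching d) d.
have two j : 2 ^+ j != 0 :> rat by rewrite expf_neq0.
have hE : F0 h = kscale (2 ^+ l)^-1 (kmul (i + 0) (F0 d) (ktr (F0 d))).
  by rewrite -F0_flip F0_comp kscaleA mulVf ?kscale1.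
have hh : kmul (i + r.*2) (F0 h) (F0 h) = kscale (2 ^+ r / 2 ^+ l) (F0 h).
  rewrite {1 2}hE kmulZl kmulZr kmulA -(kmulA _ _ (F0 d)) DD kmulZr kmulZl.
  rewrite (kmul1r (@homk_F0 _ _ d)) hE !kscaleA; congr kscale.
  by move: (two l); move: (2 ^+ l : rat) (2 ^+ r : rat) => a b a0; field.
have [hs e] : stack h h = h /\ 2 ^+ r / 2 ^+ l / 2 ^+ loops h h = 1 :> rat.
  apply: F0_eq; have := congr1 (kscale (2 ^+ loops h h)^-1) hh.
  by rewrite F0_comp !kscaleA mulVf // kscale1 => ->; congr kscale; rewrite mulrC.
have {e} rl : r = (l + loops h h)%N.
  apply: expr2_eq; rewrite exprD; move/(congr1 ( *%R (2 ^+ l * 2 ^+ loops h h))): e.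
  rewrite mulr1 => <-; have := two l; have := two (loops h h).
  by move: (2 ^+ r) (2 ^+ l) (2 ^+ _) => a b c c0 b0; field; apply/andP.
have := sgb_comp h h; have := sgb_comp (flip_matching d) d.
have or : odd r = odd l (+) odd (loops h h) by rewrite [in LHS]rl oddD.
rewrite hs comp_sgbl sgb_flip -/h -/l or.
case: (odd l); case: (odd (loops h h)); case: (sgb h); case: comp_sgb; case: bar_sgb; by case: (sgb d).
Qed.

(** * Jones-Wenzl projectors *)

Definition realizable m n (K : kernel) := exists T : Hom m n, func T = K.

Lemma realizable_scale m n c K : realizable m n K -> realizable m n (kscale c K).
Proof. by case=> T <-; exists (c *: T); rewrite funcZ. Qed.

Lemma realizable_add m n K L : realizable m n K -> realizable m n L -> realizable m n (kadd K L).
Proof. by case=> S <- [T <-]; exists (S + T); rewrite funcD. Qed.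

Lemma realizable_mul m n k K L : realizable m n K -> realizable n k L -> realizable m k (kmul n K L).
Proof.
case=> S <- [T <-]; exists (comp_sign m n k *: compH T S).
by rewrite funcZ func_comp kscaleA /comp_sign sign_sqr kscale1.
Qed.

Lemma realizable_tr m n K : realizable m n K -> realizable n m (ktr K).
Proof.
case=> S <-; exists ((-1) ^+ bar_sgb m n *: barH S).
by rewrite funcZ func_bar kscaleA sign_sqr kscale1.
Qed.

Lemma realizable_ten m n K : realizable m n K -> realizable m.+1 n.+1 (kten K).
Proof.
case=> S <-; have [b hb] := func_ten m n 1; rewrite -(addn1 m) -(addn1 n).
exists ((-1) ^+ b *: tensH S (idH 1)).
by rewrite funcZ hb kscaleA sign_sqr kscale1.
Qed.

(** A bend is composition with a cap, which comes from a diagram up to sign. *)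
Lemma realizable_bend m n K : realizable m n.+1 K -> realizable m.+1 n (kbend K).
Proof.
move=> rK; have E1 : kmul n.+1 K (kid n.+1) = K.
  by case: rK => T <-; apply: kmul1r (@homk_func _ _ T).
rewrite -E1 -kten_bend; apply: realizable_mul; first exact: realizable_ten.
have [b] := nested_caps 1 n; rewrite /= add1n => E.
have R : realizable (n + 1.*2) (n + 0) (twist (F0 (juxt_matching (id_matching n) (cap_matching 1)))).
  exists (eps (juxt_matching (id_matching n) (cap_matching 1)) *: diagram (juxt_matching (id_matching n) (cap_matching 1))).
  by rewrite funcZ func_diagram kscaleA /eps sign_sqr kscale1.
have := realizable_scale ((-1) ^+ b) R; rewrite E kscaleA sign_sqr kscale1.
by rewrite addn0 addn2.
Qed.

Lemma realizable_sym n : realizable n n (symk n).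
Proof.
elim: n => [|[|n] IH]; first by exists (idH 0); rewrite func_id symk0.
  by rewrite -kten_sym0; apply: realizable_ten.
have -> : symk n.+2 = kadd (kten (symk n.+1)) (kscale (- (n.+1%:R / n.+2%:R)) (wenzl n)).
  by rewrite kten_sym; apply: kernelP => x y; rewrite /kadd /kscale; ring.
apply: realizable_add; first exact: realizable_ten.
have B := realizable_bend IH.
by apply/realizable_scale/(realizable_mul B)/realizable_tr.
Qed.

Lemma cnt_word n (X : {ffun 'I_n -> bool}) : cnt (word_of X) = (\sum_i X i)%N.
Proof.
rewrite /cnt /word_of count_map -sum1_count big_mkcond big_enum /=.
rewrite (reindex_inj rev_ord_inj) /=; apply: eq_bigr => i _.
by rewrite rev_ordK; case: (X i).
Qed.

Lemma tauE x : tau x = odd (\sum_(i < size x) nth false x i * odd (size x - i.+1)).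
Proof.
elim: x => [|c x IH] /=; first by rewrite big_ord0.
rewrite big_ord_recl oddD /= subn1 IH; congr addb; by case: c; case: odd.
Qed.

Lemma tau_word n (X : {ffun 'I_n -> bool}) : tau (word_of X) = odd (\sum_i X i * odd i).
Proof.
rewrite tauE size_word_of; congr odd; rewrite [RHS](reindex_inj rev_ord_inj) /=.
apply: eq_bigr => i _; congr muln; have := wlab_word X (rev_ord i); rewrite /wlab /= => <-.
by congr (nat_of_bool (nth _ _ _)); have := ltn_ord i; lia.
Qed.

Lemma nth_flipw x i : (i < size x)%N ->
  nth false (flipw x) i = nth false x i (+) odd (size x - i.+1).
Proof.
elim: x i => // c x IH [|i] /=; rewrite ?subn1 //.
by rewrite ltnS => /IH->; rewrite subSS.
Qed.

Lemma wlab_flipw n x (i : 'I_n) : size x = n -> wlab (flipw x) i = wlab x i (+) odd i.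
Proof.
move=> sx; rewrite /wlab nth_flipw sx; last by have := ltn_ord i; lia.
by congr (_ (+) odd _); have := ltn_ord i; lia.
Qed.

Definition toggle n (a b : 'I_n) (X : {ffun 'I_n -> bool}) : {ffun 'I_n -> bool} :=
  [ffun i => X i (+) ((i == a) || (i == b))].

Lemma toggleK n (a b : 'I_n) : involutive (toggle a b).
Proof. by move=> X; apply/ffunP => i; rewrite !ffunE addbK. Qed.

Lemma toggle_cnt n (a b : 'I_n) (X : {ffun 'I_n -> bool}) : a != b -> X a != X b ->
  cnt (word_of (toggle a b X)) = cnt (word_of X).
Proof.
move=> ab Xab; rewrite !cnt_word (bigD1 a) // [RHS](bigD1 a) //= (bigD1 b) 1?eq_sym //=.
rewrite [in RHS](bigD1 b) 1?eq_sym //= !addnA !ffunE !eqxx orbT; congr addn.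
  by move: Xab; case: (X a); case: (X b).
by apply: eq_bigr => i /andP[/negPf ia /negPf ib]; rewrite ffunE ia ib addbF.
Qed.

Lemma toggle_tau n (a b : 'I_n) (X : {ffun 'I_n -> bool}) : odd a != odd b ->
  tau (word_of (toggle a b X)) = ~~ tau (word_of X).
Proof.
move=> oab; have ab : a != b by apply: contraNneq oab => ->.
rewrite !tau_word (bigD1 a) // [in RHS](bigD1 a) //= (bigD1 b) 1?eq_sym //=.
rewrite [in RHS](bigD1 b) 1?eq_sym //= !ffunE !eqxx orbT !oddD !oddM.
rewrite (eq_bigr (fun i : 'I_n => X i * odd i)%N); last first.
  by move=> i /andP[/negPf ia /negPf ib]; rewrite ffunE ia ib addbF.
move: oab; case: (odd a); case: (odd b) => // _; case: (X a); case: (X b); case: (odd (\sum_(_ | _) _)) => //.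
Qed.

(** Exchanging the two opposite letters at the ends of the cap fixes the entries of [symk m] and
    negates those of the twisted diagram, so the sum is its own negative. *)
Lemma sym_cap m n (f : matching m n) a b : f (inl a) = inl b ->
  kmul m (symk m) (twist (F0 f)) = kop0.
Proof.
move=> fab; have fba : f (inl b) = inl a by rewrite -fab matchingK.
have oab : odd b = ~~ odd a by have := cls_matching f (inl a); rewrite fab.
have ab : a != b by apply/eqP => e; move: oab; rewrite e; case: odd.
apply: kernelP => z y; rewrite /kop0 /kmul sum_words.
set H := fun X : {ffun 'I_m -> bool} => symk m z (word_of X) * twist (F0 f) (word_of X) y.
suff E X : H (toggle a b X) = - H X.
  have : \sum_X H X = - \sum_X H X.
    rewrite {1}(reindex_inj (inv_inj (toggleK a b))) -sumrN; exact: eq_bigr.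
  by move/eqP; rewrite -addr_eq0 -mulr2n mulrn_eq0 => /= /eqP.
have inv : F0 f (flipw (word_of (toggle a b X))) (flipw y) = F0 f (flipw (word_of X)) (flipw y).
  rewrite /F0 !size_flipw !size_word_of; congr (nat_of_bool [&& _, _ & _])%:R.
  pose t (u : point m n) := (u == inl a) || (u == inl b).
  have tf u : t (f u) = t u.
    have -> : t (f u) = (f u == f (inl b)) || (f u == f (inl a)) by rewrite fab fba.
    by rewrite !(inj_eq (@matching_inj _ _ f)) orbC.
  have L u : lab (wlab (m := m) (flipw (word_of (toggle a b X)))) (wlab (m := n) (flipw y)) u =
      lab (wlab (m := m) (flipw (word_of X))) (wlab (m := n) (flipw y)) u (+) t u.
    case: u => i; rewrite /t /=; last by rewrite addbF.
    rewrite !wlab_flipw ?size_word_of // !wlab_word ffunE.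
    by rewrite -!addbA; congr addb; rewrite addbC; congr (_ (+) _).
  by apply: eq_forallb => u; rewrite !L tf (inj_eq (@addIb _)).
rewrite /H /twist inv; have [->|nz] := eqVneq (F0 f (flipw (word_of X)) (flipw y)) 0.
  by rewrite !mulr0 oppr0.
have Xab : X a != X b.
  move: nz; rewrite /F0 !size_flipw !size_word_of eqxx /=; case: (_ == n); last by rewrite eqxx.
  case: invariant_labP => [h _|_]; last by rewrite eqxx.
  have := h (inl a); rewrite fab /= !wlab_flipw ?size_word_of // !wlab_word oab.
  by case: (X a); case: (X b); case: odd.
rewrite toggle_tau; last by rewrite oab; case: odd.
have -> : symk m z (word_of (toggle a b X)) = symk m z (word_of X).
  by rewrite /symk !size_word_of toggle_cnt.
by rewrite addNb signrN !mulNr mulrN.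
Qed.
(** Without an arc on the bottom edge, the bottom points are sent to the top in increasing order,
    hence identically. *)
Lemma id_or_cap n (h : matching n n) : h != id_matching n -> exists a b, h (inl a) = inl b.
Proof.
move=> hid; apply: contrapT => nex; case/eqP: hid.
have /choice[t ht] : forall i, exists j, h (inl i) = inr j.
  by move=> i; case E: (h (inl i)) => [j|j]; [case: nex; exists i, j|exists j].
have t_lt (i j : 'I_n) : (i < j)%N -> (t i < t j)%N.
  move=> ij; have ne : t i != t j :> nat.
    apply: contraTneq ij => /val_inj e; have := ht j; rewrite -e -ht => /(@matching_inj _ _ h)[->].
    by rewrite ltnn.
  have cr := @matching_cross _ _ h (inl i) (inl j); rewrite !ht /= in cr.
  have := ltn_ord (t i); have := ltn_ord (t j); have := ltn_ord j => lj ltj lti.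
  by have [//|ji|/eqP] := ltngtP (t i) (t j); [case: cr; split; lia|rewrite (negPf ne)].
have t_ge k (i : 'I_n) : i = k :> nat -> (i <= t i)%N.
  elim: k i => [|k IH] i ik; first by rewrite ik.
  have lt : (k < n)%N by have := ltn_ord i; lia.
  by have := IH (Ordinal lt) erefl; have := t_lt (Ordinal lt) i; rewrite /=; lia.
have t_le k (i : 'I_n) : (n = i + k.+1)%N -> (t i <= i)%N.
  elim: k i => [|k IH] i ik; first by have := ltn_ord (t i); lia.
  have lt : (i.+1 < n)%N by lia.
  by have := t_lt i (Ordinal lt); have := IH (Ordinal lt); rewrite /=; lia.
have t_id i : t i = i.
  apply: val_inj; have := t_ge _ i erefl; have := t_le (n - i.+1)%N i.
  by have := ltn_ord i; rewrite /=; lia.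
apply: val_inj; apply/ffunP => -[] i; rewrite !ffunE.
  by have := ht i; rewrite t_id.
by have := matchingK h (inl i); rewrite ht t_id.
Qed.

Lemma flip_cupcap n (i j : 'I_n) (ij : j = i.+1 :> nat) :
  flip_matching (cupcap_matching ij) = cupcap_matching ij.
Proof.
apply: val_inj; apply/ffunP => u; rewrite !ffunE.
by case: u => k /=; case: (k == i) => //; case: (k == j).
Qed.

(** The column of the twisted e_i at a word with distinct letters at i and j has two non-zero
    entries, 1 and -1, at the word and at the one with these letters exchanged. *)
Lemma cupcap_toggle n (K : kernel) (i j : 'I_n) (ij : j = i.+1 :> nat) z (Y : {ffun 'I_n -> bool}) :
  kmul n K (twist (F0 (cupcap_matching ij))) = kop0 -> Y i != Y j ->
  K z (word_of Y) = K z (word_of (toggle i j Y)).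
Proof.
move=> E Yij; have ne : i != j by apply/eqP => /(congr1 val) /= e; lia.
have oij : odd i != odd j by rewrite ij /=; case: odd.
have Fval X : twist (F0 (cupcap_matching ij)) (word_of X) (word_of Y) =
    (X == Y)%:R - (X == toggle i j Y)%:R.
  have FE : F0 (cupcap_matching ij) (flipw (word_of X)) (flipw (word_of Y)) =
      ((X == Y) || (X == toggle i j Y))%:R.
    rewrite /F0 !size_flipw !size_word_of !eqxx /=; congr (nat_of_bool _)%:R.
    have L u : lab (wlab (m := n) (flipw (word_of X))) (wlab (m := n) (flipw (word_of Y))) u =
        lab X Y u (+) match u with inl k => odd k | inr k => odd k end.
      by case: u => k /=; rewrite wlab_flipw ?size_word_of // wlab_word.
    apply/invariant_labP/orP => [h|h].
      have hX k : k != i -> k != j -> X k = Y k.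
        move=> ki kj; have := h (inl k); rewrite !L ffunE (negPf ki) (negPf kj) /=.
        by move/addIb.
      have hi : X i != X j.
        have := h (inl i); rewrite !L ffunE eqxx /=; move: oij.
        by case: (odd i); case: (odd j); case: (X i); case: (X j).
      have [e|e] := eqVneq (X i) (Y i); [left|right]; apply/eqP/ffunP => k.
        have [->//|ki] := eqVneq k i; have [->|kj] := eqVneq k j; last exact: hX.
        by move: hi Yij; rewrite e; case: (Y i); case: (X j); case: (Y j).
      rewrite ffunE; have [->|ki] := eqVneq k i.
        by move: e; case: (X i); case: (Y i).
      have [->|kj] := eqVneq k j; last by rewrite hX ?addbF.
      by move: e hi Yij; case: (X i); case: (Y i); case: (X j); case: (Y j).
    have oj : odd j = ~~ odd i by rewrite ij.
    have XY : X i != X j /\ (forall k, k != i -> k != j -> X k = Y k).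
      case: h => /eqP->; split=> //.
        by rewrite !ffunE !eqxx orbT; move: Yij; case: (Y i); case: (Y j).
      by move=> k /negPf ki /negPf kj; rewrite ffunE ki kj addbF.
    case: XY => Xij XY [] k; rewrite !L ffunE /=; have [->|ki] := eqVneq k i;
      rewrite /= ?oj.
    - by move: Xij; case: (X i); case: (X j); case: (odd i).
    - have [->|kj] := eqVneq k j; last by rewrite /= XY.
      by rewrite /= oj; move: Xij; case: (X i); case: (X j); case: (odd i).
    - by move: Yij; case: (Y i); case: (Y j); case: (odd i).
    - have [->|kj] := eqVneq k j; last by rewrite /= XY.
      by rewrite /= oj; move: Yij; case: (Y i); case: (Y j); case: (odd i).
  rewrite /twist FE; have [->|XY] := eqVneq X Y.
    rewrite addbb mul1r; case: eqP => [e|_]; last by rewrite subr0.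
    by move/ffunP/(_ i): e; rewrite ffunE eqxx; case: (Y i).
  have [->|_] := eqVneq X (toggle i j Y); last by rewrite subr0 mulr0.
  by rewrite toggle_tau // addNb addbb /= mulr1 sub0r.
have := congr1 (fun M => M z (word_of Y)) E; rewrite /kop0 /kmul sum_words.
under eq_bigr do rewrite Fval mulrBr.
rewrite sumrB (bigD1 Y) //= eqxx mulr1 big1 => [|X /negPf->]; last by rewrite mulr0.
rewrite (bigD1 (toggle i j Y)) //= eqxx mulr1 big1 => [|X /negPf->]; last by rewrite mulr0.
by rewrite !addr0 => /eqP; rewrite subr_eq0 => /eqP.
Qed.

(** Adjacent transpositions connect all words with the same number of letters [true]. *)
Lemma swap_cnt (T : Type) (g : seq bool -> T) n :
  (forall u v c d, (size u + size v).+2 = n -> g (u ++ c :: d :: v) = g (u ++ d :: c :: v)) ->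
  forall x y, size x = n -> size y = n -> cnt x = cnt y -> g x = g y.
Proof.
elim: n g => [|n IH] g gs [|c x] [|d y] //= [sx] [sy].
have P b x' y' : size x' = n -> size y' = n -> cnt x' = cnt y' -> g (b :: x') = g (b :: y').
  move=> sx' sy' e; apply: (IH (fun w => g (b :: w))) => // u v c' d' e'.
  by apply: (gs (b :: u)); rewrite /= -e'.
have W x' y' : size x' = n -> size y' = n -> (cnt x').+1 = cnt y' -> g (true :: x') = g (false :: y').
  move=> sx' sy' e; have := cnt_le y'; rewrite sy' -e => lt.
  pose y1 := nseq (cnt x') true ++ nseq (n.-1 - cnt x') false.
  have sy1 : size y1 = n.-1 by rewrite size_cat !size_nseq; lia.
  have cy1 : cnt y1 = cnt x' by rewrite /cnt count_cat !count_nseq /= mul1n mul0n addn0.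
  have -> : g (false :: y') = g (false :: true :: y1).
    by apply: P; rewrite /= ?sy1 //; [lia|rewrite -e /cnt /= -/(cnt y1) cy1].
  have /= -> := gs [::] y1 false true; last by rewrite sy1; lia.
  by apply: P; rewrite /= ?sy1 //; lia.
case: c d => -[] e; try (by apply: P => //; move: e; rewrite /cnt /=; lia).
  by apply: W => //; move: e; rewrite /cnt /=; lia.
by apply/esym/W => //; move: e; rewrite /cnt /=; lia.
Qed.
Lemma annihilated_symr n (K : kernel) :
  (forall (i j : 'I_n) (ij : j = i.+1 :> nat),
     kmul n K (twist (F0 (cupcap_matching ij))) = kop0) ->
  symr n K.
Proof.
move=> E x y z sy sz; apply: (swap_cnt (g := K x) (n := n)) => // u v c d s.
have [->//|cd] := eqVneq c d.
have lj : (n - (size u).+1 < n)%N by lia.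
have li : (n - (size u).+2 < n)%N by lia.
have ij : (n - (size u).+1 = (n - (size u).+2).+1)%N by lia.
have sw c' d' : size (u ++ c' :: d' :: v) = n by rewrite size_cat /=; lia.
have nj (j : 'I_n) c' d' : j = Ordinal lj -> wlab (u ++ c' :: d' :: v) j = c'.
  move->; rewrite /wlab nth_cat /=.
  have -> : (n - (n - (size u).+1).+1 = size u)%N by lia.
  by rewrite ltnn subnn.
have ni (i : 'I_n) c' d' : i = Ordinal li -> wlab (u ++ c' :: d' :: v) i = d'.
  move->; rewrite /wlab nth_cat /=.
  have -> : (n - (n - (size u).+2).+1 = (size u).+1)%N by lia.
  by rewrite ltnNge leqnSn subSnn.
rewrite -(word_of_wlab (sw c d)) (cupcap_toggle (i := Ordinal li) (j := Ordinal lj) (ij := ij)) //; last first.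
  by rewrite !ffunE ni // nj // eq_sym.
congr (K x _); rewrite -[RHS](word_of_wlab (sw d c)); congr word_of.
apply/ffunP => k; rewrite !ffunE.
have [->|ki] := eqVneq k (Ordinal li); first by rewrite !ni //; case: (c) (d) cd => -[].
have [->|kj] := eqVneq k (Ordinal lj); first by rewrite !nj //; case: (c) (d) cd => -[].
rewrite addbF /wlab !nth_cat; case: ltnP => // le.
have : (n - k.+1 - size u > 1)%N.
  have := ltn_ord k; move: ki kj; rewrite -!val_eqE /=; move: le s; clear; lia.
by case: (_ - _)%N => [|[]].
Qed.

Lemma func_sum m n (x : Hom m n) z y :
  func x z y = \sum_f x f * eps f * twist (F0 f) z y.
Proof. by rewrite /func /twist mulr_sumr; apply: eq_bigr => f _; rewrite mulrCA. Qed.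

(** Every diagram except the identity has an arc on the bottom edge and is killed by [symk n]. *)
Lemma sym_func n (x : Hom n n) : kmul n (symk n) (func x) = kscale (x (id_matching n)) (symk n).
Proof.
apply: kernelP => z y; rewrite /kmul.
under eq_bigr do rewrite func_sum mulr_sumr.
rewrite exchange_big /= (bigD1 (id_matching n)) //= [X in _ + X]big1 ?addr0 => [|h hid]; last first.
  have [a [b hab]] := id_or_cap hid.
  under eq_bigr do rewrite mulrCA.
  rewrite -mulr_sumr -[X in _ * X]/(kmul n (symk n) (twist (F0 h)) z y).
  by rewrite (sym_cap hab) mulr0.
rewrite F0_id twist_id /eps sgb_id; under eq_bigr do rewrite mulr1 mulrCA.
by rewrite -mulr_sumr -[X in _ * X]/(kmul n (symk n) (kid n) z y) (kmul1r (@homk_sym n)).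
Qed.

Lemma symk_false n : symk n (nseq n false) (nseq n false) = 1.
Proof. by rewrite /symk size_nseq !eqxx /cnt count_nseq /= mul0n bin0 divr1. Qed.

Lemma kscale_eq0 c K : c != 0 -> kscale c K = kop0 -> K = kop0.
Proof.
move=> c0 E; apply: kernelP => x y; have := congr1 (fun M => M x y) E.
by rewrite /kscale /kop0 => /eqP; rewrite mulf_eq0 (negPf c0) => /eqP.
Qed.

(** Annihilation by the e_i gives that [symk n] times K is K, while [sym_func] makes this product a
    multiple of [symk n]. Being idempotent and non-zero leaves only the factor 1. *)
Lemma is_JW_func n (x : Hom n n) : is_JW x -> func x = symk n.
Proof.
move=> [x0 xx xe]; set K := func x.
have KK : kmul n K K = K by rewrite -func_compl xx.
have eps0 f : @eps n n f != 0 by rewrite signr_eq0.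
have Ke (i j : 'I_n) (ij : j = i.+1 :> nat) : kmul n K (twist (F0 (cupcap_matching ij))) = kop0.
  have [/(congr1 (@func _ _)) + _] := xe i j ij.
  by rewrite func_compl func_diagram kmulZr func0 => /(kscale_eq0 (eps0 _)).
have eK (i j : 'I_n) (ij : j = i.+1 :> nat) : kmul n (ktr K) (twist (F0 (cupcap_matching ij))) = kop0.
  have [_ /(congr1 (@func _ _))] := xe i j ij.
  rewrite func_compl func_diagram kmulZl func0 => /(kscale_eq0 (eps0 _))/(congr1 ktr).
  by rewrite ktrM -twist_tr -F0_flip flip_cupcap.
have hK := @homk_func _ _ x : homk n n K.
have SK : kmul n (symk n) K = K.
  by have := congr1 ktr (symr_absorb (homk_tr hK) (annihilated_symr eK)); rewrite ktrM symk_tr.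
have Kc : K = kscale (x (id_matching n)) (symk n) by rewrite -sym_func.
move: (x _) Kc => c Kc.
have c0 : c != 0.
  apply/eqP => c0; apply: x0; apply: func_inj; rewrite func0 -/K Kc c0.
  by apply: kernelP => ? ?; rewrite /kscale mul0r.
move: KK; rewrite Kc kmulZl kmulZr symkk => /(congr1 (fun M => M (nseq n false) (nseq n false))).
rewrite /kscale symk_false !mulr1 => /eqP; rewrite -subr_eq0 -{3}[c]mulr1 -mulrBr mulf_eq0 (negPf c0) /=.
rewrite subr_eq0 => /eqP->; exact: kscale1.
Qed.

Lemma JW_exists n : exists x : Hom n n, is_JW x.
Proof.
have [x xS] := realizable_sym n; exists x; split.
- move=> x0; have := congr1 (fun M => M (nseq n false) (nseq n false)) xS.
  by rewrite x0 func0 symk_false => /eqP; rewrite eq_sym oner_eq0.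
- by apply: func_inj; rewrite func_compl xS symkk.
- move=> i j ij; have fij : cupcap_matching ij (inl i) = inl j by rewrite ffunE eqxx.
  have Z : kmul n (symk n) (func (diagram (cupcap_matching ij))) = kop0.
    rewrite func_diagram kmulZr (sym_cap fij).
    by apply: kernelP => ? ?; rewrite /kscale mulr0.
  split; apply: func_inj; rewrite func_compl func0 xS //.
  rewrite -[RHS]/(ktr kop0) -Z ktrM symk_tr; congr kmul.
  by rewrite func_diagram -[RHS]/(kscale _ (ktr _)) -twist_tr -F0_flip flip_cupcap.
Qed.

Lemma func_JW n : func (JW n) = symk n.
Proof. by apply: is_JW_func; exact: (@classical_sets.xgetPex _ 0 [set x | is_JW x]%classic (JW_exists n)). Qed.

(** * Digits and supports *)

Section Digits.
Variables (p : nat) (p_pr : prime p).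

Let p_gt1 : (1 < p)%N := prime_gt1 p_pr.
Let p_gt0 : (0 < p)%N := ltnW p_gt1.
Let pX_gt0 i : (0 < p ^ i)%N. Proof. by rewrite expn_gt0 p_gt0. Qed.

Lemma sum_digits N j k : (j <= k)%N ->
  (\sum_(j <= i < k) digit p N i * p ^ i + N %/ p ^ k * p ^ k = N %/ p ^ j * p ^ j)%N.
Proof.
elim: k => [|k IH] jk; first by move: jk; rewrite leqn0 => /eqP->; rewrite big_geq.
have [->|ne] := eqVneq j k.+1; first by rewrite big_geq.
have E : (N %/ p ^ k = N %/ p ^ k.+1 * p + digit p N k)%N by rewrite expnSr divnMA -divn_eq.
have jk' : (j <= k)%N by lia.
by rewrite big_nat_recr //= -IH // E mulnDl -mulnA -expnS -addnA; congr addn; apply: addnC.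
Qed.

Lemma digit_trunc_log N : (0 < N)%N -> digit p N (top_digit p N) != 0%N.
Proof.
move=> N0; have /andP[le lt] := trunc_log_bounds p_gt1 N0.
rewrite /digit /top_digit modn_small; first by rewrite -lt0n divn_gt0.
by rewrite ltn_divLR // -expnS.
Qed.

Lemma divn_top N : (0 < N)%N -> (N %/ p ^ (top_digit p N).+1 = 0)%N.
Proof. by move=> N0; have /andP[_ lt] := trunc_log_bounds p_gt1 N0; rewrite divn_small. Qed.

Definition low_digit N := find (fun i => digit p N i != 0%N) (iota 0 (top_digit p N).+1).

Lemma low_digitP N : (0 < N)%N ->
  [/\ (low_digit N <= top_digit p N)%N, digit p N (low_digit N) != 0%N &
      forall i, (i < low_digit N)%N -> digit p N i = 0%N].
Proof.
move=> N0; have h : has (fun i => digit p N i != 0%N) (iota 0 (top_digit p N).+1).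
  by apply/hasP; exists (top_digit p N); rewrite ?digit_trunc_log // mem_iota /=.
have lt : (low_digit N < (top_digit p N).+1)%N by move: h; rewrite has_find size_iota.
split=> //; first by have := nth_find 0%N h; rewrite nth_iota.
move=> i il; have := before_find 0%N il; rewrite nth_iota; last exact: ltn_trans il lt.
by move/negbFE/eqP.
Qed.

Lemma dvdn_low_digit N : (0 < N)%N -> (p ^ low_digit N %| N)%N.
Proof.
move=> N0; have [_ _ z] := low_digitP N0.
have := @sum_digits N 0 (low_digit N) isT; rewrite big_nat big1 => [|i /andP[_ /z->] //].
by rewrite add0n expn0 divn1 muln1 => e; apply/dvdnP; exists (N %/ p ^ low_digit N)%N.
Qed.

Lemma nonzero_digits_low N : (0 < N)%N -> nonzero_digits p N =
  (count (fun i => digit p N i != 0%N) (iota (low_digit N).+1 (top_digit p N - low_digit N))).+1.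
Proof.
move=> N0; have [le nz z] := low_digitP N0.
rewrite /nonzero_digits; have -> : (top_digit p N).+1 = (low_digit N + (top_digit p N - low_digit N).+1)%N by lia.
rewrite iotaD count_cat /= add0n nz (_ : count _ (iota 0 _) = 0%N) //; apply/eqP.
by rewrite -leqn0 leqNgt -has_count; apply/hasPn => i; rewrite mem_iota /= add0n => /z->.
Qed.

(** N without its lowest non-zero digit. *)
Definition high N := (N %/ p ^ (low_digit N).+1 * p ^ (low_digit N).+1)%N.

Lemma father_high n : father p n = (high n.+1).-1.
Proof.
have [le _ _] := low_digitP (ltn0Sn n); congr predn; rewrite /high.
by rewrite -(@sum_digits n.+1 _ (top_digit p n.+1).+1) // divn_top // addn0.
Qed.

Section NotAdam.
Variable N : nat.
Hypotheses (N0 : (0 < N)%N) (nadam : (1 < nonzero_digits p N)%N).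

Let s := low_digit N.
Let r := top_digit p N.
Let F := high N.

Lemma low_lt_top : (s < r)%N.
Proof.
have [le _ _] := low_digitP N0; rewrite ltn_neqAle le andbT; apply: contraTneq nadam => e.
by rewrite nonzero_digits_low // -/s -/r e subnn.
Qed.

Lemma top_le_high : (p ^ r <= F)%N.
Proof.
have /andP[le lt] := trunc_log_bounds p_gt1 N0; have sr := low_lt_top.
rewrite /F /high -/s -[X in (X <= _)%N](@divnK (p ^ s.+1)); last exact: dvdn_exp2l.
by rewrite leq_mul2r leq_div2r ?orbT.
Qed.

Lemma high_gt0 : (0 < F)%N. Proof. exact: leq_trans top_le_high. Qed.

Lemma high_le : (F <= N)%N. Proof. exact: leq_divM. Qed.

Lemma top_high : top_digit p F = r.
Proof.
have /andP[le lt] := trunc_log_bounds p_gt1 N0.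
by apply: trunc_log_eq => //; rewrite top_le_high (leq_ltn_trans high_le).
Qed.

Lemma digit_high i : digit p F i = if (i <= s)%N then 0%N else digit p N i.
Proof.
rewrite /digit /F /high -/s; case: leqP => si.
  have -> : (p ^ s.+1 = p ^ (s - i) * p * p ^ i)%N by rewrite -expnSr -expnD; congr expn; lia.
  by rewrite mulnA mulnK // mulnA modnMl.
have -> : (p ^ i = p ^ s.+1 * p ^ (i - s.+1))%N by rewrite -expnD; congr expn; lia.
by rewrite !divnMA mulnK.
Qed.

Lemma nonzero_digits_high : nonzero_digits p N = (nonzero_digits p F).+1.
Proof.
have sr := low_lt_top.
rewrite nonzero_digits_low // -/s -/r /nonzero_digits top_high; congr _.+1.
have -> : r.+1 = (s.+1 + (r - s))%N by lia.
rewrite iotaD count_cat add0n (_ : count _ (iota 0 _) = 0%N) ?add0n.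
  by apply: eq_in_count => i; rewrite mem_iota => /andP[si _]; rewrite digit_high leqNgt si.
apply/eqP; rewrite -leqn0 leqNgt -has_count; apply/hasPn => i.
by rewrite mem_iota /= add0n ltnS digit_high => ->.
Qed.

Lemma high_rest : (N - F = digit p N s * p ^ s)%N.
Proof.
have := @sum_digits N s s.+1 (leqnSn _); rewrite big_nat1 (divnK (dvdn_low_digit N0)) -/F => e.
by rewrite -{1}e addnK.
Qed.

Lemma rest_gt0 : (0 < N - F)%N.
Proof. by have [_ nz _] := low_digitP N0; rewrite high_rest muln_gt0 lt0n nz pX_gt0. Qed.

Lemma rest_lt : (N - F < p ^ s.+1)%N.
Proof. by rewrite high_rest expnS ltn_pmul2r // ltn_mod. Qed.

Lemma rest_dvd : (p ^ s %| N - F)%N. Proof. by rewrite high_rest dvdn_mull. Qed.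

Lemma high_dvd : (p ^ s.+1 %| F)%N. Proof. exact: dvdn_mull. Qed.

End NotAdam.

Definition signed N (r : nat) (eps : {ffun 'I_r -> bool}) : int :=
  (digit p N r * p ^ r)%N%:Z + \sum_(i < r) (-1) ^+ eps i * (digit p N i * p ^ i)%N%:Z.

Lemma suppP n r j : r = top_digit p n.+1 ->
  reflect (exists eps, j%:Z = @signed n.+1 r eps) (supp p n j).
Proof. by move->; apply: exists_eqP. Qed.

(** The leading term exceeds the sum of all lower ones. *)
Lemma signed_bounds N r (eps : {ffun 'I_r -> bool}) : (0 < N)%N -> r = top_digit p N ->
  0 < signed N eps <= N%:Z.
Proof.
move=> N0 rE; subst r; set r := top_digit p N in eps *.
have /andP[le _] := trunc_log_bounds p_gt1 N0.
have /= E := @sum_digits N 0 r isT; rewrite expn0 divn1 muln1 in E.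
have T : (N %/ p ^ r = digit p N r)%N.
  rewrite /digit modn_small // ltn_divLR // -expnS.
  by have /andP[] := trunc_log_bounds p_gt1 N0.
set A := (\sum_(0 <= i < r) _)%N in E; rewrite T in E.
have AE : A%:Z = \sum_(i < r) (digit p N i * p ^ i)%N%:Z.
  by rewrite /A big_mkord -natz natr_sum; apply: eq_bigr => i _; rewrite natz.
have Alt : (A < p ^ r)%N.
  have -> : (A = N %% p ^ r)%N.
    by apply: (@addIn (digit p N r * p ^ r)%N); rewrite /= E {1}(divn_eq N (p ^ r)) T addnC.
  by rewrite ltn_mod.
have dr : (p ^ r <= digit p N r * p ^ r)%N.
  by rewrite leq_pmull // lt0n digit_trunc_log.
have S (b : bool) (z : int) : 0 <= z -> - z <= (-1) ^+ b * z <= z.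
  move=> z0; have zN : - z <= z by lia.
  by case: b; rewrite ?expr1 ?expr0 ?mulN1r ?mul1r lexx zN.
have B1 : \sum_(i < r) (-1) ^+ eps i * (digit p N i * p ^ i)%N%:Z <= A%:Z.
  by rewrite AE; apply: ler_sum => i _; have /andP[] := @S (eps i) (digit p N i * p ^ i)%N%:Z isT.
have B2 : - A%:Z <= \sum_(i < r) (-1) ^+ eps i * (digit p N i * p ^ i)%N%:Z.
  by rewrite AE -sumrN; apply: ler_sum => i _; have /andP[] := @S (eps i) (digit p N i * p ^ i)%N%:Z isT.
rewrite /signed; move: (\sum_(i < r) _) B1 B2 => z B1 B2.
by move: E Alt dr B1 B2; clear; lia.
Qed.

Section SuppStep.
Variable n : nat.
Hypothesis nadam : (1 < nonzero_digits p n.+1)%N.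

Let N := n.+1.
Let N0 : (0 < N)%N := ltn0Sn n.
Let s := low_digit N.
Let r := top_digit p N.
Let F := high N.
Let f := father p n.
Let m := (n - f)%N.

Lemma fatherS : f.+1 = F.
Proof. by rewrite /f father_high prednK // high_gt0. Qed.

Lemma father_rest : m = (N - F)%N.
Proof. by rewrite -fatherS subSS. Qed.

Let rf : r = top_digit p f.+1. Proof. by rewrite fatherS top_high. Qed.

Lemma signed_high (eps : {ffun 'I_r -> bool}) :
  signed N eps = signed F eps + (-1) ^+ eps (Ordinal (low_lt_top N0 nadam)) * m%:Z.
Proof.
set so := Ordinal _; have sr := low_lt_top N0 nadam; have [_ _ z] := low_digitP N0.
rewrite /signed (digit_high N0 nadam) leqNgt sr /= -addrA; congr +%R.
rewrite (bigD1 so) //= [in RHS](bigD1 so) //= (digit_high N0 nadam) leqnn mul0n mulr0 add0r.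
rewrite father_rest high_rest // addrC; congr +%R.
apply: eq_bigr => i; rewrite -val_eqE /= => ne; rewrite (digit_high N0 nadam).
by case: ifP => // le; rewrite z // ltn_neqAle ne.
Qed.

(** Changing the sign of a digit changes the sum by twice that term, and all terms of F are
    multiples of p^(s+1). *)
Lemma signed_mod (eps : {ffun 'I_r -> bool}) :
  ((p ^ s.+1).*2%:Z %| F%:Z - signed F eps)%Z.
Proof.
have FE : F%:Z = (digit p F r * p ^ r)%N%:Z + \sum_(i < r) (digit p F i * p ^ i)%N%:Z.
  have F0 := high_gt0 N0 nadam; have /= := @sum_digits F 0 r.+1 isT.
  have dt : (F %/ p ^ r.+1 = 0)%N by rewrite -(divn_top F0) top_high.
  rewrite expn0 divn1 muln1 dt mul0n addn0 big_mkord => e; rewrite -{1}e big_ord_recr /= addnC PoszD; congr +%R.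
  by rewrite -natz natr_sum; apply: eq_bigr => i _; rewrite natz.
rewrite {1}FE /signed opprD addrACA subrr add0r -sumrB.
apply: (big_ind (fun z : int => ((p ^ s.+1).*2%:Z %| z)%Z)) => [||i _]; first exact: dvdz0.
  exact: rpredD.
rewrite (digit_high N0 nadam); case: leqP => [_|si]; first by rewrite mul0n mulr0 subrr dvdz0.
have /dvdnP[k ->] : (p ^ s.+1 %| digit p N i * p ^ i)%N by rewrite dvdn_mull // dvdn_exp2l.
case: (eps i); rewrite ?mul1r ?subrr ?dvdz0 // expr1 mulN1r opprK -PoszD addnn doubleMr.
by rewrite dvdzE /= dvdn_mull.
Qed.

Lemma shifted_suppP j : reflect (exists eps : {ffun 'I_r -> bool}, j.+1%:Z = signed F eps) (shifted_supp p f j).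
Proof. by rewrite -fatherS; apply: suppP. Qed.

Lemma shifted_supp_step j : shifted_supp p n j =
  ((m <= j)%N && shifted_supp p f (j - m)%N) || shifted_supp p f (j + m)%N.
Proof.
have F0 := high_gt0 N0 nadam.
have B (eps : {ffun 'I_r -> bool}) : 0 < signed F eps <= F%:Z.
  by apply: signed_bounds => //; rewrite top_high.
apply/(suppP _ (erefl r))/orP => [[eps E]|].
  rewrite -/N signed_high in E; have /andP[B0 _] := B eps.
  case: (eps _) E; rewrite ?expr1 ?expr0 ?mulN1r ?mul1r => E; [right|left; apply/andP; split].
  - apply/shifted_suppP; exists eps; lia.
  - lia.
  - apply/shifted_suppP; exists eps; lia.
(* The digit of F at place s is zero, so the sign there can be set freely; for N this sign decides
   between + m and - m. *)
pose set_sign b (eps : {ffun 'I_r -> bool}) : {ffun 'I_r -> bool} :=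
  [ffun i => if i == Ordinal (low_lt_top N0 nadam) then b else eps i].
have setE b eps : signed F (set_sign b eps) = signed F eps.
  rewrite /signed; congr +%R; apply: eq_bigr => i _; rewrite ffunE.
  by case: eqP => // ->; rewrite (digit_high N0 nadam) leqnn mul0n !mulr0.
case=> [/andP[mj] |] /shifted_suppP[eps E].
  exists (set_sign false eps); rewrite -/N signed_high setE ffunE eqxx expr0 mul1r; lia.
exists (set_sign true eps); rewrite -/N signed_high setE ffunE eqxx expr1 mulN1r; lia.
Qed.

Lemma shifted_supp_mod i : shifted_supp p f i -> (i.+1 = f.+1 %[mod (p ^ s.+1).*2])%N.
Proof.
move=> /shifted_suppP[eps E]; have := signed_mod eps; rewrite -E fatherS => d.
by move: d; rewrite -eqz_mod_dvd !modz_nat => /eqP[->].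
Qed.

(** i + 1 is a positive multiple of p^(s+1), which exceeds m. *)
Lemma shifted_supp_ge i : shifted_supp p f i -> (m <= i)%N.
Proof.
move=> si; have d2 : (p ^ s.+1 %| (p ^ s.+1).*2)%N by rewrite -muln2 dvdn_mulr.
have : (p ^ s.+1 %| i.+1)%N.
  by rewrite /dvdn -(modn_dvdm _ d2) (shifted_supp_mod si) modn_dvdm // fatherS; apply: high_dvd.
by move/(dvdn_leq (ltn0Sn i)); have := rest_lt N0; rewrite -father_rest; apply: leq_trans.
Qed.

(** Both would be congruent modulo 2 p^(s+1), yet they differ by 2 m with 0 < m < p^(s+1). *)
Lemma shifted_supp_disj i : shifted_supp p f i -> ~~ shifted_supp p f (i + m.*2)%N.
Proof.
move=> si; apply/negP => /shifted_supp_mod/eqP; rewrite -(shifted_supp_mod si) -addSn -{2}[i.+1]addn0.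
have lt : (m < p ^ s.+1)%N by rewrite father_rest; apply: rest_lt.
rewrite eqn_modDl mod0n modn_small ?ltn_double // double_eq0 father_rest.
by have := rest_gt0 N0; case: (_ - _)%N.
Qed.

End SuppStep.

Lemma adam_shape n : nonzero_digits p n.+1 = 1%N ->
  let r := top_digit p n.+1 in (p ^ r %| n.+1)%N /\ forall j, shifted_supp p n j = (j == n).
Proof.
have N0 := ltn0Sn n; set r := top_digit p n.+1 => n1 /=.
have [le nz z] := low_digitP N0; have sr : low_digit n.+1 = r.
  apply/eqP; rewrite eqn_leq le leqNgt; apply/negP => lt; move: n1; rewrite nonzero_digits_low // => -[].
  apply/eqP; rewrite -lt0n -has_count; apply/hasP; exists r; last exact: digit_trunc_log.
  by rewrite mem_iota -/r lt; lia.
rewrite sr in z; split=> [|j]; first by rewrite -sr dvdn_low_digit.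
have E0 (eps : {ffun 'I_r -> bool}) : signed n.+1 eps = n.+1%:Z.
  rewrite /signed big1 ?addr0 => [|i _]; last by rewrite z // mul0n mulr0.
  congr Posz; have := @sum_digits n.+1 r r.+1 (leqnSn r).
  by rewrite big_nat1 divn_top // mul0n addn0 => ->; rewrite divnK // -sr dvdn_low_digit.
apply/(suppP _ (erefl r))/eqP => [[eps]|->]; first by rewrite E0 => -[].
by exists [ffun=> false]; rewrite E0.
Qed.
End Digits.

(** * The p-Jones-Wenzl element *)

Section Assembly.
Variables (p : nat) (p_pr : prime p).

(* Up to signs, [kmor k n j] is the matrix of [pmor_rec p k n j] and
   [kcoef k n j] is [lambda_rec p k n j]. *)
Fixpoint kcoef (k n j : nat) : rat :=
  if k is k'.+1 then
    let f := father p n in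
    let m := (n - f)%N in
    if (m <= j)%N && shifted_supp p f (j - m)%N then kcoef k' f (j - m)%N
    else let i := (j + m)%N in (i.+1 - m)%:R / i.+1%:R * kcoef k' f i
  else 1.

Fixpoint kmor (k n j : nat) : kernel :=
  if k is k'.+1 then
    let f := father p n in
    let m := (n - f)%N in
    if (m <= j)%N && shifted_supp p f (j - m)%N then iter m kten (kmor k' f (j - m)%N)
    else let i := (j + m)%N in iter m kbend (kmul i (kmor k' f i) (symk i))
  else kid n.

Section Step.
Variables (k n : nat).
Hypothesis nd : nonzero_digits p n.+1 = k.+2.
Let f := father p n.
Let m := (n - f)%N.

Lemma digits_gt1 : (1 < nonzero_digits p n.+1)%N. Proof. by rewrite nd. Qed.

Lemma father_digits : nonzero_digits p f.+1 = k.+1.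
Proof. by have := nonzero_digits_high p_pr (ltn0Sn n) digits_gt1; rewrite nd -fatherS ?digits_gt1 // => -[]. Qed.

Lemma father_le : (f <= n)%N.
Proof. by have := high_le p n.+1; rewrite -(fatherS p_pr digits_gt1). Qed.

Lemma down_branch i : shifted_supp p f i ->
  (m <= i - m)%N && shifted_supp p f (i - m - m)%N = false.
Proof.
move=> si; apply/negP => /andP[le s2]; have /negP[] := shifted_supp_disj p_pr digits_gt1 s2.
rewrite -/f -/m; have -> // : (i - m - m + m.*2 = i)%N by lia.
Qed.

Lemma kstep_up i : shifted_supp p f i ->
  kcoef k.+1 n (i + m) = kcoef k f i /\ kmor k.+1 n (i + m) = iter m kten (kmor k f i).
Proof. by move=> si; rewrite /= -/f -/m leq_addl addnK si. Qed.

Lemma kstep_down i : shifted_supp p f i ->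
  kcoef k.+1 n (i - m) = (i.+1 - m)%:R / i.+1%:R * kcoef k f i /\
  kmor k.+1 n (i - m) = iter m kbend (kmul i (kmor k f i) (symk i)).
Proof.
move=> si; have mi := shifted_supp_ge p_pr digits_gt1 si.
by rewrite /= -/f -/m down_branch // subnK.
Qed.

End Step.

(** Induction along the fathers. For a p-Adam, s is the place of the only non-zero digit; then n + 1
    < p^(s+1), so no j < n is linked to n and [symk n] is the linked part of the identity. *)
Lemma kmor_family k n : nonzero_digits p n.+1 = k.+1 ->
  family n (shifted_supp p n) (kcoef k n) (kmor k n) /\
  pintk p (family_sum n (shifted_supp p n) (kcoef k n) (kmor k n)).
Proof.
elim: k n => [|k IH] n nd.
  have [pn sE] := adam_shape p_pr nd; split.
    move=> i; rewrite sE => /eqP->; split=> //; first exact: eqv_id.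
    by rewrite [kmor 0 n n]/(kid n) ktr_id (kmul1l (@homk_id n)) (kmul1l (@homk_sym n)) symkk invr1 kscale1.
  have -> : family_sum n (shifted_supp p n) (kcoef 0 n) (kmor 0 n) = symk n.
    apply: kernelP => x y; rewrite /family_sum (bigD1 ord_max) ?sE //= big1 => [|i].
      by rewrite addr0 mul1r /sandwich ktr_id (kmul1r (@homk_sym n)) (kmul1l (@homk_sym n)).
    by rewrite sE -val_eqE /= => /andP[/eqP-> /eqP].
  have [K iK E] := isotypic_id n.
  apply: (block_integral p_pr pn (R := K)).
  - rewrite -[symk n]symkk -{2}[symk n]symkk; apply: isotypic_one; try exact: eqv_sym.
    by rewrite /block eqxx.
  - apply: isotypic_sub iK => j /andP[jn _].
    have /andP[_ lt] := trunc_log_bounds (prime_gt1 p_pr) (ltn0Sn n).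
    rewrite /block negb_or !modn_small; try by move: lt jn; rewrite -/(top_digit p n.+1); clear; lia.
    by rewrite (ltn_eqF jn) gtnNdvd //; move: lt jn; rewrite -/(top_digit p n.+1); clear; lia.
  - by rewrite -E => x y; apply: pint_nat.
have g1 := digits_gt1 nd; have fle := father_le nd.
have [fam pf] := IH _ (father_digits nd).
set f := father p n in fam pf fle; set m := (n - f)%N; have mE : (m + f = n)%N by rewrite subnK.
have mr : m = (n.+1 - high p n.+1)%N by rewrite /m father_rest.
have ge i : shifted_supp p f i -> (m <= i)%N by apply: shifted_supp_ge.
have m0 : (0 < m)%N by rewrite mr rest_gt0.
have step := @shifted_supp_step p p_pr n g1.
have disj i : shifted_supp p f i -> ~~ shifted_supp p f (i + m.*2)%N by apply: shifted_supp_disj.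
have up := @kstep_up k n; have down := @kstep_down k n nd.
split; first by rewrite -{1}mE; apply: (family_step fam).
rewrite -{1}mE; apply: (@family_step_pint _ _ _ _ _ _ _ _ fam m0 _ _ _ _ _ p (low_digit p n.+1)) => //.
- by rewrite mr rest_lt.
- by rewrite mr rest_dvd.
- by rewrite fatherS // high_dvd.
- by move=> i; apply: shifted_supp_mod.
Qed.

Lemma func_castH m n m' n' (T : Hom m n) : m = m' -> n = n' -> func (castH m' n' T) = func T.
Proof. by move=> em en; subst m' n'; rewrite castH_id. Qed.

Lemma iter_ten_scale m c K : iter m kten (kscale c K) = kscale c (iter m kten K).
Proof. by elim: m => //= m ->; rewrite ktenZ. Qed.

Lemma func_caps k r : exists b : bool,
  func (tensH (idH k) (capH r)) = kscale ((-1) ^+ b) (iter r kbend (kid (r + k))).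
Proof.
have [b1 h1] := func_juxt k k (cap_matching r); have [b2 h2] := nested_caps r k.
exists (b1 (+) b2); rewrite h1 signr_addb -kscaleA -h2; congr kscale; congr twist.
apply: kernelP => x y; rewrite (bigD1 (id_matching k)) //= big1 => [|f /negPf fi].
  by rewrite ffunE eqxx /eps sgb_id !mul1r addr0.
by rewrite ffunE fi !mul0r.
Qed.

Lemma kmor_homk k n j : nonzero_digits p n.+1 = k.+1 -> shifted_supp p n j -> homk n j (kmor k n j).
Proof. by move=> nd sj; have [fam _] := kmor_family nd; have [_ [] ] := fam j sj. Qed.

(** r is the number of caps in p_n^j: a downward step adds m of them and a factor (-1)^m to
    [lambda]. *)
Lemma pmor_lambda k n j : nonzero_digits p n.+1 = k.+1 -> shifted_supp p n j ->
  exists r (b : bool), [/\ n = (j + r.*2)%N, lambda_rec p k n j = (-1) ^+ r * kcoef k n j &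
    func (pmor_rec p k n j) = kscale ((-1) ^+ b) (kmor k n j)].
Proof.
elim: k n j => [|k IH] n j nd sj.
  have [_ sE] := adam_shape p_pr nd; move: sj; rewrite sE => /eqP->.
  exists 0%N, false; split; rewrite ?addn0 //= ?eqxx ?mulr1 //.
  by rewrite castH_id func_id kscale1.
have g1 := digits_gt1 nd; have fle := father_le nd; have ndf := father_digits nd.
have := sj; rewrite (shifted_supp_step p_pr g1) /=.
set f := father p n in fle ndf *; set m := (n - f)%N.
case: ifP => [/andP[mj si] _|_ /= si].
  have [r [b [fE lE pE]]] := IH _ _ ndf si; have [b' tE] := func_ten f (j - m) m.
  exists r, (b (+) b'); split=> //; first by move: fE mj fle; rewrite /m; clear; lia.
  rewrite func_castH; [|by rewrite /m subnKC|exact: subnK].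
  by rewrite tE pE iter_ten_scale kscaleA signr_addb mulrC.
rewrite si; have [r [b [fE lE pE]]] := IH _ _ ndf si; have := kmor_homk ndf si.
have jE : (j = j + m - m)%N by rewrite addnK.
have mE : (m + f = n)%N by rewrite subnK.
move: (j + m)%N jE (leq_addl j m) fE lE pE si => i jE mi fE lE pE si hq.
have i0 : i.+1%:R != 0 :> rat by rewrite pnatr_eq0.
have [b1 t1] := func_ten f i m; have [b2 t2] := func_caps (i - m) m.
exists (r + m)%N, (comp_sgb (f + m) (i + m) (i - m) (+) b1 (+) b2 (+) b); split.
- by move: fE mE jE mi; clear; lia.
- by rewrite lE (natrB _ (leqW mi)) exprD; ring.
rewrite func_castH; [|by rewrite addnC|by []].
rewrite func_comp t1 func_castH; [|by move: mi; clear; lia|by rewrite addn0].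
rewrite t2 func_compr func_JW pE !kmulZl iter_ten_scale !kmulZl !kmulZr !kscaleA.
have hs : homk f i (kmul i (kmor k f i) (symk i)) := homk_mul hq (@homk_sym i).
rewrite subnKC // [(i + m)%N]addnC iter_ten_bend_mul (kmul1r hs); congr kscale.
rewrite /comp_sign addnC !signr_addb; move: ((-1) ^+ b) ((-1) ^+ b1) ((-1) ^+ b2) ((-1) ^+ comp_sgb _ _ _) => *; ring.
Qed.

(** The sign b of p_n^j occurs twice. Composition and flip together contribute (-1)^r by
    [bar_comp_sign], which cancels the sign of [lambda]. *)
Lemma func_U k n j : nonzero_digits p n.+1 = k.+1 -> shifted_supp p n j ->
  func (lambda p n j *: U p n j) = kscale (kcoef k n j) (sandwich j (kmor k n j)).
Proof.
move=> nd sj; have [r [b [nE lE pE]]] := pmor_lambda nd sj.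
have sgn : comp_sgb n j n (+) bar_sgb n j = odd r.
  by have := bar_comp_sign j r; rewrite addn0 -nE.
rewrite funcZ /lambda /U /pmor nd /= lE func_comp func_compr func_bar func_JW pE.
rewrite kmulZr !kmulZl -[ktr _]/(kscale _ (ktr _)) !kmulZr !kscaleA /sandwich -kmulA; congr kscale.
rewrite -signr_odd -sgn signr_addb /comp_sign; have := sign_sqr b.
have := sign_sqr (comp_sgb n j n); have := sign_sqr (bar_sgb n j).
move: ((-1) ^+ b : rat) ((-1) ^+ bar_sgb n j : rat) ((-1) ^+ comp_sgb n j n : rat) (kcoef k n j).
move=> x y z c yy zz xx.
by transitivity ((y * y) * (z * z) * (x * x) * c); [ring|rewrite xx yy zz !mul1r].
Qed.

Lemma func_pJW k n : nonzero_digits p n.+1 = k.+1 ->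
  func (pJW p n) = family_sum n (shifted_supp p n) (kcoef k n) (kmor k n).
Proof.
move=> nd; apply: kernelP => x y; rewrite /pJW /family_sum.
rewrite (@big_morph _ _ (fun T : Hom n n => func T x y) 0 +%R 0 +%R).
- by apply: eq_bigr => j sj; rewrite (func_U nd sj).
- by move=> S T; rewrite funcD.
- by rewrite func0.
Qed.

End Assembly.

Theorem theorem2p8 (p : nat) (hp : prime p) (n : nat) (hn : (1 <= n)%N) :
  compH (pJW p n) (pJW p n) = pJW p n /\
  (forall h : matching n n, ~~ (p%:Z %| denq (pJW p n h))%Z).
Proof.
(* The non-zero digits above the lowest one give the depth of the recursion. *)
have nd := nonzero_digits_low hp (ltn0Sn n).
have [fam pf] := kmor_family hp nd; split.
  by apply: func_inj; rewrite func_compl (func_pJW hp nd) (family_idem fam).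
move=> h; apply: pint_denq; apply: (@saturation _ _ (pint p)).
- exact: (pint_int hp 0).
- exact: pint_add.
- exact: pint_opp.
- by move=> x y; rewrite (func_pJW hp nd).
Qed.
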